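(* Let $q\in\mathbb{C}$ with $0<|q|<1$, and let $f$ be a meromorphic function on $\mathbb{C}$ of order zero. If $f$ has three distinct Jackson-Picard values in $\mathbb{C}\cup\{\infty\}$, then $f$ must be a constant.
   Context: The Jackson difference operator is $D_qf(z)=\frac{f(qz)-f(z)}{qz-z}$. The order of a meromorphic function $f$ on $\mathbb{C}$ is $\sigma(f)=\limsup_{r\to\infty}\frac{\log T(r,f)}{\log r}$, where $T(r,f)$ is the Nevanlinna characteristic of $f$. For $a\in\mathbb{C}$, $\tilde n_J(r,f=a)$ is the sum of the integers $h-k$ over all points $z$ in $\{|z|<r\}$ at which $f(z)=a$, where $h$ is the multiplicity of the $a$-point $z$ and $k=\min\{h,k'\}$, with $k'$ the multiplicity of $z$ as a zero of $D_qf$ ($k'=0$ if $z$ is not a zero of $D_qf$). For $a=\infty$, $\tilde n_J(r,f=\infty)=\tilde n_J(r,\frac1f=0)$ is the sum of the integers $h-k$ over all poles $z$ of $f$ in $\{|z|<r\}$, where $h$ is the multiplicity of the pole and $k=\min\{h,k'\}$, with $k'$ the multiplicity of $z$ as a zero of $D_q(1/f)$. A value $a\in\mathbb{C}\cup\{\infty\}$ is called a Jackson-Picard value of $f$ if $\tilde n_J(r,f=a)=0$ (for all $r>0$). *)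

(* Defs.v *)
(* MathComp-Analysis; the complex plane is R[i] for R : realType. *)
From HB Require Import structures.
From mathcomp Require Import all_boot all_order all_algebra.
From mathcomp Require Import all_classical all_reals all_analysis.
From mathcomp.real_closed Require Import complex.

Set Implicit Arguments.
Unset Strict Implicit.
Unset Printing Implicit Defensive.

Import Order.TTheory GRing.Theory Num.Theory.
Import numFieldNormedType.Exports.

Local Open Scope classical_set_scope.
Local Open Scope complex_scope.
Local Open Scope ring_scope.

(* The alias R[i]^o carries the topology of R[i] and its structure of normed
   module over itself, so that [derivable g z 1] is complex differentiability
   of g at z.  The modulus with values in R is [Normc.normc]. *)
Notation Cplx R := (R[i]^o)%type.

(* The Riemann sphere: None is the point at infinity. *)
Definition sphere (R : realType) := option (Cplx R).

Section Meromorphic.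
Variable R : realType.
Local Notation C := (Cplx R).
Local Notation S := (sphere R).
Implicit Types (f F : C -> S) (g : C -> C) (z w q : C) (r t : R).

Definition holomorphic_near g z := \forall w \near z, derivable g w 1.

Definition modulus (p : S) : \bar R :=
  if p is Some w then (Normc.normc w)%:E else +oo%E.

Definition regular_at f z :=
  exists2 g, holomorphic_near g z & \forall w \near z, f w = Some (g w).

Definition pole_at f z :=
  [/\ f z = None,
      exists g, \forall w \near z^', f w = Some (g w) /\ derivable g w 1
    & modulus (f w) @[w --> z^'] --> +oo%E].

Definition meromorphic f := forall z, regular_at f z \/ pole_at f z.

Definition is_vanishing_order F z (h : nat) :=
  exists g, [/\ holomorphic_near g z, g z != 0
    & \forall w \near z^', F w = Some ((w - z) ^+ h * g w)].

(* Multiplicity of z as a zero of F; it is 0 when z is a pole of F or F does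
   not tend to 0 at z.  It depends only on F in a punctured neighbourhood of z,
   so the value of F at a removable singularity z is irrelevant.  When F
   vanishes identically near z there is no multiplicity and the value is 0. *)
Definition zero_mult F z : nat := xget 0%N (is_vanishing_order F z).

Definition recip f : C -> S := fun z =>
  match f z with
  | None => Some 0
  | Some w => if w == 0 then None else Some w^-1
  end.

Definition minus_cst f (a : C) : C -> S := fun z => omap (fun w => w - a) (f z).

Definition pole_mult f z : nat := zero_mult (recip f) z.

(* At z = 0, and at the isolated points where f z or f (q * z) is infinite, the
   value below need not be that of the meromorphic function D_q f; this does
   not affect [zero_mult]. *)
Definition jackson q f : C -> S := fun z =>
  match f (q * z), f z with
  | Some u, Some v => Some ((u - v) / (q * z - z))
  | _, _ => None
  end.

(* Nevanlinna theory *)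

Definition circle_pt r t : C := (r * cos t) +i* (r * sin t).

Definition log_plus (x : \bar R) : \bar R := maxe 0%E (lne x).

Definition proximity f r : \bar R :=
  (((2 * pi)^-1)%R%:E *
   \int[lebesgue_measure]_(t in `[0%R, (2 * pi)%R])
     log_plus (modulus (f (circle_pt r t))))%E.

Definition pole_count f r : \bar R :=
  (\esum_(z in [set z : C | (Normc.normc z <= r)%R]) (pole_mult f z)%:R%:E)%E.

Definition int_pole_count f r : \bar R :=
  (\int[lebesgue_measure]_(t in `]0%R, r[)
     ((pole_count f t - pole_count f 0%R) * (t^-1)%R%:E)
   + pole_count f 0%R * (ln r)%:E)%E.

Definition nevanlinna f r : \bar R := (proximity f r + int_pole_count f r)%E.

Definition mero_order f : \bar R :=
  limf_esup (fun r => lne (nevanlinna f r) * ((ln r)^-1)%R%:E)%E (pinfty_nbhs R).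

(* Jackson-Picard values *)

Definition jackson_defect q f (a : C) z : nat :=
  let h := zero_mult (minus_cst f a) z in
  let k := minn h (zero_mult (jackson q f) z) in
  (h - k)%N.

Definition nJ_fin q f (a : C) r : \bar R :=
  (\esum_(z in [set z : C | (Normc.normc z < r)%R /\ f z = Some a])
     (jackson_defect q f a z)%:R%:E)%E.

Definition nJ q f (a : S) r : \bar R :=
  if a is Some a' then nJ_fin q f a' r else nJ_fin q (recip f) 0 r.

Definition jackson_picard_value q f (a : S) :=
  forall r, 0 < r -> nJ q f a r = 0%E.

End Meromorphic.

(* Main.v *)
(* A Jackson-Picard value of a nonconstant f is omitted by f: if f z = a with
   multiplicity h, then D_q f vanishes at z to order at least h, hence
   f (q z) = a, and by iteration f = a along the sequence q ^ n z, which tends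
   to 0.  So f 0 = a, and either f is constant or 0 is an a-point of order h
   where D_q f has order h - 1.  It remains to prove that a meromorphic function
   omitting three values is constant; a Moebius map reduces this to the little
   Picard theorem for entire functions.  With two omitted values sent to -1, 1
   one has f = cosh F and F = i pi cosh H with H entire, and H omits a set that
   meets every disc of radius 11, so H is constant by an argument of Bloch and
   Landau.  The complex analysis rests on a discrete Goursat lemma, which gives a
   maximum principle that tolerates exceptional points; removable
   singularities, holomorphy of the derivative and convergence theorems follow
   by applying it to difference quotients. *)

(* Only one consequence of contour sums is exploited: a bound [N (f w) <= C * M] whose constant
   depends on the square and on [w] but not on [f]. It requires no exact integral, only a winding
   sum bounded away from 0. Tolerance of exceptional points matters because a difference quotient is
   at first known to be merely continuous at its centre. Contours are rectangles, hence squares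
   replace discs throughout. As to the double use of cosh: if f = cosh F omits -1 and 1, then F
   omits every multiple of i pi, so F / (i pi) omits all integers, in particular -1 and 1, and is
   itself of the form cosh H. Now H omits all preimages under cosh of the positive integers. These
   have bounded gaps: along the real axis because arcosh grows slowly, along the imaginary axis
   because of the period 2 i pi. A nonconstant entire function is close to an affine map on suitable
   squares whose images are as large as wanted, so it cannot omit such a set. *)
Require Import Defs.
From mathcomp Require Import all_boot all_order all_algebra.
From mathcomp Require Import all_classical all_reals all_analysis.
From mathcomp.real_closed Require Import complex.
From mathcomp Require Import ring lra.

Set Implicit Arguments.
Unset Strict Implicit.
Unset Printing Implicit Defensive.

Import Order.TTheory GRing.Theory Num.Theory.
Import numFieldNormedType.Exports.

Local Open Scope ring_scope.

(** * Complex differentiability *)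

Section Modulus.
Variable R : realType.
Local Notation K := (R[i]).
Local Notation N := (@Normc.normc R).
Implicit Types x y z w : K.

Lemma normc_ge0 z : 0 <= N z.
Proof. by case: z => a b; rewrite /= sqrtr_ge0. Qed.

Lemma normc_eq0 z : (N z == 0) = (z == 0).
Proof. by apply/eqP/eqP => [/Normc.eq0_normc //|->]; rewrite Normc.normc0. Qed.

Lemma normc_gt0 z : (0 < N z) = (z != 0).
Proof. by rewrite lt_def normc_ge0 andbT normc_eq0. Qed.

Lemma normcX x n : N (x ^+ n) = N x ^+ n.
Proof. by elim: n => [|n IH]; rewrite ?expr0 ?Normc.normc1 // !exprS Normc.normcM IH. Qed.

Lemma ler_normcD x y : N (x + y) <= N x + N y.
Proof. exact: le_normcD. Qed.

Lemma ler_normcB x y : N (x - y) <= N x + N y.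
Proof. by apply: le_trans (ler_normcD _ _) _; rewrite normcN. Qed.

Lemma normcBC x y : N (x - y) = N (y - x).
Proof. by rewrite -normcN opprB. Qed.

Lemma ler_normc_dist x y z : N (x - z) <= N (x - y) + N (y - z).
Proof.
have -> : x - z = (x - y) + (y - z) by ring.
exact: ler_normcD.
Qed.

Lemma lerB_normc x y : N x - N y <= N (x - y).
Proof.
have := ler_normcD (x - y) y; rewrite subrK => h; lra.
Qed.

Lemma ler_normc_sum (I : Type) (r : seq I) (P : pred I) (F : I -> K) :
  N (\sum_(i <- r | P i) F i) <= \sum_(i <- r | P i) N (F i).
Proof.
elim/big_ind2: _ => [|a x b y ha hb|//]; first by rewrite Normc.normc0.
by apply: le_trans (ler_normcD _ _) _; rewrite lerD.
Qed.

Lemma normc_real (a : R) : N a%:C%C = `|a|.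
Proof. by rewrite /= expr0n addr0 sqrtr_sqr. Qed.

Lemma normc_nat n : N n%:R = n%:R.
Proof.
by rewrite -(rmorph_nat (real_complex R)) normc_real ger0_norm.
Qed.

Lemma ler_normRe z : `|complex.Re z| <= N z.
Proof.
case: z => a b /=; rewrite -sqrtr_sqr ler_wsqrtr // lerDl sqr_ge0 //.
Qed.

Lemma ler_normIm z : `|complex.Im z| <= N z.
Proof.
case: z => a b /=; rewrite -sqrtr_sqr ler_wsqrtr // lerDr sqr_ge0 //.
Qed.

Lemma ler_normc_ReIm z : N z <= `|complex.Re z| + `|complex.Im z|.
Proof.
case: z => a b /=.
have h : 0 <= `|a| + `|b| by rewrite addr_ge0.
rewrite -[leRHS]ger0_norm // -sqrtr_sqr ler_wsqrtr //.
rewrite sqrrD !real_normK ?num_real // addrAC lerDl.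
by rewrite mulrn_wge0 // mulr_ge0.
Qed.

Lemma ReD x y : complex.Re (x + y) = complex.Re x + complex.Re y.
Proof. by case: x; case: y. Qed.
Lemma ImD x y : complex.Im (x + y) = complex.Im x + complex.Im y.
Proof. by case: x; case: y. Qed.
Lemma ReN x : complex.Re (- x) = - complex.Re x.
Proof. by case: x. Qed.
Lemma ImN x : complex.Im (- x) = - complex.Im x.
Proof. by case: x. Qed.
Lemma ReB x y : complex.Re (x - y) = complex.Re x - complex.Re y.
Proof. by rewrite ReD ReN. Qed.
Lemma ImB x y : complex.Im (x - y) = complex.Im x - complex.Im y.
Proof. by rewrite ImD ImN. Qed.
Lemma ReZ (a : R) x : complex.Re (a%:C%C * x) = a * complex.Re x.
Proof. by case: x => b c /=; rewrite mul0r subr0. Qed.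
Lemma ImZ (a : R) x : complex.Im (a%:C%C * x) = a * complex.Im x.
Proof. by case: x => b c /=; rewrite mul0r addr0. Qed.

End Modulus.

Section Continuity.
Variable R : realType.
Local Notation K := (R[i]).
Local Notation N := (@Normc.normc R).
Implicit Types (f g : K -> K) (x y z w l : K).

Lemma divr2_gt0 (a : R) : 0 < a -> 0 < a / 2.
Proof. by move=> a0; rewrite divr_gt0. Qed.

(** Stated with real radii and the real modulus, so that all estimates stay in the ordered field
    [R]; [near_normcP] makes the link with the topology of [R[i]]. *)
Definition ccont f z := forall e : R, 0 < e ->
  exists2 d : R, 0 < d & forall w, N (w - z) < d -> N (f w - f z) <= e.

Lemma ccont_cst c z : ccont (fun=> c) z.
Proof. by move=> e e0; exists 1 => // w _; rewrite subrr Normc.normc0 ltW. Qed.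

Lemma ccont_id z : ccont id z.
Proof. by move=> e e0; exists e => // w /ltW. Qed.

Lemma ccont_near f g z (d : R) : 0 < d -> 
  (forall w, N (w - z) < d -> f w = g w) -> ccont f z -> ccont g z.
Proof.
move=> d0 fg cf e e0; have [d' d'0 h] := cf e e0.
exists (Num.min d d'); first by rewrite lt_min d0.
move=> w; rewrite lt_min => /andP[h1 h2]; rewrite -!fg //; first exact: h.
by rewrite subrr Normc.normc0.
Qed.

Lemma eq_ccont f g z : f =1 g -> ccont f z -> ccont g z.
Proof. by move=> fg; apply: (@ccont_near f g z 1). Qed.

Lemma ccontD f g z : ccont f z -> ccont g z -> ccont (fun w => f w + g w) z.
Proof.
move=> cf cg e e0; have e20 : 0 < e / 2 by rewrite divr_gt0.
have [d d0 hd] := cf _ e20; have [d' d'0 hd'] := cg _ e20.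
exists (Num.min d d'); first by rewrite lt_min d0.
move=> w; rewrite lt_min => /andP[/hd h1 /hd' h2].
have -> : f w + g w - (f z + g z) = (f w - f z) + (g w - g z) by ring.
by have := ler_normcD (f w - f z) (g w - g z); lra.
Qed.

Lemma ccont_bnd f z : ccont f z -> exists2 d : R, 0 < d &
  forall w, N (w - z) < d -> N (f w) <= N (f z) + 1.
Proof.
move=> /(_ 1 ltr01) [d d0 h]; exists d => // w /h.
by have := lerB_normc (f w) (f z); lra.
Qed.

Lemma ccontM f g z : ccont f z -> ccont g z -> ccont (fun w => f w * g w) z.
Proof.
move=> cf cg e e0.
have [d1 d10 hd1] := ccont_bnd cf.
pose A := N (f z) + N (g z) + 1.
have A0 : 0 < A by have := normc_ge0 (f z); have := normc_ge0 (g z); rewrite /A; lra.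
have eA : 0 < e / (2 * A) by rewrite divr_gt0 // mulr_gt0.
have [d d0 hd] := cf _ eA; have [d' d'0 hd'] := cg _ eA.
exists (Num.min d1 (Num.min d d')); first by rewrite !lt_min d10 d0.
move=> w; rewrite !lt_min => /and3P[/hd1 h1 /hd h2 /hd' h3].
have -> : f w * g w - f z * g z = f w * (g w - g z) + (f w - f z) * g z by ring.
apply: le_trans (ler_normcD _ _) _; rewrite !Normc.normcM.
have -> : e = A * (e / (2 * A)) + (e / (2 * A)) * A by field; apply/lt0r_neq0.
apply: lerD; apply: ler_pM; rewrite ?normc_ge0 //.
  by have := normc_ge0 (g z); rewrite /A; lra.
by have := normc_ge0 (f z); rewrite /A; lra.
Qed.

Lemma ccontN f z : ccont f z -> ccont (fun w => - f w) z.
Proof.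
move=> cf; apply: (@eq_ccont (fun w => -1 * f w)) => [w|]; first by ring.
by apply: ccontM => //; exact: ccont_cst.
Qed.

Lemma ccontB f g z : ccont f z -> ccont g z -> ccont (fun w => f w - g w) z.
Proof. by move=> cf cg; apply: ccontD => //; exact: ccontN. Qed.

Lemma ccontV f z : f z != 0 -> ccont f z -> ccont (fun w => (f w)^-1) z.
Proof.
move=> fz cf e e0.
pose A := N (f z); have A0 : 0 < A by rewrite normc_gt0.
have [d d0 hd] := cf (A / 2) (divr2_gt0 A0).
have eA : 0 < e * A ^+ 2 / 2 by rewrite divr_gt0 // mulr_gt0 // exprn_gt0.
have [d' d'0 hd'] := cf _ eA.
exists (Num.min d d'); first by rewrite lt_min d0.
move=> w; rewrite lt_min => /andP[/hd h1 /hd' h2].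
have Nw : A / 2 <= N (f w).
  by have := lerB_normc (f z) (f w); rewrite normcBC -/A; lra.
have fw : f w != 0 by rewrite -normc_gt0; lra.
have -> : (f w)^-1 - (f z)^-1 = - (f w - f z) / (f w * f z).
  by field; rewrite fw fz.
rewrite Normc.normcM normcN Normc.normcV Normc.normcM -/A ler_pdivrMr; last by rewrite mulr_gt0 //; lra.
apply: le_trans h2 _.
have -> : e * A ^+ 2 / 2 = e * ((A / 2) * A) by rewrite expr2; ring.
by rewrite ler_wpM2l ?(ltW e0) // ler_wpM2r ?(ltW A0).
Qed.

Lemma ccont_comp f g z : ccont g z -> ccont f (g z) -> ccont (fun w => f (g w)) z.
Proof.
move=> cg cf e e0; have [d d0 hd] := cf e e0.
have [d' d'0 hd'] := cg (d / 2) (divr2_gt0 d0).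
exists d' => // w /hd' h; apply: hd; lra.
Qed.

Lemma ccontX f n z : ccont f z -> ccont (fun w => f w ^+ n) z.
Proof.
move=> cf; elim: n => [|n IH].
  by apply: (@eq_ccont (fun=> 1)) => [w|]; [rewrite expr0|exact: ccont_cst].
apply: (@eq_ccont (fun w => f w * f w ^+ n)) => [w|]; first by rewrite exprS.
exact: ccontM.
Qed.

Lemma ccont_neq0 f z : ccont f z -> f z != 0 -> exists2 d : R, 0 < d &
  forall w, N (w - z) < d -> f w != 0.
Proof.
move=> cf fz; have A0 : 0 < N (f z) by rewrite normc_gt0.
have [d d0 hd] := cf (N (f z) / 2) (divr2_gt0 A0).
exists d => // w /hd; rewrite -normc_gt0.
by have := lerB_normc (f z) (f w); rewrite normcBC; lra.
Qed.

(** The points [z + d / (n + 2)] are pairwise distinct, so a finite list cannot contain them all;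
    [n.+2] instead of [n.+1] keeps the distance strictly below [d]. *)
Lemma exists_near_neq z (d : R) (s : seq K) : 0 < d ->
  exists w, [/\ N (w - z) < d, w \notin s & w != z].
Proof.
move=> d0.
pose t n : K := z + ((d / (n.+2)%:R)%:C)%C.
have tI : injective t.
  move=> m n /addrI/complexI /(mulfI (lt0r_neq0 d0)) /invr_inj /eqP.
  by rewrite eqr_nat => /eqP [].
have [n nm] : exists n, t n \notin s.
  apply: contrapT => /forallNP h.
  have := @uniq_leq_size _ (map t (iota 0 (size s).+1)) s.
  rewrite map_inj_uniq // iota_uniq => /(_ isT).
  rewrite size_map size_iota ltnn => H; suff: false by [].
  by apply: H => x /mapP [n _ ->]; have /negP := h n; rewrite negbK.
have dn : 0 < d / n.+2%:R by rewrite divr_gt0.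
exists (t n); split=> //.
  rewrite /t addrC addKr normc_real gtr0_norm // ltr_pdivrMr //.
  by rewrite ltr_pMr // ltr1n.
rewrite /t -subr_eq0 addrC addKr -normc_gt0 normc_real gtr0_norm //.
Qed.

Lemma ler_ccont f z (A : R) (s : seq K) (d : R) : 0 < d -> ccont f z ->
  (forall w, N (w - z) < d -> w \notin s -> w != z -> N (f w) <= A) -> N (f z) <= A.
Proof.
move=> d0 cf h; apply/ler_addgt0Pr => e e0.
have [d' d'0 hd'] := cf e e0.
have dd : 0 < Num.min d d' by rewrite lt_min d0.
have [w []] := exists_near_neq z s dd.
rewrite lt_min => /andP[h1 h2] ws wz.
have := hd' w h2; have := h w h1 ws wz; have := lerB_normc (f z) (f w).
by rewrite normcBC; lra.
Qed.

Lemma ccont_lim_unique f g z (d : R) : 0 < d -> ccont f z -> ccont g z ->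
  (forall w, N (w - z) < d -> w != z -> f w = g w) -> f z = g z.
Proof.
move=> d0 cf cg h; apply/eqP; rewrite -subr_eq0 -normc_eq0 eq_le normc_ge0 andbT.
apply: (@ler_ccont (fun w => f w - g w) z 0 [::] d) => //.
  exact: ccontB.
by move=> w wd _ wz; rewrite h // subrr Normc.normc0.
Qed.

End Continuity.

Section Derivative.
Variable R : realType.
Local Notation K := (R[i]).
Local Notation N := (@Normc.normc R).
Implicit Types (f g : K -> K) (x y z w l : K).

Definition slope f z l w := if w == z then l else (f w - f z) / (w - z).

(* Caratheodory's formulation of complex differentiability *)
Definition cder f z l := ccont (slope f z l) z.

Lemma slope_at f z l : slope f z l z = l.
Proof. by rewrite /slope eqxx. Qed.

Lemma slope_neq f z l w : w != z -> slope f z l w = (f w - f z) / (w - z).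
Proof. by rewrite /slope => /negbTE ->. Qed.

Lemma slopeE f z l w : f w = f z + slope f z l w * (w - z).
Proof.
have [->|wz] := eqVneq w z; first by rewrite subrr mulr0 addr0.
rewrite slope_neq // divfK ?subr_eq0 //; ring.
Qed.

Lemma cderP f z l q : ccont q z -> q z = l ->
  (forall w, f w - f z = q w * (w - z)) -> cder f z l.
Proof.
move=> cq qz h; apply: (eq_ccont _ cq) => w; rewrite /slope.
by have [->//|wz] := eqVneq w z; rewrite h mulfK // subr_eq0.
Qed.

Lemma cder_eq f z l l' : l = l' -> cder f z l -> cder f z l'.
Proof. by move=> ->. Qed.

Lemma cder_near f g z l (d : R) : 0 < d ->
  (forall w, N (w - z) < d -> f w = g w) -> cder f z l -> cder g z l.
Proof.
move=> d0 fg; apply: (ccont_near d0) => w wd; rewrite /slope fg //.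
by rewrite (fg z) // subrr Normc.normc0.
Qed.

Lemma eq_cder f g z l : f =1 g -> cder f z l -> cder g z l.
Proof. by move=> fg; apply: (@cder_near f g z l 1). Qed.

Lemma cder_ccont f z l : cder f z l -> ccont f z.
Proof.
move=> df; apply: (@eq_ccont _ (fun w => f z + slope f z l w * (w - z))).
  by move=> w; rewrite -slopeE.
apply: ccontD; first exact: ccont_cst.
by apply: ccontM => //; apply: ccontB; [exact: ccont_id|exact: ccont_cst].
Qed.

Lemma cder_unique f z l l' : cder f z l -> cder f z l' -> l = l'.
Proof.
move=> h h'; rewrite -(slope_at f z l) -[RHS](slope_at f z l').
apply: (ccont_lim_unique ltr01 h h') => w _ wz.
by rewrite !slope_neq.
Qed.

Lemma cder_cst c z : cder (fun=> c) z 0.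
Proof.
by apply: (cderP (q := fun=> 0)) => [|//|w]; [exact: ccont_cst|rewrite subrr mul0r].
Qed.

Lemma cder_id z : cder id z 1.
Proof.
by apply: (cderP (q := fun=> 1)) => [|//|w]; [exact: ccont_cst|rewrite mul1r].
Qed.

Lemma cderD f g z l l' : cder f z l -> cder g z l' ->
  cder (fun w => f w + g w) z (l + l').
Proof.
move=> df dg.
apply: (cderP (q := fun w => slope f z l w + slope g z l' w)).
- exact: ccontD.
- by rewrite !slope_at.
- by move=> w; rewrite (slopeE f z l w) (slopeE g z l' w); ring.
Qed.

Lemma cderM f g z l l' : cder f z l -> cder g z l' ->
  cder (fun w => f w * g w) z (l * g z + f z * l').
Proof.
move=> df dg.
apply: (cderP (q := fun w => slope f z l w * g w + f z * slope g z l' w)).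
- apply: ccontD; apply: ccontM => //; first exact: cder_ccont dg.
  exact: ccont_cst.
- by rewrite !slope_at.
- by move=> w; rewrite (slopeE f z l w) (slopeE g z l' w); ring.
Qed.

Lemma cderZ c f z l : cder f z l -> cder (fun w => c * f w) z (c * l).
Proof.
move=> df; apply: (cder_eq (l := 0 * f z + c * l)); first by ring.
by apply: cderM => //; exact: cder_cst.
Qed.

Lemma cderN f z l : cder f z l -> cder (fun w => - f w) z (- l).
Proof.
move=> /(cderZ (-1)); rewrite mulN1r; apply: eq_cder => w; exact: mulN1r.
Qed.

Lemma cderB f g z l l' : cder f z l -> cder g z l' ->
  cder (fun w => f w - g w) z (l - l').
Proof. by move=> df dg; apply: cderD => //; exact: cderN. Qed.

Lemma cderV f z l : f z != 0 -> cder f z l ->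
  cder (fun w => (f w)^-1) z (- l / f z ^+ 2).
Proof.
move=> fz df.
have [d d0 hd] := ccont_neq0 (cder_ccont df) fz.
(* [cderP] asks for a factorisation valid at every [w], so [f] is first replaced by a function
   without zeros that agrees with it near [z]; any nonzero default would do. *)
pose h w := if f w == 0 then 2 * f z else f w.
have hE w : N (w - z) < d -> f w = h w by rewrite /h => /hd /negbTE ->.
have hz : h z = f z by rewrite -hE // subrr Normc.normc0.
have h0 w : h w != 0.
  by rewrite /h; case: ifPn => // _; rewrite mulf_neq0 // pnatr_eq0.
have dh : cder h z l by exact: cder_near d0 hE df.
suff : cder (fun w => (h w)^-1) z (- l / f z ^+ 2).
  by apply: (cder_near d0) => w /hE ->.
apply: (cderP (q := fun w => - slope h z l w * ((h w)^-1 * (f z)^-1))).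
- apply: ccontM; first exact: ccontN.
  apply: ccontM; last exact: ccont_cst.
  by apply: ccontV; rewrite ?hz //; exact: cder_ccont dh.
- by rewrite slope_at hz expr2 invfM.
- move=> w; have [->|wz] := eqVneq w z; first by rewrite !subrr mulr0.
  rewrite slope_neq // hz; field; rewrite subr_eq0 wz h0 fz; by [].
Qed.

Lemma cder_comp f g z l l' : cder g z l' -> cder f (g z) l ->
  cder (fun w => f (g w)) z (l * l').
Proof.
move=> dg df.
apply: (cderP (q := fun w => slope f (g z) l (g w) * slope g z l' w)).
- apply: ccontM => //.
  apply: (@ccont_comp _ (slope f (g z) l) g) => //; exact: cder_ccont dg.
- by rewrite !slope_at.
- move=> w; rewrite (slopeE f (g z) l (g w)) [X in _ * (X - _)](slopeE g z l' w); ring.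
Qed.

Lemma cderX f n z l : cder f z l ->
  cder (fun w => f w ^+ n) z (n%:R * f z ^+ n.-1 * l).
Proof.
move=> df; elim: n => [|n IH].
  by rewrite !mul0r; apply: eq_cder (cder_cst 1 z) => w; rewrite expr0.
apply: (eq_cder (f := fun w => f w * f w ^+ n)) => [w|]; first by rewrite exprS.
apply: (cder_eq _ (cderM df IH)).
case: n {IH} => [|n] /=; first by rewrite expr0; ring.
by rewrite -!natr1 exprS; ring.
Qed.

Lemma cder_mul_root f z : ccont f z -> cder (fun w => f w * (w - z)) z (f z).
Proof.
by move=> cf; apply: (cderP cf) => // w; rewrite subrr mulr0 subr0.
Qed.

Lemma cder_slope f z l w l' : w != z -> cder f w l' ->
  cder (slope f z l) w ((l' - slope f z l w) / (w - z)).
Proof.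
move=> wz df.
have wz0 : 0 < N (w - z) by rewrite normc_gt0 subr_eq0.
have wz1 : w - z != 0 by rewrite subr_eq0.
apply: (@cder_near (fun u => (f u - f z) * (u - z)^-1) _ _ _ (N (w - z))) => //.
  move=> u uw; rewrite slope_neq //; apply: contraTneq uw => ->.
  by rewrite normcBC -leNgt.
have d1 : cder (fun u => u - z) w (1 - 0) by apply: cderB; [exact: cder_id|exact: cder_cst].
apply: (cder_eq _ (cderM (cderB df (cder_cst (f z) w)) (cderV (f := fun u => u - z) wz1 d1))).
by rewrite slope_neq //; field.
Qed.

Definition hol f z := exists l, cder f z l.

Definition cderive f z : K := xget 0 [set l | cder f z l].

Lemma cderiveP f z : hol f z -> cder f z (cderive f z).
Proof. exact: xgetPex. Qed.

Lemma cderiveE f z l : cder f z l -> cderive f z = l.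
Proof. by move=> h; exact: (cder_unique (cderiveP (ex_intro _ l h)) h). Qed.

Lemma hol_ccont f z : hol f z -> ccont f z.
Proof. by case=> l; exact: cder_ccont. Qed.

Lemma hol_near f g z (d : R) : 0 < d ->
  (forall w, N (w - z) < d -> f w = g w) -> hol f z -> hol g z.
Proof. by move=> d0 h [l dl]; exists l; exact: cder_near d0 h dl. Qed.
Lemma eq_hol f g z : f =1 g -> hol f z -> hol g z.
Proof. by move=> h [l dl]; exists l; exact: eq_cder h dl. Qed.
Lemma hol_cst c z : hol (fun=> c) z.
Proof. by exists 0; exact: cder_cst. Qed.
Lemma hol_id z : hol id z.
Proof. by exists 1; exact: cder_id. Qed.
Lemma holD f g z : hol f z -> hol g z -> hol (fun w => f w + g w) z.
Proof. by move=> [l dl] [l' dl']; eexists; apply: cderD; eassumption. Qed.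
Lemma holM f g z : hol f z -> hol g z -> hol (fun w => f w * g w) z.
Proof. by move=> [l dl] [l' dl']; eexists; apply: cderM; eassumption. Qed.
Lemma holB f g z : hol f z -> hol g z -> hol (fun w => f w - g w) z.
Proof. by move=> [l dl] [l' dl']; eexists; apply: cderB; eassumption. Qed.
Lemma holV f z : f z != 0 -> hol f z -> hol (fun w => (f w)^-1) z.
Proof. by move=> fz [l dl]; eexists; apply: cderV; eassumption. Qed.
Lemma holX f n z : hol f z -> hol (fun w => f w ^+ n) z.
Proof. by move=> [l dl]; eexists; apply: cderX; eassumption. Qed.
Lemma hol_comp f g z : hol g z -> hol f (g z) -> hol (fun w => f (g w)) z.
Proof. by move=> [l dl] [l' dl']; eexists; apply: cder_comp; eassumption. Qed.
Lemma hol_mul_root f z : ccont f z -> hol (fun w => f w * (w - z)) z.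
Proof. by move=> cf; exists (f z); exact: cder_mul_root. Qed.
Lemma hol_slope f z l w : w != z -> hol f w -> hol (slope f z l) w.
Proof. by move=> wz [l' dl]; eexists; apply: cder_slope; eassumption. Qed.

End Derivative.

(** * Completeness and bisection *)

Section Completeness.
Variable R : realType.
Local Notation K := (R[i]).
Local Notation N := (@Normc.normc R).

Lemma cauchy_seq_lim (x : nat -> R) :
  (forall e, 0 < e -> exists n0 : nat, forall m n, (n0 <= m)%N -> (n0 <= n)%N ->
     `|x m - x n| <= e) ->
  exists l, forall e, 0 < e -> exists n0 : nat, forall n, (n0 <= n)%N -> `|x n - l| <= e.
Proof.
move=> h.
have cx : cvgn x.
  apply/cauchy_cvgP/cauchy_ballP => e e0.
  have [n0 hn] := h (e / 2) (divr2_gt0 e0).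
  exists ([set y | exists2 n, (n0 <= n)%N & y = x n], [set y | exists2 n, (n0 <= n)%N & y = x n])%classic.
    by split; exists n0 => // n /= nn; exists n.
  move=> [y1 y2] /= [[m mm ->] [n nn ->]].
  by rewrite /ball /= (le_lt_trans (hn _ _ mm nn)) //; lra.
exists (limn x) => e e0.
have /cvgrPdist_le /(_ e e0) [n0 _ hn] : (x @ \oo --> limn x)%classic by [].
by exists n0 => n /hn /=; rewrite distrC.
Qed.

Lemma cauchy_seqC (x : nat -> K) :
  (forall e, 0 < e -> exists n0 : nat, forall m n, (n0 <= m)%N -> (n0 <= n)%N ->
     N (x m - x n) <= e) ->
  exists l, forall e, 0 < e -> exists n0 : nat, forall n, (n0 <= n)%N -> N (x n - l) <= e.
Proof.
move=> h.
have [a ha] : exists a, forall e, 0 < e -> exists n0 : nat, forall n, (n0 <= n)%N ->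
    `|complex.Re (x n) - a| <= e.
  apply: cauchy_seq_lim => e /h [n0 hn]; exists n0 => m n mm nn.
  by rewrite -ReB (le_trans (ler_normRe _)) // hn.
have [b hb] : exists b, forall e, 0 < e -> exists n0 : nat, forall n, (n0 <= n)%N ->
    `|complex.Im (x n) - b| <= e.
  apply: cauchy_seq_lim => e /h [n0 hn]; exists n0 => m n mm nn.
  by rewrite -ImB (le_trans (ler_normIm _)) // hn.
exists (a +i* b)%C => e e0.
have [n1 h1] := ha _ (divr2_gt0 e0); have [n2 h2] := hb _ (divr2_gt0 e0).
exists (maxn n1 n2) => n; rewrite geq_max => /andP[/h1 i1 /h2 i2].
apply: le_trans (ler_normc_ReIm _) _; rewrite ReB ImB /=; lra.
Qed.

Lemma cauchy_limC (f : K -> K) (z : K) :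
  (forall e, 0 < e -> exists2 d : R, 0 < d & forall u v, N (u - z) < d -> N (v - z) < d ->
     u != z -> v != z -> N (f u - f v) <= e) ->
  exists l, forall e, 0 < e -> exists2 d : R, 0 < d & forall u, N (u - z) < d -> u != z ->
     N (f u - l) <= e.
Proof.
move=> h.
pose x (n : nat) : K := z + ((n.+1%:R^-1 : R)%:C)%C.
have xz n : x n != z.
  by rewrite /x -subr_eq0 addrC addKr -normc_gt0 normc_real gtr0_norm.
have xd d : 0 < d -> exists n0 : nat, forall n, (n0 <= n)%N -> N (x n - z) < d.
  move=> d0; exists (Num.truncn d^-1) => n nn.
  rewrite /x addrC addKr normc_real gtr0_norm // -[d]invrK ltf_pV2 ?posrE ?invr_gt0 //.
  by rewrite (lt_le_trans (truncnS_gt _)) // ler_nat.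
have [l hl] : exists l, forall e, 0 < e -> exists n0 : nat, forall n, (n0 <= n)%N ->
    N (f (x n) - l) <= e.
  apply: cauchy_seqC => e /h [d d0 hd]; have [n0 hn0] := xd d d0.
  by exists n0 => m n /hn0 mm /hn0 nn; apply: hd.
exists l => e e0.
have [d d0 hd] := h _ (divr2_gt0 e0); have [n0 hn0] := xd d d0.
have [n1 hn1] := hl _ (divr2_gt0 e0).
exists d => // u ud uz; pose n := maxn n0 n1.
apply: le_trans (ler_normc_dist _ (f (x n)) _) _.
have h1 : N (f u - f (x n)) <= e / 2 by apply: hd => //; apply: hn0; rewrite leq_maxl.
have h2 : N (f (x n) - l) <= e / 2 by apply: hn1; rewrite leq_maxr.
lra.
Qed.

End Completeness.

Section Bisection.
Variable R : realType.
Local Notation K := (R[i]).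
Local Notation N := (@Normc.normc R).

(** Every left end point lies below every right end point, so the supremum of the left ones belongs
    to all the intervals. *)
Lemma nested_dyadic (a : nat -> R) :
  (forall n, a n <= a n.+1) ->
  (forall n, a n.+1 + (2 ^+ n.+1)^-1 <= a n + (2 ^+ n)^-1) ->
  exists s, forall n, a n <= s <= a n + (2 ^+ n)^-1.
Proof.
move=> h1 h2.
have m1 m n : a n <= a (m + n)%N.
  by elim: m => [|m IH]; rewrite ?add0n // addSn (le_trans IH).
have m2 m n : a (m + n)%N + (2 ^+ (m + n))^-1 <= a n + (2 ^+ n)^-1.
  by elim: m => [|m IH]; rewrite ?add0n // addSn (le_trans _ IH).
have p2 n : 0 < (2 ^+ n)^-1 :> R by rewrite invr_gt0 exprn_gt0.
have ub n m : a m <= a n + (2 ^+ n)^-1.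
  have [mn|nm] := leqP m n.
    by have := m1 (n - m)%N m; rewrite subnK //; have := p2 n; lra.
  by have := m2 (m - n)%N n; rewrite subnK ?(ltnW nm) //; have := p2 m; lra.
have hs : has_sup (range a).
  by split; [exists (a 0%N); exists 0%N|exists (a 0%N + (2 ^+ 0)^-1) => _ [m _ <-]].
exists (sup (range a)) => n; apply/andP; split.
  by apply: ub_le_sup; [case: hs|exists n].
by apply: ge_sup; [case: hs|move=> _ [m _ <-]].
Qed.

Definition dyadic_square n (a b s t : R) :=
  (a <= s <= a + (2 ^+ n)^-1) && (b <= t <= b + (2 ^+ n)^-1).

(** In its applications [P] says that a wanted conclusion fails on a subsquare; the common point of
    the selected squares is where a local hypothesis contradicts that failure. *)
Lemma bisection (P : nat -> R -> R -> Prop) : P 0%N 0 0 ->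
  (forall n a b, P n a b -> exists i j : bool,
    P n.+1 (a + i%:R / 2 ^+ n.+1) (b + j%:R / 2 ^+ n.+1)) ->
  exists s t, forall n, exists a b, [/\ P n a b, 0 <= a /\ a + (2 ^+ n)^-1 <= 1,
    0 <= b /\ b + (2 ^+ n)^-1 <= 1 & dyadic_square n a b s t].
Proof.
move=> P0 PS.
have /choice [F hF] (x : nat * (R * R)) : exists ij : bool * bool, P x.1 x.2.1 x.2.2 ->
    P x.1.+1 (x.2.1 + ij.1%:R / 2 ^+ x.1.+1) (x.2.2 + ij.2%:R / 2 ^+ x.1.+1).
  have [/PS [i [j h]]|h] := pselect (P x.1 x.2.1 x.2.2); first by exists (i, j).
  (* [choice] needs a total function; where [P] fails the child is arbitrary, and [Pst] shows that
     the construction never gets there. *)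
  by exists (true, true).
pose st := fix st n : R * R := if n is m.+1 then
  let ij := F (m, st m) in
  ((st m).1 + ij.1%:R / 2 ^+ m.+1, (st m).2 + ij.2%:R / 2 ^+ m.+1) else (0, 0).
have Pst n : P n (st n).1 (st n).2.
  by elim: n => [//|n IH]; exact: (hF (n, st n)).
have p2 n : 0 < (2 ^+ n)^-1 :> R by rewrite invr_gt0 exprn_gt0.
have half n : (2 ^+ n)^-1 = (2 ^+ n.+1)^-1 + (2 ^+ n.+1)^-1 :> R.
  by rewrite exprS invfM; lra.
have up (i : bool) (c : R) n : c <= c + i%:R / 2 ^+ n.
  by rewrite lerDl mulr_ge0 // ltW.
have dn (i : bool) (c : R) n : c + i%:R / 2 ^+ n.+1 + (2 ^+ n.+1)^-1 <= c + (2 ^+ n)^-1.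
  by rewrite (half n) -addrA lerD2l lerD2r ler_piMl ?(ltW (p2 _)) //; case: i.
have [s hs] := @nested_dyadic (fun n => (st n).1) (fun n => up _ _ _) (fun n => dn _ _ _).
have [t ht] := @nested_dyadic (fun n => (st n).2) (fun n => up _ _ _) (fun n => dn _ _ _).
exists s, t => n; exists (st n).1, (st n).2.
split => //; last by rewrite /dyadic_square hs ht.
  elim: n => [|n [IH1 IH2]]; first by rewrite /= expr0 invr1 add0r.
  by split; [apply: le_trans IH1 _; exact: up|apply: le_trans IH2; exact: dn].
elim: n => [|n [IH1 IH2]]; first by rewrite /= expr0 invr1 add0r.
by split; [apply: le_trans IH1 _; exact: up|apply: le_trans IH2; exact: dn].
Qed.

Definition par_pt (z D E : K) (s t : R) : K := z + (s%:C * D + t%:C * E)%C.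

Definition par z D E (u : K) := exists s t : R,
  [/\ 0 <= s <= 1, 0 <= t <= 1 & u = par_pt z D E s t].

Lemma dyadic_small (L d : R) : 0 <= L -> 0 < d -> exists n, L / 2 ^+ n < d.
Proof.
move=> L0 d0; exists (Num.truncn (L / d)).
rewrite ltr_pdivrMr ?exprn_gt0 // -ltr_pdivrMl // mulrC.
apply: lt_le_trans (truncnS_gt _) _.
by rewrite -natrX ler_nat ltn_expl.
Qed.

Lemma ler_par_pt_dist z D E (s t s' t' h : R) : `|s - s'| <= h -> `|t - t'| <= h ->
  N (par_pt z D E s t - par_pt z D E s' t') <= (N D + N E) * h.
Proof.
move=> hs ht.
have -> : par_pt z D E s t - par_pt z D E s' t' =
    (s - s')%:C%C * D + (t - t')%:C%C * E.
  by rewrite /par_pt !rmorphB /=; ring.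
apply: le_trans (ler_normcD _ _) _; rewrite !Normc.normcM !normc_real mulrDl.
by apply: lerD; rewrite mulrC ler_wpM2l ?normc_ge0.
Qed.

Lemma dyadic_squareP n (a b s t s' t' : R) :
  dyadic_square n a b s t -> dyadic_square n a b s' t' ->
  `|s - s'| <= (2 ^+ n)^-1 /\ `|t - t'| <= (2 ^+ n)^-1.
Proof.
rewrite /dyadic_square => /andP[/andP[h1 h2] /andP[h3 h4]] /andP[/andP[h5 h6] /andP[h7 h8]].
by split; rewrite ler_norml; apply/andP; split; lra.
Qed.

(** Compactness by bisection: an unbounded function stays unbounded on arbitrarily small subsquares,
    against continuity at their common point. *)
Lemma par_bounded (f : K -> K) z D E : (forall u, par z D E u -> ccont f u) ->
  exists M, forall u, par z D E u -> N (f u) <= M.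
Proof.
move=> cf; apply: contrapT => unb.
pose P n (a b : R) := ~ exists M, forall s t, dyadic_square n a b s t ->
  N (f (par_pt z D E s t)) <= M.
have [||s [t hst]] := @bisection P.
- move=> [M hM]; apply: unb; exists M => u [s [t [s01 t01 ->]]].
  by apply: hM; rewrite /dyadic_square expr0 invr1 !add0r s01 t01.
- move=> n a b; apply: contra_notP => /forallNP hi.
  have {}hi (i j : bool) : exists M, forall s t,
      dyadic_square n.+1 (a + i%:R / 2 ^+ n.+1) (b + j%:R / 2 ^+ n.+1) s t ->
      N (f (par_pt z D E s t)) <= M.
    by apply: contrapT => h; apply: (hi i); exists j.
  have [M1 h1] := hi false false; have [M2 h2] := hi false true.
  have [M3 h3] := hi true false; have [M4 h4] := hi true true.
  exists (Num.max (Num.max M1 M2) (Num.max M3 M4)) => s t.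
  rewrite !le_max.
  have half : (2 ^+ n)^-1 = (2 ^+ n.+1)^-1 + (2 ^+ n.+1)^-1 :> R.
    by rewrite exprS invfM; lra.
  rewrite /dyadic_square half => /andP[/andP[q1 q2] /andP[q3 q4]].
  have [q5|/ltW q5] := leP s (a + (2 ^+ n.+1)^-1);
  have [q6|/ltW q6] := leP t (b + (2 ^+ n.+1)^-1).
  + by rewrite h1 // /dyadic_square !mul0r !addr0 q1 q3 q5 q6.
  + by rewrite h2 ?orbT // /dyadic_square !mul0r !mul1r !addr0 q1 q5 q6 /=; lra.
  + by rewrite h3 ?orbT // /dyadic_square !mul0r !mul1r !addr0 q3 q5 q6 /=; lra.
  + by rewrite h4 ?orbT // /dyadic_square !mul1r q5 q6 /=; lra.
- have pst : par z D E (par_pt z D E s t).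
    exists s, t; have [a [b [_ [a0 a1] [b0 b1] /andP[/andP[? ?] /andP[? ?]]]]] := hst 0%N.
    by split=> //; apply/andP; split; lra.
  have [d d0 hd] := ccont_bnd (cf _ pst).
  have L0 : 0 <= N D + N E by rewrite addr_ge0 // normc_ge0.
  have [n hn] := dyadic_small L0 d0.
  have [a [b [Pn _ _ hsq]]] := hst n.
  apply: Pn; exists (N (f (par_pt z D E s t)) + 1) => s' t' hsq'.
  apply: hd; apply: le_lt_trans hn; apply: ler_par_pt_dist.
    by case: (dyadic_squareP hsq' hsq).
  by case: (dyadic_squareP hsq' hsq).
Qed.

End Bisection.

(** * Goursat *)

Section Goursat.
Variable R : realType.
Local Notation K := (R[i]).
Local Notation N := (@Normc.normc R).
Implicit Types (f g : K -> K) (z D E F : K).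

(* Trapezoidal sum for the integral of f along the segment [z, z + D]: exact on
   affine f and additive under bisection, so no integral is ever needed. *)
Definition edge f z D n : K :=
  \sum_(j < n) (f (z + j%:R / n%:R * D) + f (z + j.+1%:R / n%:R * D)) / 2 * (D / n%:R).

(** The boundary traversed once: the minus signs reverse the far side parallel to [D] and the near
    side parallel to [F]. *)
Definition contour f z D F n :=
  edge f z D n + edge f (z + D) F n - edge f (z + F) D n - edge f z F n.

Lemma natC_neq0 n : (0 < n)%N -> n%:R != 0 :> K.
Proof. by rewrite pnatr_eq0 -lt0n. Qed.

Lemma edge_double f z D n : (0 < n)%N ->
  edge f z D (n + n) = edge f z (D / 2) n + edge f (z + D / 2) (D / 2) n.
Proof.
move=> n0; have n0' := natC_neq0 n0.
have nn : n%:R + n%:R != 0 :> K by rewrite -natrD natC_neq0 // addn_gt0 n0.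
rewrite /edge big_split_ord /=; congr (_ + _); apply: eq_bigr => j _.
  have h (m : nat) : z + m%:R / (n + n)%:R * D = z + m%:R / n%:R * (D / 2).
    by rewrite natrD; field; rewrite n0' nn.
  by rewrite !h natrD; field; rewrite n0' nn.
have h (m : nat) : z + (n + m)%:R / (n + n)%:R * D = z + D / 2 + m%:R / n%:R * (D / 2).
  by rewrite !natrD; field; rewrite n0' nn.
by rewrite -addnS !h natrD; field; rewrite n0' nn.
Qed.

(** Each interior side occurs twice, with the same nodes and opposite signs, and cancels. *)
Lemma contour_double f z D F n : (0 < n)%N ->
  contour f z D F (n + n) = contour f z (D / 2) (F / 2) n
    + contour f (z + D / 2) (D / 2) (F / 2) n
    + contour f (z + F / 2) (D / 2) (F / 2) n
    + contour f (z + D / 2 + F / 2) (D / 2) (F / 2) n.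
Proof.
move=> n0; rewrite /contour !edge_double //.
have -> : z + D / 2 + D / 2 = z + D by field.
have -> : z + F / 2 + F / 2 = z + F by field.
have -> : z + F / 2 + D / 2 = z + D / 2 + F / 2 by ring.
have -> : z + D / 2 + F / 2 + D / 2 = z + D + F / 2 by field.
have -> : z + D / 2 + F / 2 + F / 2 = z + F + D / 2 by field.
ring.
Qed.

Lemma edgeB f g z D n : edge (fun u => f u - g u) z D n = edge f z D n - edge g z D n.
Proof. by rewrite /edge -sumrB; apply: eq_bigr => j _; ring. Qed.

Lemma edgeZ c g z D n : edge (fun u => c * g u) z D n = c * edge g z D n.
Proof. by rewrite /edge mulr_sumr; apply: eq_bigr => j _; ring. Qed.

Lemma contourB f g z D F n :
  contour (fun u => f u - g u) z D F n = contour f z D F n - contour g z D F n.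
Proof. by rewrite /contour !edgeB; ring. Qed.

Definition seg_pt z D (s : R) : K := z + s%:C%C * D.

Lemma frac_itv n (j : nat) : (j <= n)%N -> exists2 s : R, 0 <= s <= 1 &
  s%:C%C = j%:R / n%:R :> K.
Proof.
move=> jn; exists (j%:R / n%:R); last by rewrite rmorphM fmorphV !rmorph_nat.
have [->|n0] := posnP n; first by rewrite invr0 mulr0 lexx ler01.
by rewrite divr_ge0 //= ler_pdivrMr ?ltr0n // mul1r ler_nat.
Qed.

Lemma edge_ext f g z D n :
  (forall s : R, 0 <= s <= 1 -> f (seg_pt z D s) = g (seg_pt z D s)) ->
  edge f z D n = edge g z D n.
Proof.
move=> h; apply: eq_bigr => j _.
have [s s01 es] := frac_itv (ltnW (ltn_ord j)).
have [t t01 et] := frac_itv (ltn_ord j).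
by rewrite -es -et -/(seg_pt z D s) -/(seg_pt z D t) !h.
Qed.

Lemma edge_bound f z D n (M : R) :
  (forall s : R, 0 <= s <= 1 -> N (f (seg_pt z D s)) <= M) ->
  N (edge f z D n) <= M * N D.
Proof.
move=> h; have M0 : 0 <= M.
  by apply: le_trans (h 0 _); rewrite ?normc_ge0 // lexx ler01.
have [->|n0] := posnP n.
  by rewrite /edge big_ord0 Normc.normc0 mulr_ge0 // normc_ge0.
apply: le_trans (ler_normc_sum _ _ _) _.
apply: (@le_trans _ _ (\sum_(j < n) M * (N D / n%:R))); last first.
  rewrite sumr_const card_ord -[leLHS]mulr_natr le_eqVlt; apply/orP; left; apply/eqP.
  by field; rewrite pnatr_eq0 -lt0n.
apply: ler_sum => j _; rewrite !Normc.normcM !Normc.normcV !normc_nat.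
apply: ler_wpM2r; first by rewrite divr_ge0 // normc_ge0.
have [s s01 es] := frac_itv (ltnW (ltn_ord j)).
have [t t01 et] := frac_itv (ltn_ord j).
rewrite -es -et; have := h s s01; have := h t t01.
by have := ler_normcD (f (seg_pt z D s)) (f (seg_pt z D t)); rewrite /seg_pt; lra.
Qed.

(** On an affine function each trapezoid equals an increment of the quadratic primitive [G], so the
    sum telescopes. *)
Lemma edge_affine (a b : K) z D n : (0 < n)%N ->
  edge (fun u => a * u + b) z D n =
  (a * (z + D) ^+ 2 / 2 + b * (z + D)) - (a * z ^+ 2 / 2 + b * z).
Proof.
move=> n0; have n0' := natC_neq0 n0.
pose G (j : nat) := a * (z + j%:R / n%:R * D) ^+ 2 / 2 + b * (z + j%:R / n%:R * D).
have -> : edge (fun u => a * u + b) z D n = \sum_(0 <= j < n) (G j.+1 - G j).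
  rewrite big_mkord; apply: eq_bigr => j _; rewrite /G -!natr1; field; exact: n0'.
rewrite telescope_sumr // /G mul0r mul0r addr0 divff // mul1r //.
Qed.

Lemma contour_affine (a b : K) z D F n : (0 < n)%N ->
  contour (fun u => a * u + b) z D F n = 0.
Proof. move=> n0; rewrite /contour !edge_affine //; ring. Qed.

Lemma par_pt_seg1 z D F s : seg_pt z D s = par_pt z D F s 0.
Proof. by rewrite /par_pt /seg_pt rmorph0 mul0r addr0. Qed.
Lemma par_pt_seg2 z D F s : seg_pt z F s = par_pt z D F 0 s.
Proof. by rewrite /par_pt /seg_pt rmorph0 mul0r add0r. Qed.
Lemma par_pt_seg3 z D F s : seg_pt (z + F) D s = par_pt z D F s 1.
Proof. by rewrite /par_pt /seg_pt rmorph1; ring. Qed.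
Lemma par_pt_seg4 z D F s : seg_pt (z + D) F s = par_pt z D F 1 s.
Proof. by rewrite /par_pt /seg_pt rmorph1; ring. Qed.

Lemma contour_bound f z D F n (M : R) :
  (forall u, par z D F u -> N (f u) <= M) ->
  N (contour f z D F n) <= 2 * (N D + N F) * M.
Proof.
move=> h.
have i0 : 0 <= (0 : R) <= 1 by rewrite lexx ler01.
have i1 : 0 <= (1 : R) <= 1 by rewrite lexx ler01.
have b1 : N (edge f z D n) <= M * N D.
  apply: edge_bound => s s01; rewrite (par_pt_seg1 _ _ F); apply: h.
  by exists s, 0.
have b2 : N (edge f z F n) <= M * N F.
  apply: edge_bound => s s01; rewrite (par_pt_seg2 _ D F); apply: h.
  by exists 0, s.
have b3 : N (edge f (z + F) D n) <= M * N D.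
  apply: edge_bound => s s01; rewrite (par_pt_seg3 _ D F); apply: h.
  by exists s, 1.
have b4 : N (edge f (z + D) F n) <= M * N F.
  apply: edge_bound => s s01; rewrite (par_pt_seg4 _ D F); apply: h.
  by exists 1, s.
rewrite /contour; have := ler_normcB (edge f z D n + edge f (z + D) F n - edge f (z + F) D n) (edge f z F n).
have := ler_normcB (edge f z D n + edge f (z + D) F n) (edge f (z + F) D n).
by have := ler_normcD (edge f z D n) (edge f (z + D) F n); lra.
Qed.

(** The numbers of steps are powers of 2 because one bisection of the contour halves them. *)
Definition contour_small f z D F := forall e : R, 0 < e -> exists k0 : nat,
  forall k, (k0 <= k)%N -> N (contour f z D F (2 ^ k)) <= e.

Lemma contour_child f z D F (e1 e2 e3 e4 : R) (k1 k2 k3 k4 : nat) :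
  (forall k, (k1 <= k)%N -> N (contour f z (D / 2) (F / 2) (2 ^ k)) <= e1) ->
  (forall k, (k2 <= k)%N -> N (contour f (z + D / 2) (D / 2) (F / 2) (2 ^ k)) <= e2) ->
  (forall k, (k3 <= k)%N -> N (contour f (z + F / 2) (D / 2) (F / 2) (2 ^ k)) <= e3) ->
  (forall k, (k4 <= k)%N -> N (contour f (z + D / 2 + F / 2) (D / 2) (F / 2) (2 ^ k)) <= e4) ->
  exists k0 : nat, forall k, (k0 <= k)%N -> N (contour f z D F (2 ^ k)) <= e1 + e2 + e3 + e4.
Proof.
move=> h1 h2 h3 h4; exists (maxn (maxn k1 k2) (maxn k3 k4)).+1 => -[//|k].
rewrite ltnS !geq_max => /andP[/andP[/h1 i1 /h2 i2] /andP[/h3 i3 /h4 i4]].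
rewrite expnS mul2n -addnn contour_double ?expn_gt0 //.
apply: le_trans (ler_normcD _ _) _; apply: lerD => //.
apply: le_trans (ler_normcD _ _) _; apply: lerD => //.
apply: le_trans (ler_normcD _ _) _; exact: lerD.
Qed.

Lemma par_ptD z D F s t s' t' :
  par_pt (par_pt z D F s t) D F s' t' = par_pt z D F (s + s') (t + t').
Proof. by rewrite /par_pt !rmorphD /=; ring. Qed.

Lemma par_ptZ z D F n s t :
  par_pt z (D / 2 ^+ n) (F / 2 ^+ n) s t = par_pt z D F (s / 2 ^+ n) (t / 2 ^+ n).
Proof.
rewrite /par_pt !rmorphM /= !fmorphV !rmorphXn /= !rmorph_nat.
field; by rewrite expf_neq0 // pnatr_eq0.
Qed.

(** Goursat's argument: if the sums over a contour do not eventually stay below [e], those over some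
    child do not eventually stay below [e / 4]. Near the common point [f] differs from an affine
    function by a small multiple of the distance, and at level [n] perimeter times diameter is of
    order [1 / 4 ^ n]. *)
Lemma goursat f z D F : (forall u, par z D F u -> hol f u) -> contour_small f z D F.
Proof.
move=> hf e e0; apply: contrapT => nsm.
pose P n (a b : R) := ~ exists k0 : nat, forall k, (k0 <= k)%N ->
  N (contour f (par_pt z D F a b) (D / 2 ^+ n) (F / 2 ^+ n) (2 ^ k)) <= e / 4 ^+ n.
have p2 n : 2 ^+ n != 0 :> K by rewrite expf_neq0 // pnatr_eq0.
have p2R n : 2 ^+ n != 0 :> R by rewrite expf_neq0 // pnatr_eq0.
have [||s [t hst]] := @bisection R P.
- rewrite /P !expr0 !divr1 /par_pt !rmorph0 !mul0r !addr0; exact: nsm.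
- move=> n a b; apply: contra_notP => /forallNP hi.
  have {}hi (i j : bool) : exists k0 : nat, forall k, (k0 <= k)%N ->
      N (contour f (par_pt z D F (a + i%:R / 2 ^+ n.+1) (b + j%:R / 2 ^+ n.+1))
         (D / 2 ^+ n.+1) (F / 2 ^+ n.+1) (2 ^ k)) <= e / 4 ^+ n.+1.
    by apply: contrapT => h; apply: (hi i); exists j.
  have hh (X : K) : X / 2 ^+ n / 2 = X / 2 ^+ n.+1 by rewrite exprS; field; exact: p2.
  have zz (i j : bool) : par_pt z D F (a + i%:R / 2 ^+ n.+1) (b + j%:R / 2 ^+ n.+1)
      = par_pt z D F a b + i%:R * (D / 2 ^+ n.+1) + j%:R * (F / 2 ^+ n.+1).
    rewrite -par_ptD -par_ptZ {1}/par_pt !rmorph_nat; ring.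
  have [k1] := hi false false; have [k2] := hi true false.
  have [k3] := hi false true; have [k4] := hi true true.
  rewrite !zz !mul0r !mul1r !addr0 -!hh => h4 h3 h2 h1.
  have [k0 hk0] := contour_child h1 h2 h3 h4; exists k0 => k /hk0.
  suff -> : e / 4 ^+ n = e / 4 ^+ n.+1 + e / 4 ^+ n.+1 + e / 4 ^+ n.+1 + e / 4 ^+ n.+1 by [].
  by rewrite exprS invfM; lra.
- have pst : par z D F (par_pt z D F s t).
    exists s, t; have [a [b [_ [a0 a1] [b0 b1] /andP[/andP[? ?] /andP[? ?]]]]] := hst 0%N.
    by split=> //; apply/andP; split; lra.
  set p := par_pt z D F s t in pst.
  have [l dl] := hf _ pst.
  have L0 : 0 <= N D + N F by rewrite addr_ge0 // normc_ge0.
  set L := N D + N F in L0.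
  (* [2 * L ^+ 2] bounds perimeter times diameter at level 0; the [+ 1] keeps the denominator
     positive when [L = 0]. *)
  have eL : 0 < e / (2 * L ^+ 2 + 1).
    by rewrite divr_gt0 // ltr_wpDl // mulr_ge0 // sqr_ge0.
  have [d d0 hd] := dl _ eL.
  have [n hn] := dyadic_small L0 d0.
  have [a [b [Pn _ _ hsq]]] := hst n.
  apply: Pn; exists 0%N => k _.
  (* The affine part has contour sum 0; what remains is the slope minus its limit, times [u - p]. *)
  pose r u := f u - (l * u + (f p - l * p)).
  have -> : contour f (par_pt z D F a b) (D / 2 ^+ n) (F / 2 ^+ n) (2 ^ k) =
            contour r (par_pt z D F a b) (D / 2 ^+ n) (F / 2 ^+ n) (2 ^ k).
    by rewrite /r contourB contour_affine ?subr0 // expn_gt0.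
  apply: (@le_trans _ _ (2 * (L / 2 ^+ n) * (e / (2 * L ^+ 2 + 1) * (L / 2 ^+ n)))).
    rewrite [X in 2 * X * _](_ : _ = N (D / 2 ^+ n) + N (F / 2 ^+ n)); last first.
      by rewrite !Normc.normcM !Normc.normcV !normcX !normc_nat -mulrDl.
    apply: contour_bound => u [s' [t' [s01 t01 ->]]].
    rewrite par_ptZ par_ptD; set w := par_pt _ _ _ _ _.
    have sq : dyadic_square n a b (a + s' / 2 ^+ n) (b + t' / 2 ^+ n).
      have q0 : 0 <= (2 ^+ n)^-1 :> R by rewrite invr_ge0 exprn_ge0.
      case/andP: s01 => ? ?; case/andP: t01 => ? ?.
      by rewrite /dyadic_square !lerDl !lerD2l !mulr_ge0 //= !ler_piMl.
    have [m1 m2] := dyadic_squareP sq hsq.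
    have wp : N (w - p) <= L / 2 ^+ n by apply: ler_par_pt_dist.
    have -> : r w = (slope f p l w - slope f p l p) * (w - p).
      by rewrite /r slope_at {1}(slopeE f p l w); ring.
    rewrite Normc.normcM; apply: ler_pM; rewrite ?normc_ge0 //; apply: hd; exact: le_lt_trans hn.
  have -> : (4 : R) = 2 * 2 by lra.
  rewrite exprMn.
  have B0 : 0 < 2 * L ^+ 2 + 1 :> R by rewrite ltr_wpDl // mulr_ge0 // sqr_ge0.
  have -> : 2 * (L / 2 ^+ n) * (e / (2 * L ^+ 2 + 1) * (L / 2 ^+ n)) =
     (e / (2 ^+ n * 2 ^+ n)) * (2 * L ^+ 2 / (2 * L ^+ 2 + 1)).
    by field; rewrite p2R lt0r_neq0.
  rewrite ler_piMr //; first by rewrite divr_ge0 ?ltW // mulr_gt0 // exprn_gt0.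
  by rewrite ler_pdivrMr // mul1r lerDl ler01.
Qed.

Definition real_indep (D F : K) := forall s t : R, s%:C%C * D + t%:C%C * F = 0 ->
  s = 0 /\ t = 0.

Lemma real_indep_half D F : real_indep D F -> real_indep (D / 2) (F / 2).
Proof.
move=> h s t hst; apply: h.
have -> : s%:C%C * D + t%:C%C * F = 2 * (s%:C%C * (D / 2) + t%:C%C * (F / 2)) by field.
by rewrite hst mulr0.
Qed.

(* Only the child square at the corner z may contribute, and its perimeter tends
   to 0 under repeated bisection. *)
Lemma goursat_corner f z D F (M : R) : real_indep D F ->
  (forall u, par z D F u -> N (f u) <= M) ->
  (forall u, par z D F u -> u != z -> hol f u) -> contour_small f z D F.
Proof.
move=> ind bf hf.
have M0 : 0 <= M.
  apply: le_trans (normc_ge0 _) (bf z _).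
  by exists 0, 0; rewrite lexx ler01 /par_pt !rmorph0 !mul0r !addr0.
suff H m : forall e : R, 0 < e -> exists k0 : nat, forall k, (k0 <= k)%N ->
    N (contour f z D F (2 ^ k)) <= 2 * (N D + N F) * M / 2 ^+ m + e.
  move=> e e0.
  have L0 : 0 <= 2 * (N D + N F) * M by rewrite !mulr_ge0 // addr_ge0 ?normc_ge0.
  have [m hm] := dyadic_small L0 (divr2_gt0 e0).
  have [k0 hk0] := H m _ (divr2_gt0 e0); exists k0 => k /hk0; lra.
elim: m D F ind bf hf => [|m IH] D F ind bf hf e e0.
  exists 0%N => k _; rewrite expr0 divr1.
  by apply: le_trans (contour_bound _ bf) _; rewrite lerDl ltW.
have chsub (i j : bool) u : par (z + i%:R * (D / 2) + j%:R * (F / 2)) (D / 2) (F / 2) u ->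
    exists s t, [/\ i%:R / 2 <= s <= 1, j%:R / 2 <= t <= 1 & u = par_pt z D F s t].
  move=> [s [t [/andP[s0 s1] /andP[t0 t1] ->]]].
  exists ((s + i%:R) / 2), ((t + j%:R) / 2); split.
  - by apply/andP; split; case: i => /=; lra.
  - by apply/andP; split; case: j => /=; lra.
  - by rewrite /par_pt !rmorphM !rmorphD /= !fmorphV !rmorph_nat; field.
have chpar (i j : bool) u : par (z + i%:R * (D / 2) + j%:R * (F / 2)) (D / 2) (F / 2) u ->
    par z D F u.
  move=> /chsub [s [t [/andP[s0 s1] /andP[t0 t1] ->]]]; exists s, t; split=> //.
    by apply/andP; split=> //; apply: le_trans s0; rewrite divr_ge0.
  by apply/andP; split=> //; apply: le_trans t0; rewrite divr_ge0.
have chne (i j : bool) u : i || j ->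
    par (z + i%:R * (D / 2) + j%:R * (F / 2)) (D / 2) (F / 2) u -> u != z.
  move=> ij /chsub [s [t [/andP[s0 s1] /andP[t0 t1] ->]]].
  apply: contraTneq ij; rewrite /par_pt => /eqP; rewrite -subr_eq0.
  have -> : z + (s%:C%C * D + t%:C%C * F) - z = s%:C%C * D + t%:C%C * F by ring.
  move=> /eqP /ind [es et]; move: s0 t0; rewrite es et.
  by case: i; case: j => //=; lra.
have sm (i j : bool) : i || j ->
    contour_small f (z + i%:R * (D / 2) + j%:R * (F / 2)) (D / 2) (F / 2).
  by move=> ij; apply: goursat => u hu; apply: hf; [exact: chpar hu|exact: chne hu].
have e40 : 0 < e / 4 by rewrite divr_gt0.
have [k2 h2] := sm true false isT _ e40.
have [k3 h3] := sm false true isT _ e40.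
have [k4 h4] := sm true true isT _ e40.
have z00 : z + false%:R * (D / 2) + false%:R * (F / 2) = z by rewrite !mul0r !addr0.
have [] := IH (D / 2) (F / 2) (real_indep_half ind) _ _ _ e40.
- by move=> u hu; apply: bf; apply: (chpar false false); rewrite z00.
- by move=> u hu; apply: hf; apply: (chpar false false); rewrite z00.
move=> k1 h1.
move: h2 h3 h4; rewrite !mul0r !mul1r !addr0 => h2 h3 h4.
have [k0 hk0] := contour_child h1 h2 h3 h4; exists k0 => k /hk0.
suff -> : 2 * (N (D / 2) + N (F / 2)) * M / 2 ^+ m = 2 * (N D + N F) * M / 2 ^+ m.+1 by lra.
rewrite !Normc.normcM Normc.normcV normc_nat exprS; field.
by rewrite expf_neq0 // pnatr_eq0.
Qed.

End Goursat.

(** * A bound by boundary values *)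

Section CauchyBound.
Variable R : realType.
Local Notation K := (R[i]).
Local Notation N := (@Normc.normc R).
Local Notation Re := (@complex.Re R).
Local Notation Im := (@complex.Im R).
Implicit Types (f g : K -> K) (z w d e : K).

(** The imaginary part of the sum is an average of values of [Im (f * e)] at the nodes. *)
Lemma Im_edge_ge f z e n (c : R) : (0 < n)%N ->
  (forall s : R, 0 <= s <= 1 -> c <= Im (f (seg_pt z e s) * e)) ->
  c <= Im (edge f z e n).
Proof.
move=> n0 h.
have ImS (F : 'I_n -> K) : Im (\sum_(j < n) F j) = \sum_(j < n) Im (F j).
  by elim/big_ind2: _ => // x y x' y' <- <-; rewrite ImD.
have -> : c = \sum_(j < n) c / n%:R.
  by rewrite sumr_const card_ord -[RHS]mulr_natr divfK // pnatr_eq0 -lt0n.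
rewrite /edge ImS; apply: ler_sum => j _.
have [s s01 es] := frac_itv R (ltnW (ltn_ord j)).
have [t t01 et] := frac_itv R (ltn_ord j).
rewrite -es -et; set x := f _; set y := f _.
have -> : (x + y) / 2 * (e / n%:R) = ((2 * n%:R)^-1)%:C%C * (x * e + y * e).
  rewrite fmorphV rmorphM !rmorph_nat; field.
  by rewrite pnatr_eq0 -lt0n.
rewrite ImZ ImD invfM.
have := h s s01; have := h t t01; rewrite /seg_pt -/x -/y => h1 h2.
have -> : c / n%:R = 2^-1 / n%:R * (c + c) by field; rewrite pnatr_eq0 -lt0n.
by apply: ler_wpM2l; [rewrite divr_ge0|exact: lerD].
Qed.

Lemma Im_edge_le f z e n (c : R) : (0 < n)%N ->
  (forall s : R, 0 <= s <= 1 -> Im (f (seg_pt z e s) * e) <= - c) ->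
  Im (edge f z e n) <= - c.
Proof.
move=> n0 h.
suff : c <= Im (edge (fun u => -1 * f u) z e n) by rewrite edgeZ mulN1r ImN; lra.
apply: Im_edge_ge => // s /h; rewrite mulN1r mulNr ImN; lra.
Qed.

Lemma pair_neq0 (x y : R) : x ^+ 2 + y ^+ 2 != 0 -> (x +i* y)%C != 0.
Proof. by apply: contraNneq => -[-> ->]; rewrite expr0n addr0. Qed.

Lemma div_kernel (x y u v : R) : x ^+ 2 + y ^+ 2 != 0 ->
  (u +i* v)%C / (x +i* y)%C =
  (((u * x + v * y) / (x ^+ 2 + y ^+ 2)) +i* ((v * x - u * y) / (x ^+ 2 + y ^+ 2)))%C.
Proof.
move=> h; have nz : (x +i* y)%C != 0.
  exact: pair_neq0.
apply: (mulIf nz); rewrite divfK //.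
by apply/eqP; rewrite eq_complex /=; apply/andP; split; apply/eqP; field.
Qed.

(** The two sides not through [w]. The sides through [w] are shared by neighbouring corners and
    cancel when four corners surround [w]. *)
Definition outer f w d e n := edge f (w + d) e n - edge f (w + e) d n.

(** A rectangle with vertex [w]: [e] is [d] turned counterclockwise by a right angle and rescaled by
    [tau]. [Q] is the ambient region, [B] its boundary, and [dl] a lower bound for the distance from
    [w] to the two outer sides. *)
Definition corner (Q B : K -> Prop) w (dl : R) d e :=
  [/\ d != 0 , exists2 tau : R, 0 < tau & e = (0 +i* tau)%C * d,
      forall u, par w d e u -> Q u,
      forall s : R, 0 <= s <= 1 ->
        B (seg_pt (w + d) e s) /\ dl <= N (seg_pt (w + d) e s - w) &
      forall s : R, 0 <= s <= 1 ->
        B (seg_pt (w + e) d s) /\ dl <= N (seg_pt (w + e) d s - w)].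

(* Each of the four corners around w turns by a positive angle; this replaces
   the exact value 2 i pi of the integral of 1 / (u - w). *)
Lemma corner_winding Q B w dl d e : corner Q B w dl d e ->
  exists2 c : R, 0 < c & forall n, (0 < n)%N ->
    c <= Im (outer (fun u => (u - w)^-1) w d e n).
Proof.
move=> [d0 [tau tau0 eE] _ _ _].
have B0 : 0 < 1 + tau ^+ 2 :> R by rewrite ltr_wpDr // sqr_ge0.
(* On each outer side the integrand is worst at the vertex [w + d + e] opposite to [w], where it
   still contributes [tau / (1 + tau ^+ 2)]. *)
exists (2 * (tau / (1 + tau ^+ 2))); first by rewrite mulr_gt0 // divr_gt0.
move=> n n0; rewrite /outer ImB.
have h1 : tau / (1 + tau ^+ 2) <= Im (edge (fun u => (u - w)^-1) (w + d) e n).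
  apply: Im_edge_ge => // s /andP[s0 s1].
  have D0 : 0 < 1 + (s * tau) ^+ 2 :> R by rewrite ltr_wpDr // sqr_ge0.
  have D0' : 1 ^+ 2 + (s * tau) ^+ 2 != 0 :> R by rewrite expr1n lt0r_neq0.
  have -> : (seg_pt (w + d) e s - w)^-1 * e = (0 +i* tau)%C / (1 +i* (s * tau))%C.
    have -> : seg_pt (w + d) e s - w = (1 +i* (s * tau))%C * d.
      rewrite /seg_pt eE mulrA.
      have -> : s%:C%C * (0 +i* tau)%C = (1 +i* (s * tau))%C - 1.
        by apply/eqP; rewrite eq_complex /=; apply/andP; split; apply/eqP; ring.
      ring.
    have nz := pair_neq0 D0'.
    by rewrite eE invfM mulrACA mulVf // mulr1 mulrC.
  rewrite div_kernel //= expr1n mul0r subr0 mulr1.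
  rewrite ler_wpM2l ?(ltW tau0) // lef_pV2 ?posrE // lerD2l exprMn ler_piMl ?sqr_ge0 //.
  by rewrite expr_le1.
have h2 : Im (edge (fun u => (u - w)^-1) (w + e) d n) <= - (tau / (1 + tau ^+ 2)).
  apply: Im_edge_le => // s /andP[s0 s1].
  have D0 : 0 < s ^+ 2 + tau ^+ 2 :> R by rewrite ltr_wpDl ?sqr_ge0 // exprn_gt0.
  have D0' : s ^+ 2 + tau ^+ 2 != 0 :> R by rewrite lt0r_neq0.
  have -> : (seg_pt (w + e) d s - w)^-1 * d = (1 +i* 0)%C / (s +i* tau)%C.
    have -> : seg_pt (w + e) d s - w = (s +i* tau)%C * d.
      rewrite /seg_pt eE.
      have -> : (s +i* tau)%C = s%:C%C + (0 +i* tau)%C.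
        by apply/eqP; rewrite eq_complex /=; apply/andP; split; apply/eqP; ring.
      ring.
    have -> : (1 +i* 0)%C = 1 :> K by [].
    have nz := pair_neq0 D0'.
    by rewrite invfM -mulrA mulVf // mulr1 mul1r.
  rewrite div_kernel //= mul0r sub0r mul1r mulNr lerN2.
  rewrite ler_wpM2l ?(ltW tau0) // lef_pV2 ?posrE // lerD2r.
  by rewrite expr_le1.
lra.
Qed.

Lemma corner_indep Q B w dl d e : corner Q B w dl d e -> real_indep d e.
Proof.
move=> [d0 [tau tau0 ->] _ _ _] s t.
have -> : s%:C%C * d + t%:C%C * ((0 +i* tau)%C * d) = (s +i* (t * tau))%C * d.
  have -> : (s +i* (t * tau))%C = s%:C%C + t%:C%C * (0 +i* tau)%C.
    by apply/eqP; rewrite eq_complex /=; apply/andP; split; apply/eqP; ring.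
  ring.
move=> /eqP; rewrite mulf_eq0 (negbTE d0) orbF eq_complex /= => /andP[/eqP -> /eqP].
by move=> /eqP; rewrite mulf_eq0 (gt_eqF tau0) orbF => /eqP ->.
Qed.

Lemma corner_outer Q B w dl d e f (M : R) : corner Q B w dl d e -> 0 < dl ->
  (forall u, B u -> N (f u) <= M) -> forall l n,
  outer (slope f w l) w d e n =
    outer (fun u => f u / (u - w)) w d e n - f w * outer (fun u => (u - w)^-1) w d e n
  /\ N (outer (fun u => f u / (u - w)) w d e n) <= M / dl * (N d + N e).
Proof.
move=> [d0 _ _ h1 h2] dl0 fM l n.
have ne u : dl <= N (u - w) -> u != w.
  by move=> h; rewrite -subr_eq0 -normc_gt0 (lt_le_trans dl0).
split.
  have sl z u : (forall s : R, 0 <= s <= 1 -> dl <= N (seg_pt z u s - w)) ->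
      edge (slope f w l) z u n = edge (fun v => f v / (v - w)) z u n
         - f w * edge (fun v => (v - w)^-1) z u n.
    move=> h; rewrite -edgeZ -edgeB; apply: edge_ext => s /h /ne sw.
    by rewrite slope_neq // mulrBl.
  rewrite /outer !sl; first ring.
    by move=> s /h2 [].
  by move=> s /h1 [].
have M0 : 0 <= M.
  have i0 : 0 <= (0 : R) <= 1 by rewrite lexx ler01.
  by have [/fM h _] := h1 0 i0; apply: le_trans h; exact: normc_ge0.
have sq_bd z u : (forall s : R, 0 <= s <= 1 ->
      B (seg_pt z u s) /\ dl <= N (seg_pt z u s - w)) ->
    N (edge (fun v => f v / (v - w)) z u n) <= M / dl * N u.
  move=> h; apply: edge_bound => s /h [/fM hf hd].
  rewrite Normc.normcM Normc.normcV; apply: ler_pM; rewrite ?normc_ge0 ?invr_ge0 ?normc_ge0 //.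
  by rewrite lef_pV2 ?posrE // (lt_le_trans dl0).
apply: le_trans (ler_normcB _ _) _.
rewrite mulrDr addrC; apply: lerD; exact: sq_bd.
Qed.

(** At [w] the slope is only known to be continuous, so the form of Goursat's lemma with an
    exceptional corner is needed. *)
Lemma corner_small Q B w dl d e f l : corner Q B w dl d e ->
  (forall u, Q u -> hol f u) -> cder f w l -> contour_small (slope f w l) w d e.
Proof.
move=> hc hf dw; have ind := corner_indep hc; case: hc => _ _ hQ _ _.
have [M hM] : exists M, forall u, par w d e u -> N (slope f w l u) <= M.
  apply: par_bounded => u hu; have [->|uw] := eqVneq u w; first exact: dw.
  by apply: hol_ccont; apply: hol_slope => //; exact/hf/hQ.
apply: goursat_corner ind hM _ => u hu uw.
by apply: hol_slope => //; exact/hf/hQ.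
Qed.

(** Cauchy's formula as an inequality. The contour sums of the slope at [w] become small and their
    inner sides cancel, so [f w] times the sum of the kernel is close to the sum of [f u / (u - w)]
    over the outer sides. The kernel sum has modulus at least [b] because its four imaginary parts
    are all positive. *)
Lemma four_corners Q B w dl d0 d1 d2 d3 : 0 < dl -> Q w ->
  corner Q B w dl d0 d1 -> corner Q B w dl d1 d2 ->
  corner Q B w dl d2 d3 -> corner Q B w dl d3 d0 ->
  exists C : R, forall f M, (forall u, Q u -> hol f u) ->
    (forall u, B u -> N (f u) <= M) -> N (f w) <= C * M.
Proof.
move=> dl0 Qw c0 c1 c2 c3.
have [b0 b00 hb0] := corner_winding c0; have [b1 b10 hb1] := corner_winding c1.
have [b2 b20 hb2] := corner_winding c2; have [b3 b30 hb3] := corner_winding c3.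
pose b := b0 + b1 + b2 + b3.
(* Each of the four vectors is a side of two corners, hence the factor 2. *)
pose S := 2 * (N d0 + N d1 + N d2 + N d3).
exists (S / dl / b) => f M hf fM.
have bpos : 0 < b by rewrite /b; lra.
have [l dw] := hf w Qw.
suff H : N (f w) * b <= S / dl * M.
  by rewrite mulrAC ler_pdivlMr.
apply/ler_addgt0Pr => ep ep0.
have ep4 : 0 < ep / 4 by rewrite divr_gt0.
have [k0 s0] := corner_small c0 hf dw ep4; have [k1 s1] := corner_small c1 hf dw ep4.
have [k2 s2] := corner_small c2 hf dw ep4; have [k3 s3] := corner_small c3 hf dw ep4.
pose k := maxn (maxn k0 k1) (maxn k2 k3).
have {}s0 := s0 k; have {}s1 := s1 k; have {}s2 := s2 k; have {}s3 := s3 k.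
rewrite !leq_max !leqnn ?orbT in s0 s1 s2 s3.
move: (s0 isT) (s1 isT) (s2 isT) (s3 isT) => {}s0 {}s1 {}s2 {}s3.
set n := (2 ^ k)%N in s0 s1 s2 s3.
have n0 : (0 < n)%N by rewrite expn_gt0.
have [q0 p0] := corner_outer c0 dl0 fM l n; have [q1 p1] := corner_outer c1 dl0 fM l n.
have [q2 p2] := corner_outer c2 dl0 fM l n; have [q3 p3] := corner_outer c3 dl0 fM l n.
have v0 := hb0 n n0; have v1 := hb1 n n0.
have v2 := hb2 n n0; have v3 := hb3 n n0.
set W0 := outer (fun u => (u - w)^-1) w d0 d1 n in q0 v0; set W1 := outer (fun u => (u - w)^-1) w d1 d2 n in q1 v1.
set W2 := outer (fun u => (u - w)^-1) w d2 d3 n in q2 v2; set W3 := outer (fun u => (u - w)^-1) w d3 d0 n in q3 v3.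
set F0 := outer (fun u => f u / (u - w)) w d0 d1 n in q0 p0; set F1 := outer (fun u => f u / (u - w)) w d1 d2 n in q1 p1.
set F2 := outer (fun u => f u / (u - w)) w d2 d3 n in q2 p2; set F3 := outer (fun u => f u / (u - w)) w d3 d0 n in q3 p3.
set g := slope f w l in s0 s1 s2 s3 q0 q1 q2 q3.
have E : f w * (W0 + W1 + W2 + W3) = (F0 + F1 + F2 + F3) -
    (contour g w d0 d1 n + contour g w d1 d2 n + contour g w d2 d3 n + contour g w d3 d0 n).
  have -> : contour g w d0 d1 n + contour g w d1 d2 n + contour g w d2 d3 n + contour g w d3 d0 n
    = outer g w d0 d1 n + outer g w d1 d2 n + outer g w d2 d3 n + outer g w d3 d0 n.
    by rewrite /contour /outer; ring.
  by rewrite q0 q1 q2 q3; ring.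
have NW : b <= N (W0 + W1 + W2 + W3).
  apply: le_trans (ler_normIm _); apply: le_trans (ler_norm _).
  by rewrite /b; clearbody W0 W1 W2 W3; rewrite !ImD; lra.
apply: (@le_trans _ _ (N (f w * (W0 + W1 + W2 + W3)))).
  by rewrite Normc.normcM ler_wpM2l ?normc_ge0.
rewrite E; apply: le_trans (ler_normcB _ _) _; apply: lerD; last first.
  have := ler_normcD (contour g w d0 d1 n + contour g w d1 d2 n + contour g w d2 d3 n) (contour g w d3 d0 n).
  have := ler_normcD (contour g w d0 d1 n + contour g w d1 d2 n) (contour g w d2 d3 n).
  have := ler_normcD (contour g w d0 d1 n) (contour g w d1 d2 n); lra.
have -> : S / dl * M = M / dl * (N d0 + N d1) + M / dl * (N d1 + N d2)
   + M / dl * (N d2 + N d3) + M / dl * (N d3 + N d0).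
  by rewrite /S; field; rewrite lt0r_neq0.
have := ler_normcD (F0 + F1 + F2) F3; have := ler_normcD (F0 + F1) F2; have := ler_normcD F0 F1; lra.
Qed.

Definition sq z (r : R) u := `|Re (u - z)| <= r /\ `|Im (u - z)| <= r.

Definition sq_int z (r : R) u := `|Re (u - z)| < r /\ `|Im (u - z)| < r.

Definition sq_bd z (r : R) u := sq z r u /\ (`|Re (u - z)| = r \/ `|Im (u - z)| = r).

(** The horizontal and the vertical line through [w] cut the square into four corners. The order of
    the quantifiers matters: [C] is chosen before [f], so one constant serves all powers of a
    function. *)
Lemma cauchy_bound z0 (r : R) w : sq_int z0 r w -> exists C : R, forall f M,
  (forall u, sq z0 r u -> hol f u) -> (forall u, sq_bd z0 r u -> N (f u) <= M) ->
  N (f w) <= C * M.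
Proof.
move=> [wr wi].
pose x := Re (w - z0); pose y := Im (w - z0).
(* Distances from [w] to the right, left, upper and lower side. *)
pose a := r - x; pose a' := r + x; pose b := r - y; pose b' := r + y.
move: wr wi; rewrite !ltr_norml -/x -/y => /andP[x1 x2] /andP[y1 y2].
have a0 : 0 < a by rewrite /a; lra. have a'0 : 0 < a' by rewrite /a'; lra.
have b0 : 0 < b by rewrite /b; lra. have b'0 : 0 < b' by rewrite /b'; lra.
pose dl := Num.min (Num.min a a') (Num.min b b').
have dl0 : 0 < dl by rewrite !lt_min a0 a'0 b0.
have dla : dl <= a by rewrite !ge_min lexx.
have dla' : dl <= a' by rewrite !ge_min lexx ?orbT.
have dlb : dl <= b by rewrite !ge_min lexx ?orbT.
have dlb' : dl <= b' by rewrite !ge_min lexx ?orbT.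
have key u : - a' <= Re (u - w) <= a -> - b' <= Im (u - w) <= b -> sq z0 r u.
  have -> : u - w = (u - z0) - (w - z0) by ring.
  rewrite !ReB !ImB => /andP[h1 h2] /andP[h3 h4].
  rewrite /a /b /a' /b' /x /y !ReB !ImB in h1 h2 h3 h4.
  by split; rewrite ler_norml ?ReB ?ImB; apply/andP; split; lra.
have keyb u : - a' <= Re (u - w) <= a -> - b' <= Im (u - w) <= b ->
    [\/ Re (u - w) = a, Re (u - w) = - a', Im (u - w) = b | Im (u - w) = - b'] ->
    sq_bd z0 r u /\ dl <= N (u - w).
  move=> h1 h2 h3; split.
    split; first exact: key.
    move: h3; have -> : u - w = (u - z0) - (w - z0) by ring.
    rewrite !ReB !ImB /a /b /a' /b' /x /y !ReB !ImB.
    move: x1 x2 y1 y2; rewrite /x /y !ReB !ImB => x1 x2 y1 y2.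
    case=> h.
    - by left; rewrite ger0_norm; lra.
    - by left; rewrite ler0_norm; lra.
    - by right; rewrite ger0_norm; lra.
    - by right; rewrite ler0_norm; lra.
  case: h3 => h.
  - apply: le_trans (ler_normRe _); rewrite h ger0_norm // ltW //.
  - apply: le_trans (ler_normRe _); rewrite h normrN ger0_norm // ltW //.
  - apply: le_trans (ler_normIm _); rewrite h ger0_norm // ltW //.
  - apply: le_trans (ler_normIm _); rewrite h normrN ger0_norm // ltW //.
have sb (s c : R) : 0 <= s <= 1 -> 0 < c -> 0 <= s * c <= c.
  by move=> /andP[s0 s1] c0; rewrite mulr_ge0 ?(ltW c0) //= ler_piMl // ltW.
have subw (c d : K) (s t : R) : par_pt w c d s t - w = s%:C%C * c + t%:C%C * d.
  by rewrite /par_pt; ring.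
have subw' (c d : K) (s : R) : seg_pt (w + c) d s - w = c + s%:C%C * d.
  by rewrite /seg_pt; ring.
have Qw : sq z0 r w by split; rewrite ler_norml; apply/andP; split; rewrite ltW.
pose d0 := (a +i* 0)%C; pose d1 := (0 +i* b)%C.
pose d2 := (- a' +i* 0)%C; pose d3 := (0 +i* - b')%C.
apply: (@four_corners (sq z0 r) (sq_bd z0 r) w dl d0 d1 d2 d3) => //.
- split.
  + by rewrite eq_complex /= negb_and (lt0r_neq0 a0).
  + exists (b / a); first by rewrite divr_gt0.
    by apply/eqP; rewrite eq_complex /=; apply/andP; split; apply/eqP; field; rewrite lt0r_neq0.
  + move=> u [s [t [/sb/(_ a0)/andP[h1 h2] /sb/(_ b0)/andP[h3 h4] ->]]].
    by apply: key; rewrite subw /=; apply/andP; split; lra.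
  + move=> s /sb/(_ b0)/andP[h1 h2]; apply: keyb; rewrite ?subw' /=.
    1,2: by apply/andP; split; lra.
    by apply: Or41; ring.
  + move=> s /sb/(_ a0)/andP[h1 h2]; apply: keyb; rewrite ?subw' /=.
    1,2: by apply/andP; split; lra.
    by apply: Or43; ring.
- split.
  + by rewrite eq_complex /= negb_and (lt0r_neq0 b0) orbT.
  + exists (a' / b); first by rewrite divr_gt0.
    by apply/eqP; rewrite eq_complex /=; apply/andP; split; apply/eqP; field; rewrite lt0r_neq0.
  + move=> u [s [t [/sb/(_ b0)/andP[h1 h2] /sb/(_ a'0)/andP[h3 h4] ->]]].
    by apply: key; rewrite subw /=; apply/andP; split; lra.
  + move=> s /sb/(_ a'0)/andP[h1 h2]; apply: keyb; rewrite ?subw' /=.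
    1,2: by apply/andP; split; lra.
    by apply: Or43; ring.
  + move=> s /sb/(_ b0)/andP[h1 h2]; apply: keyb; rewrite ?subw' /=.
    1,2: by apply/andP; split; lra.
    by apply: Or42; ring.
- split.
  + by rewrite eq_complex /= negb_and oppr_eq0 (lt0r_neq0 a'0).
  + exists (b' / a'); first by rewrite divr_gt0.
    by apply/eqP; rewrite eq_complex /=; apply/andP; split; apply/eqP; field; rewrite lt0r_neq0.
  + move=> u [s [t [/sb/(_ a'0)/andP[h1 h2] /sb/(_ b'0)/andP[h3 h4] ->]]].
    by apply: key; rewrite subw /=; apply/andP; split; lra.
  + move=> s /sb/(_ b'0)/andP[h1 h2]; apply: keyb; rewrite ?subw' /=.
    1,2: by apply/andP; split; lra.
    by apply: Or42; ring.
  + move=> s /sb/(_ a'0)/andP[h1 h2]; apply: keyb; rewrite ?subw' /=.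
    1,2: by apply/andP; split; lra.
    by apply: Or44; ring.
- split.
  + by rewrite eq_complex /= negb_and oppr_eq0 (lt0r_neq0 b'0) orbT.
  + exists (a / b'); first by rewrite divr_gt0.
    by apply/eqP; rewrite eq_complex /=; apply/andP; split; apply/eqP; field; rewrite lt0r_neq0.
  + move=> u [s [t [/sb/(_ b'0)/andP[h1 h2] /sb/(_ a0)/andP[h3 h4] ->]]].
    by apply: key; rewrite subw /=; apply/andP; split; lra.
  + move=> s /sb/(_ a0)/andP[h1 h2]; apply: keyb; rewrite ?subw' /=.
    1,2: by apply/andP; split; lra.
    by apply: Or44; ring.
  + move=> s /sb/(_ b'0)/andP[h1 h2]; apply: keyb; rewrite ?subw' /=.
    1,2: by apply/andP; split; lra.
    by apply: Or41; ring.
Qed.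

End CauchyBound.

(** * Maximum principle and removable singularities *)

Section MaximumPrinciple.
Variable R : realType.
Local Notation K := (R[i]).
Local Notation N := (@Normc.normc R).
Local Notation Re := (@complex.Re R).
Local Notation Im := (@complex.Im R).
Implicit Types (f g : K -> K) (z w u p : K) (r : R).

Lemma sq_ball z r u : N (u - z) <= r -> sq z r u.
Proof. by move=> h; split; apply: le_trans h; [exact: ler_normRe|exact: ler_normIm]. Qed.

Lemma sq_le z r u : sq z r u -> N (u - z) <= 2 * r.
Proof. by move=> [h1 h2]; apply: le_trans (ler_normc_ReIm _) _; lra. Qed.

Lemma sq_bd_ge z r u : sq_bd z r u -> r <= N (u - z).
Proof. by case=> _ [] <-; [exact: ler_normRe|exact: ler_normIm]. Qed.

Lemma sq_int_or_bd z r u : sq z r u -> sq_int z r u \/ sq_bd z r u.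
Proof.
move=> [h1 h2]; have [e1|n1] := eqVneq `|Re (u - z)| r.
  by right; split; [split|left].
have [e2|n2] := eqVneq `|Im (u - z)| r; first by right; split; [split|right].
by left; split; rewrite lt_neqAle ?n1 ?n2.
Qed.

Lemma sq_center z r : 0 <= r -> sq z r z.
Proof. by move=> r0; apply: sq_ball; rewrite subrr Normc.normc0. Qed.

Lemma sq_mono z r r' u : r <= r' -> sq z r u -> sq z r' u.
Proof. by move=> rr [h1 h2]; split; apply: le_trans rr. Qed.

Lemma sq_bd_exists z r : 0 <= r -> exists u, sq_bd z r u.
Proof.
move=> r0; exists (z + r%:C%C).
have e : z + r%:C%C - z = r%:C%C by ring.
by rewrite /sq_bd /sq e /= normr0 ger0_norm //; split; [split|left].
Qed.

Lemma sq_bounded f z r : 0 < r -> (forall u, sq z r u -> ccont f u) ->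
  exists2 M : R, 0 <= M & forall u, sq z r u -> N (f u) <= M.
Proof.
move=> r0 cf.
pose c := z - (r +i* r)%C.
have parE s t : par_pt c (2 * r)%:C%C (0 +i* (2 * r))%C s t - z =
    ((2 * s - 1) * r +i* ((2 * t - 1) * r))%C.
  by apply/eqP; rewrite /par_pt /c eq_complex /= !ReB !ReD !ImB !ImD /= ?ReN ?ImN /=;
     apply/andP; split; apply/eqP; ring.
have [M hM] : exists M, forall u, par c (2 * r)%:C%C (0 +i* (2 * r))%C u -> N (f u) <= M.
  apply: par_bounded => u [s [t [/andP[s0 s1] /andP[t0 t1] ->]]]; apply: cf.
  rewrite /sq parE /= !normrM (gtr0_norm r0).
  by split; rewrite ler_piMl ?(ltW r0) // ler_norml; apply/andP; split; lra.
exists M => [|u [h1 h2]].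
  apply: le_trans (normc_ge0 _) (hM c _).
  by exists 0, 0; rewrite lexx ler01 /par_pt !rmorph0 !mul0r !addr0.
apply: hM; exists ((Re (u - z) + r) / (2 * r)), ((Im (u - z) + r) / (2 * r)).
have r2 : 0 < 2 * r by rewrite mulr_gt0.
move: h1 h2; rewrite !ler_norml => /andP[a1 a2] /andP[b1 b2]; split.
- by rewrite divr_ge0 ?ler_pdivrMr // ?(ltW r2) //=; lra.
- by rewrite divr_ge0 ?ler_pdivrMr // ?(ltW r2) //=; lra.
- apply/eqP; rewrite -subr_eq0; set x := par_pt _ _ _ _ _.
  have -> : u - x = (u - z) - (x - z) by ring.
  rewrite /x parE; case: (u - z) => a b /=.
  by rewrite eq_complex /=; apply/andP; split; apply/eqP; field; rewrite lt0r_neq0.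
Qed.

Lemma bernoulli_ineq (x : R) n : 0 <= x -> 1 + x *+ n <= (1 + x) ^+ n.
Proof.
move=> x0; elim: n => [|n IH]; first by rewrite mulr0n expr0 addr0.
rewrite exprS mulrS.
have h : 0 <= x *+ n by rewrite mulrn_wge0.
apply: le_trans (_ : (1 + x) * (1 + x *+ n) <= _); last by rewrite ler_wpM2l //; lra.
have : 0 <= x * (x *+ n) by rewrite mulr_ge0.
by set y := x *+ n; lra.
Qed.

(** If [x > M > 0], Bernoulli's inequality makes some [(x / M) ^+ n.+1] exceed [C]; for [M = 0] the
    first power is enough. *)
Lemma le_of_powers (x M C : R) : 0 <= x -> 0 <= M ->
  (forall n : nat, x ^+ n.+1 <= C * M ^+ n.+1) -> x <= M.
Proof.
move=> x0 M0 h; rewrite leNgt; apply/negP => Mx.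
have [M00|Mn0] := eqVneq M 0.
  by have := h 0%N; rewrite !expr1 M00 mulr0 => ?; lra.
have {Mn0}M0' : 0 < M by rewrite lt_def Mn0.
pose y := x / M - 1.
have y0 : 0 < y by rewrite subr_gt0 ltr_pdivlMr // mul1r.
have hy n : (1 + y) ^+ n.+1 <= C.
  have -> : 1 + y = x / M by rewrite /y; ring.
  by rewrite expr_div_n ler_pdivrMr // exprn_gt0.
have C0 : 0 <= C by apply: le_trans (hy 0%N); rewrite expr1; lra.
have := hy (Num.truncn (C / y)); rewrite leNgt => /negP; apply.
apply: lt_le_trans (bernoulli_ineq _ (ltW y0)).
have := truncnS_gt (C / y); rewrite ltr_pdivrMr // -mulr_natl => ?; lra.
Qed.

(* Powers of f make the constant of cauchy_bound irrelevant, and a factor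
   (u - e) restores differentiability at an exceptional point e. *)
Lemma max_principle f z0 r (s : seq K) (M : R) : 0 < r ->
  (forall u, sq z0 r u -> ccont f u) ->
  (forall u, sq z0 r u -> u \notin s -> hol f u) ->
  (forall u, sq_bd z0 r u -> N (f u) <= M) ->
  forall w, sq z0 r w -> N (f w) <= M.
Proof.
move=> r0 cf hf fM w /sq_int_or_bd [hw|]; last exact: fM.
have M0 : 0 <= M.
  by have [u /fM h] := sq_bd_exists z0 (ltW r0); apply: le_trans h; exact: normc_ge0.
have cpr (s' : seq K) u : hol (fun v => \prod_(e <- s') (v - e)) u.
  elim: s' => [|e s' IH].
    by apply: (eq_hol (f := fun=> 1)) (hol_cst 1 u) => v; rewrite big_nil.
  apply: (eq_hol (f := fun v => (v - e) * \prod_(e <- s') (v - e))).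
    by move=> v; rewrite big_cons.
  by apply: holM => //; apply: holB; [exact: hol_id|exact: hol_cst].
have hF n u : sq z0 r u -> hol (fun v => f v ^+ n.+1 * \prod_(e <- s) (v - e)) u.
  move=> hu; have [us|us] := boolP (u \in s); last first.
    by apply: holM => //; apply: holX; exact: hf.
  apply: (eq_hol (f := fun v => (f v ^+ n.+1 * \prod_(e <- rem u s) (v - e)) * (v - u))).
    move=> v; rewrite [in RHS](big_rem u us) /=. by rewrite -mulrA; congr (_ * _); rewrite mulrC.
  apply: (hol_mul_root (f := fun v => f v ^+ n.+1 * \prod_(e <- rem u s) (v - e))).
  apply: ccontM; last exact/hol_ccont/cpr.
  by apply: ccontX; exact: cf.
have [B B0 hB] := sq_bounded (z := z0) r0 (fun u _ => hol_ccont (cpr s u)).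
have main v : sq_int z0 r v -> v \notin s -> N (f v) <= M.
  move=> hv vs; have [C hC] := cauchy_bound hv.
  have pv : 0 < N (\prod_(e <- s) (v - e)).
    rewrite normc_gt0 prodf_seq_neq0; apply/allP => e es /=.
    by rewrite subr_eq0; apply: contraNneq vs => ->.
  (* The product is evaluated at [v] on one side and bounded by [B] on the other; neither depends on
     the exponent, so both go into the constant. *)
  apply: (@le_of_powers _ _ (C * B / N (\prod_(e <- s) (v - e)))) => // [|n].
    exact: normc_ge0.
  rewrite mulrAC ler_pdivlMr // -normcX -Normc.normcM -mulrA.
  apply: (hC (fun u => f u ^+ n.+1 * \prod_(e <- s) (u - e)) (B * M ^+ n.+1)).
    exact: hF.
  move=> u hu; rewrite Normc.normcM normcX [B * _]mulrC; apply: ler_pM; rewrite ?exprn_ge0 ?normc_ge0 //.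
    by rewrite lerXn2r ?nnegrE ?normc_ge0 // fM.
  by apply: hB; case: hu.
have cw : ccont f w by apply: cf; case: hw => /ltW h1 /ltW h2.
pose d := Num.min (r - `|Re (w - z0)|) (r - `|Im (w - z0)|).
have d0 : 0 < d by case: hw => h1 h2; rewrite lt_min; apply/andP; split; lra.
apply: (ler_ccont (s := s) d0 cw) => v vd vs _; apply: main => //.
have vE : v - z0 = (v - w) + (w - z0) by ring.
rewrite /sq_int vE.
move: vd; rewrite lt_min => /andP[v1 v2].
split.
  rewrite ReD; have := ler_normD (Re (v - w)) (Re (w - z0)).
  have := ler_normRe (v - w); lra.
rewrite ImD; have := ler_normD (Im (v - w)) (Im (w - z0)).
have := ler_normIm (v - w); lra.
Qed.

Lemma ccont_slope f z l w : w != z -> ccont f w -> ccont (slope f z l) w.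
Proof.
move=> wz cf; have wz1 : w - z != 0 by rewrite subr_eq0.
have wz0 : 0 < N (w - z) by rewrite normc_gt0.
apply: (@ccont_near _ (fun u => (f u - f z) * (u - z)^-1) _ _ (N (w - z))) => //.
  move=> u uw; rewrite slope_neq //; apply: contraTneq uw => ->.
  by rewrite normcBC -leNgt.
apply: ccontM; first by apply: ccontB => //; exact: ccont_cst.
apply: (@ccontV _ (fun u => u - z)) => //.
by apply: ccontB; [exact: ccont_id|exact: ccont_cst].
Qed.

(* On the boundary of the square the slopes at u and v are close because both
   are close to the slope at p; the maximum principle does the rest. *)
Lemma slopes_close f p r : 0 < r -> (forall u, sq p r u -> ccont f u) ->
  (forall u, sq p r u -> u != p -> hol f u) ->
  forall e : R, 0 < e -> exists2 d : R, 0 < d & forall u v l m,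
    N (u - p) < d -> N (v - p) < d -> cder f u l -> cder f v m ->
    forall w, sq p r w -> N (slope f u l w - slope f v m w) <= e.
Proof.
move=> r0 cf hf e e0.
have [B B0 hB] := sq_bounded r0 cf.
(* The error on the boundary is at most [2 * B * d2 + e * r / 16 * N (w - p)] divided by
   [N (w - u) * N (w - p)]. The denominator is at least [r ^+ 2 / 2] and at least
   [r * N (w - p) / 2], so the two terms give at most [e / 4] and [e / 8]. *)
have eta0 : 0 < e * r / 16 by rewrite divr_gt0 // mulr_gt0.
have [d1 d10 hd1] := cf p (sq_center _ (ltW r0)) _ eta0.
pose d2 := e * r ^+ 2 / (16 * (B + 1)).
have B1 : 0 < 16 * (B + 1) by rewrite mulr_gt0 //; lra.
have d20 : 0 < d2 by rewrite divr_gt0 // mulr_gt0 // exprn_gt0.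
exists (Num.min (r / 2) (Num.min d1 d2)).
  by rewrite !lt_min d10 d20 divr2_gt0.
have near w u l : sq_bd p r w -> N (u - p) < Num.min (r / 2) (Num.min d1 d2) ->
    N (slope f u l w - (f w - f p) / (w - p)) <= e / 2.
  move=> hw; rewrite !lt_min => /and3P[u1 u2 u3].
  have Nwp : r <= N (w - p) by exact: sq_bd_ge.
  have wp : w - p != 0 by rewrite -normc_gt0 (lt_le_trans r0).
  have Nwu : r / 2 <= N (w - u).
    by have := ler_normc_dist w u p; lra.
  have wu : w - u != 0 by rewrite -normc_gt0 (lt_le_trans _ Nwu) // divr2_gt0.
  rewrite slope_neq; last by rewrite -subr_eq0.
  have -> : (f w - f u) / (w - u) - (f w - f p) / (w - p) =
     ((f w - f p) * (u - p) - (f u - f p) * (w - p)) / ((w - u) * (w - p)).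
    by field; rewrite wu wp.
  rewrite Normc.normcM Normc.normcV Normc.normcM ler_pdivrMr; last by rewrite mulr_gt0 // normc_gt0.
  have hwB := hB w (proj1 hw).
  have hpB := hB p (sq_center _ (ltW r0)).
  have t1 : N ((f w - f p) * (u - p)) <= 2 * B * d2.
    rewrite Normc.normcM; apply: ler_pM; rewrite ?normc_ge0 //; last exact: ltW.
    by have := ler_normcB (f w) (f p); lra.
  have t2 : N ((f u - f p) * (w - p)) <= e * r / 16 * N (w - p).
    by rewrite Normc.normcM ler_wpM2r ?normc_ge0 // hd1.
  have t3 : 2 * B * d2 <= e * r ^+ 2 / 8.
    rewrite /d2 mulrA ler_pdivrMr //.
    have : 0 <= e * r ^+ 2 by rewrite mulr_ge0 ?ltW // exprn_gt0.
    by set X := e * r ^+ 2; nra.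
  have t4 : r * (r / 2) <= N (w - p) * N (w - u).
    by apply: ler_pM => //; rewrite ?(ltW r0) // ltW // divr2_gt0.
  have t5 : r * N (w - p) <= 2 * (N (w - u) * N (w - p)).
    by rewrite mulrA ler_wpM2r ?normc_ge0 //; lra.
  have := ler_normcB ((f w - f p) * (u - p)) ((f u - f p) * (w - p)).
  have e4 := ler_wpM2l (ltW e0) t4; have e5 := ler_wpM2l (ltW e0) t5.
  rewrite expr2 in t3; nra.
move=> u v l m ud vd du dv.
(* Three exceptional points: at [u] and [v] the slopes are only continuous, and at [p] so is [f]. *)
apply: (@max_principle (fun w => slope f u l w - slope f v m w) p r [:: u; v; p]) => //.
- move=> w hw; apply: ccontB.
    by have [->|wu] := eqVneq w u; [exact: du|apply: ccont_slope => //; exact: cf].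
  by have [->|wv] := eqVneq w v; [exact: dv|apply: ccont_slope => //; exact: cf].
- move=> w hw; rewrite !inE !negb_or => /and3P[wu wv wp].
  by apply: holB; apply: hol_slope => //; exact: hf.
- move=> w hw; apply: le_trans (ler_normc_dist _ ((f w - f p) / (w - p)) _) _.
  by have h1 := near w u l hw ud; have h2 := near w v m hw vd; rewrite normcBC in h2; lra.
Qed.

(* The slope of f at u, evaluated at p, is the slope of f at p, evaluated at u:
   by slopes_close it has a limit when u tends to p. *)
Lemma removable f p r : 0 < r -> ccont f p ->
  (forall u, sq p r u -> u != p -> hol f u) -> hol f p.
Proof.
move=> r0 cp hf.
have cf u : sq p r u -> ccont f u.
  by move=> hu; have [->//|up] := eqVneq u p; exact/hol_ccont/hf.
have [|l hl] := @cauchy_limC R (fun u => (f u - f p) / (u - p)) p.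
  move=> e e0; have [d d0 hd] := slopes_close r0 cf hf e0.
  exists (Num.min d r); first by rewrite lt_min d0.
  move=> u v; rewrite !lt_min => /andP[ud ur] /andP[vd vr] up vp.
  have [a da] := hf u (sq_ball (ltW ur)) up; have [b db] := hf v (sq_ball (ltW vr)) vp.
  have := hd u v a b ud vd da db p (sq_center _ (ltW r0)).
  rewrite !slope_neq 1?eq_sym //.
  by rewrite -[f p - f u]opprB -[p - u]opprB -[f p - f v]opprB -[p - v]opprB !invrN !mulrNN.
exists l => e e0; have [d d0 hd] := hl e e0; exists d => // w wd.
rewrite slope_at; have [->|wp] := eqVneq w p; last by rewrite slope_neq // hd.
by rewrite slope_at subrr Normc.normc0 ltW.
Qed.

Lemma hol_slope_at f p r l : 0 < r -> (forall u, sq p r u -> hol f u) ->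
  cder f p l -> forall u, sq p r u -> hol (slope f p l) u.
Proof.
move=> r0 hf dp u hu; have [->|up] := eqVneq u p; last by apply: hol_slope => //; exact: hf.
by apply: (removable r0) => // v hv vp; apply: hol_slope => //; exact: hf.
Qed.

(** [cderive f w] is the slope at [w] evaluated at [w]. By [slopes_close], which is uniform in the
    evaluation point, it is close to the slope at [p] evaluated at [w], and the latter tends to
    [cderive f p]. *)
Lemma ccont_cderive f p r : 0 < r -> (forall u, sq p r u -> hol f u) -> ccont (cderive f) p.
Proof.
move=> r0 hf e e0.
have dp := cderiveP (hf p (sq_center _ (ltW r0))).
have [d d0 hd] := slopes_close r0 (fun u hu => hol_ccont (hf u hu))
  (fun u hu _ => hf u hu) (divr2_gt0 e0).
have [d' d'0 hd'] := dp _ (divr2_gt0 e0).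
exists (Num.min d (Num.min d' r)); first by rewrite !lt_min d0 d'0.
move=> w; rewrite !lt_min => /and3P[w1 w2 w3].
have hw := sq_ball (ltW w3).
have pp : N (p - p) < d by rewrite subrr Normc.normc0.
have := hd w p _ _ w1 pp (cderiveP (hf w hw)) dp w hw; rewrite slope_at => h1.
have := hd' w w2; rewrite slope_at => h2.
by apply: le_trans (ler_normc_dist _ (slope f p (cderive f p) w) _) _; lra.
Qed.

(** With [q] the slope at [p], differentiating [f p + q u * (u - p)] gives
    [q u + cderive q u * (u - p)]; the last product is differentiable at [p] because [cderive q] is
    continuous there. *)
Lemma hol_cderive f p r : 0 < r -> (forall u, sq p r u -> hol f u) -> hol (cderive f) p.
Proof.
move=> r0 hf.
have dp := cderiveP (hf p (sq_center _ (ltW r0))).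
pose q := slope f p (cderive f p).
have hq : forall u, sq p r u -> hol q u by exact: hol_slope_at.
apply: (@hol_near _ (fun u => q u + cderive q u * (u - p)) _ _ r) => //.
  move=> w /ltW/sq_ball hw.
  have d1 : cder (fun u => u - p) w (1 - 0).
    by apply: cderB; [exact: cder_id|exact: cder_cst].
  symmetry; apply: cderiveE.
  apply: (eq_cder (f := fun u => f p + q u * (u - p))); first by move=> u; rewrite -slopeE.
  apply: (cder_eq _ (cderD (cder_cst (f p) w) (cderM (cderiveP (hq w hw)) d1))); ring.
apply: holD; first exact/hq/sq_center/ltW.
by apply: (hol_mul_root (f := cderive q)); exact: ccont_cderive hq.
Qed.

(** The slopes of the [F n] at [p] are uniformly Cauchy: by the maximum principle they need only be
    compared on the boundary, where dividing by [u - p] costs at most a factor [1 / r]. Hence their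
    limit, the slope of [f] with value [m] at [p], is continuous at [p]. *)
Lemma weierstrass (F : nat -> K -> K) (f : K -> K) p r (l : nat -> K) m : 0 < r ->
  (forall n u, sq p r u -> hol (F n) u) -> (forall n, cder (F n) p (l n)) ->
  (forall e : R, 0 < e -> exists n0 : nat, forall n, (n0 <= n)%N ->
     forall u, sq p r u -> N (F n u - f u) <= e) ->
  (forall e : R, 0 < e -> exists n0 : nat, forall n, (n0 <= n)%N -> N (l n - m) <= e) ->
  cder f p m.
Proof.
move=> r0 hF dF uF lm e e0.
have e5 : 0 < e / 8 by rewrite divr_gt0.
(* Four terms of this size, divided by [r], add up to [e / 8]. *)
have e5r : 0 < e * r / 32 by rewrite divr_gt0 // mulr_gt0.
have [n0 hn0] := uF _ e5r.
have unif n n' w : (n0 <= n)%N -> (n0 <= n')%N -> sq p r w ->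
    N (slope (F n) p (l n) w - slope (F n') p (l n') w) <= e / 8.
  move=> nn nn'; apply: (@max_principle (fun v => slope (F n) p (l n) v - slope (F n') p (l n') v) p r [:: p]) => //.
  - move=> u hu; apply: ccontB; apply: hol_ccont.
      exact: (hol_slope_at r0 (hF n) (dF n)).
    exact: (hol_slope_at r0 (hF n') (dF n')).
  - by move=> u hu; rewrite inE => up; apply: holB; apply: hol_slope => //; exact: hF.
  - move=> u hu; have Nup := sq_bd_ge hu.
    have up : u - p != 0 by rewrite -normc_gt0 (lt_le_trans r0).
    rewrite !slope_neq; try by rewrite -subr_eq0.
    have -> : (F n u - F n p) / (u - p) - (F n' u - F n' p) / (u - p) =
      (((F n u - f u) - (F n' u - f u)) - ((F n p - f p) - (F n' p - f p))) / (u - p).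
      by field.
    rewrite Normc.normcM Normc.normcV ler_pdivrMr ?normc_gt0 //.
    have hp := sq_center p (ltW r0); have hu' := proj1 hu.
    have := ler_normcB ((F n u - f u) - (F n' u - f u)) ((F n p - f p) - (F n' p - f p)).
    have := ler_normcB (F n u - f u) (F n' u - f u); have := ler_normcB (F n p - f p) (F n' p - f p).
    have := hn0 n nn u hu'; have := hn0 n' nn' u hu'.
    have := hn0 n nn p hp; have := hn0 n' nn' p hp.
    have : e / 8 * r <= e / 8 * N (u - p) by rewrite ler_wpM2l ?(ltW e5).
    lra.
have lim w : sq p r w -> N (slope f p m w - slope (F n0) p (l n0) w) <= e / 4.
  move=> hw.
  have [wp|wp] := eqVneq w p.
    have [n1 hn1] := lm _ e5; pose n := maxn n0 n1.
    have := hn1 n; rewrite leq_maxr => /(_ isT) h1.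
    have := unif n n0 w; rewrite leq_maxl leqnn => /(_ isT isT hw).
    rewrite wp !slope_at => h2; have := ler_normc_dist m (l n) (l n0); rewrite normcBC in h1; lra.
  have wp0 : 0 < N (w - p) by rewrite normc_gt0 subr_eq0.
  have ew : 0 < e * N (w - p) / 16 by rewrite divr_gt0 // mulr_gt0.
  have [n1 hn1] := uF _ ew; pose n := maxn n0 n1.
  have := hn1 n; rewrite leq_maxr => /(_ isT) h1.
  have := unif n n0 w; rewrite leq_maxl leqnn => /(_ isT isT hw) h2.
  apply: le_trans (ler_normc_dist _ (slope (F n) p (l n) w) _) _.
  suff : N (slope f p m w - slope (F n) p (l n) w) <= e / 8 by lra.
  rewrite !slope_neq // -mulrBl Normc.normcM Normc.normcV ler_pdivrMr //.
  have -> : f w - f p - (F n w - F n p) = (F n p - f p) - (F n w - f w) by ring.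
  have := ler_normcB (F n p - f p) (F n w - f w); have := h1 w hw.
  have := h1 p (sq_center p (ltW r0)); lra.
have [d d0 hd] := dF n0 _ e5.
exists (Num.min d r); first by rewrite lt_min d0.
move=> w; rewrite lt_min => /andP[w1 w2].
have h1 := lim w (sq_ball (ltW w2)); have h2 := lim p (sq_center p (ltW r0)).
have h3 := hd w w1; rewrite !slope_at in h2 h3 *.
have := ler_normc_dist (slope f p m w) (slope (F n0) p (l n0) w) m.
have := ler_normc_dist (slope (F n0) p (l n0) w) (l n0) m.
rewrite normcBC in h2; lra.
Qed.

End MaximumPrinciple.

(** * Taylor remainders and primitives *)

Section Taylor.
Variable R : realType.
Local Notation K := (R[i]).
Local Notation N := (@Normc.normc R).
Local Notation Re := (@complex.Re R).
Local Notation Im := (@complex.Im R).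
Implicit Types (f g : K -> K) (z w u p : K) (r : R).

(* The n-th Taylor remainder of f at p divided by (u - p) ^ n *)
Fixpoint taylor_rem f p n : K -> K :=
  if n is m.+1 then slope (taylor_rem f p m) p (cderive (taylor_rem f p m) p) else f.

Lemma hol_taylor_rem f p r n : 0 < r -> (forall u, sq p r u -> hol f u) ->
  forall u, sq p r u -> hol (taylor_rem f p n) u.
Proof.
move=> r0 hf; elim: n => [//|n IH] u hu /=.
by apply: (hol_slope_at r0 IH) => //; apply/cderiveP/IH/sq_center/ltW.
Qed.

Lemma taylor_remE f p n u :
  taylor_rem f p n u = taylor_rem f p n p + taylor_rem f p n.+1 u * (u - p).
Proof. exact: slopeE. Qed.

Lemma taylor_rem_vanish f p n : (forall i, (i < n)%N -> taylor_rem f p i p = 0) ->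
  forall u, f u = (u - p) ^+ n * taylor_rem f p n u.
Proof.
elim: n => [|n IH] h u; first by rewrite expr0 mul1r.
rewrite IH => [|i ilt]; last by apply: h; rewrite ltnS ltnW.
by rewrite taylor_remE h // add0r exprS; ring.
Qed.

(** The first nonzero Taylor coefficient gives the order. If all coefficients vanish, [f u] is
    [(u - p) ^+ n] times a remainder bounded by [M / r ^+ n] for every positive [n], which forces
    [f u = 0] when [N (u - p) < r]. *)
Lemma local_factor f p r : 0 < r -> (forall u, sq p r u -> hol f u) ->
  (forall u, N (u - p) < r -> f u = 0) \/
  exists n g, [/\ forall u, sq p r u -> hol g u, g p != 0 &
    forall u, f u = (u - p) ^+ n * g u].
Proof.
move=> r0 hf.
have [h|] := pselect (forall i, taylor_rem f p i p = 0); last first.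
  move=> /existsNP [n0 /eqP hn0]; right.
  have ex : exists n, taylor_rem f p n p != 0 by exists n0.
  exists (ex_minn ex), (taylor_rem f p (ex_minn ex)); case: ex_minnP => n hn hmin.
  split=> //; first exact: hol_taylor_rem.
  apply: taylor_rem_vanish => i; apply: contraTeq => /hmin.
  by rewrite leqNgt.
left=> u; set x := N (u - p) => ur.
have [M M0 hM] := sq_bounded r0 (fun u hu => hol_ccont (hf u hu)).
have key n : r ^+ n.+1 * N (f u) <= M * x ^+ n.+1.
  have fE := taylor_rem_vanish (n := n.+1) (fun i _ => h i).
  have hu : sq p r u by apply/sq_ball/ltW.
  have rn : 0 < r ^+ n.+1 by rewrite exprn_gt0.
  have tb : N (taylor_rem f p n.+1 u) <= M / r ^+ n.+1.
    apply: (@max_principle _ _ p r [::]) hu => //.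
    - by move=> v hv; apply: hol_ccont; exact: (hol_taylor_rem _ r0).
    - by move=> v hv _; exact: (hol_taylor_rem _ r0).
    - move=> v hv; rewrite ler_pdivlMr //; apply: le_trans (hM v (proj1 hv)).
      rewrite fE Normc.normcM normcX mulrC ler_wpM2r ?normc_ge0 // lerXn2r ?nnegrE ?normc_ge0 ?(ltW r0) //.
      exact: sq_bd_ge.
  rewrite fE Normc.normcM normcX mulrCA [M * _]mulrC ler_wpM2l ?exprn_ge0 ?normc_ge0 // mulrC.
  by rewrite -ler_pdivlMr.
apply/eqP; rewrite -normc_eq0; apply: contraT => fu.
have Nf : 0 < N (f u) by rewrite lt_def fu normc_ge0.
have : r <= x.
  apply: (@le_of_powers _ _ _ (M / N (f u))) => [||n]; first exact: ltW.
    exact: normc_ge0.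
  by rewrite mulrAC ler_pdivlMr.
by rewrite leNgt ur.
Qed.

(** Termwise integration of the Taylor series at 0: the primitive is the limit of the polynomials
    [P n], and [weierstrass] differentiates it. *)
Lemma primitive f : (forall u, hol f u) -> exists F, forall u, cder F u (f u).
Proof.
move=> hf.
pose t n := taylor_rem f 0 n; pose a n := t n 0.
have ht n u : hol (t n) u.
  have r0 : 0 < N u + 1 by have := normc_ge0 u; lra.
  apply: (hol_taylor_rem n r0 (fun v _ => hf v)).
  by apply: sq_ball; rewrite subr0; lra.
have fE n u : f u = \sum_(i < n) a i * u ^+ i + u ^+ n * t n u.
  elim: n => [|n IH]; first by rewrite big_ord0 add0r expr0 mul1r.
  rewrite IH big_ord_recr /= -addrA; congr (_ + _).
  rewrite (_ : t n u = a n + t n.+1 u * u); last by rewrite [LHS]taylor_remE subr0.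
  by rewrite exprS; ring.
(* Passing to the next remainder at most doubles the bound and divides it by [N v], which is at
   least [r] on the boundary. *)
have tb (r : R) : 0 < r -> exists2 M : R, 0 <= M & forall n u, sq 0 r u ->
    N (t n u) <= M * (2 / r) ^+ n.
  move=> r0; have [M M0 hM] := sq_bounded (z := 0) r0 (fun u _ => hol_ccont (hf u)).
  exists M => //; elim=> [|n IH] u hu; first by rewrite expr0 mulr1 hM.
  apply: (@max_principle _ _ 0 r [::]) hu => //.
    by move=> v _; exact/hol_ccont/ht.
  move=> v hv; have Nv := sq_bd_ge hv; rewrite subr0 in Nv.
  have v0 : v != 0 by rewrite -normc_gt0 (lt_le_trans r0).
  rewrite /t /= slope_neq // -/(t n) -/(a n) Normc.normcM Normc.normcV subr0 ler_pdivrMr ?normc_gt0 //.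
  have h1 := IH v (proj1 hv); have h2 := IH 0 (sq_center 0 (ltW r0)).
  apply: le_trans (ler_normcB _ _) _; apply: le_trans (lerD h1 h2) _.
  set X := M * (2 / r) ^+ n; have X0 : 0 <= X by apply: le_trans (normc_ge0 _) h1.
  have -> : M * (2 / r) ^+ n.+1 * N v = (X + X) * (N v / r) by rewrite exprS /X; field; rewrite lt0r_neq0.
  rewrite ler_peMr ?addr_ge0 // ler_pdivlMr ?mul1r //.
pose P n u := \sum_(i < n) a i / i.+1%:R * u ^+ i.+1.
have dP n u : cder (P n) u (\sum_(i < n) a i * u ^+ i).
  elim: n => [|n IH].
    by rewrite big_ord0; apply: eq_cder (cder_cst 0 u) => v; rewrite /P big_ord0.
  rewrite big_ord_recr /=.
  apply: (eq_cder (f := fun v => P n v + a n / n.+1%:R * v ^+ n.+1)).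
    by move=> v; rewrite /P big_ord_recr.
  apply: cderD => //.
  apply: (cder_eq _ (cderZ (a n / n.+1%:R) (cderX n.+1 (cder_id u)))) => /=.
  by rewrite mulr1 mulrA divfK // pnatr_eq0.
have bound (A : R) : 0 < A -> exists2 M : R, 0 <= M &
    (forall m k u, N u <= A -> N (P (m + k)%N u - P m u) <= M / 2 ^+ m) /\
    (forall n u, N u <= A -> N (u ^+ n * t n u) <= M / 2 ^+ n).
  (* The half-side [4 * A] makes the ratio [A * (2 / (4 * A))] equal to 1 / 2, so that terms and
     remainders decay geometrically. *)
  move=> A0; have A4 : 0 < 4 * A by rewrite mulr_gt0.
  have [M M0 hM] := tb _ A4.
  have half : A * (2 / (4 * A)) = 2^-1 by field; rewrite lt0r_neq0.
  have p2 n : 0 < 2 ^+ n :> R by rewrite exprn_gt0.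
  exists (M + 2 * M * A); first by rewrite addr_ge0 ?mulr_ge0 ?(ltW A0).
  split=> [m k u uA|n u uA]; last first.
    rewrite Normc.normcM normcX.
    have hu : sq 0 (4 * A) u by apply: sq_ball; rewrite subr0; lra.
    apply: le_trans (_ : A ^+ n * (M * (2 / (4 * A)) ^+ n) <= _).
      by apply: ler_pM; rewrite ?exprn_ge0 ?normc_ge0 ?hM // lerXn2r ?nnegrE ?normc_ge0 ?(ltW A0).
    rewrite mulrCA -exprMn half exprVn ler_wpM2r ?invr_ge0 ?(ltW (p2 _)) //.
    by rewrite lerDl !mulr_ge0 // ltW.
  (* The induction on [k] needs this sharper bound, a partial sum of a geometric series. *)
  apply: (@le_trans _ _ (2 * M * A / 2 ^+ m - 2 * M * A / 2 ^+ (m + k))); last first.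
    have h1 : 0 <= 2 * M * A / 2 ^+ (m + k).
      by rewrite divr_ge0 ?mulr_ge0 // ?ltW.
    have h2 : 0 <= M / 2 ^+ m by rewrite divr_ge0 // ltW.
    by rewrite mulrDl; lra.
  elim: k => [|k IH]; first by rewrite addn0 !subrr Normc.normc0.
  rewrite addnS /P big_ord_recr /= -/(P _ _).
  set x := a _ / _ * _.
  have -> : P (m + k)%N u + x - P m u = (P (m + k)%N u - P m u) + x by ring.
  apply: le_trans (ler_normcD _ _) _.
  suff : N x <= M * A / 2 ^+ (m + k).
    rewrite exprS [(2 * 2 ^+ _)^-1]invfM; have := IH; lra.
  rewrite /x !Normc.normcM Normc.normcV normcX normc_nat exprS.
  have h1 : N (a (m + k)%N) <= M * (2 / (4 * A)) ^+ (m + k).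
    by apply: hM; apply/sq_center/ltW.
  have h2 : N u ^+ (m + k) <= A ^+ (m + k) by rewrite lerXn2r ?nnegrE ?normc_ge0 ?(ltW A0).
  have h3 : N (a (m + k)%N) / (m + k).+1%:R <= M * (2 / (4 * A)) ^+ (m + k).
    apply: le_trans h1; rewrite ler_pdivrMr ?ltr0n // ler_peMr ?normc_ge0 //.
    by rewrite ler1n.
  apply: le_trans (_ : (M * (2 / (4 * A)) ^+ (m + k)) * (A * A ^+ (m + k)) <= _).
    apply: ler_pM => //; rewrite ?divr_ge0 ?mulr_ge0 ?exprn_ge0 ?normc_ge0 //.
    by apply: ler_pM; rewrite ?exprn_ge0 ?normc_ge0.
  have -> : M * (2 / (4 * A)) ^+ (m + k) * (A * A ^+ (m + k)) =
     M * A * (A * (2 / (4 * A))) ^+ (m + k).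
    by set y := 2 / _; rewrite [(A * y) ^+ _]exprMn; ring.
  by rewrite half exprVn.
have small (M e : R) : 0 <= M -> 0 < e -> exists n0 : nat, forall n, (n0 <= n)%N -> M / 2 ^+ n <= e.
  move=> M0 e0; have [n0 hn0] := dyadic_small M0 e0; exists n0 => n nn.
  apply: le_trans (ltW hn0); rewrite ler_wpM2l // lef_pV2 ?posrE ?exprn_gt0 //.
  by rewrite -!natrX ler_nat leq_exp2l.
have unif (A : R) : 0 < A -> forall e : R, 0 < e -> exists n0 : nat, forall m n,
    (n0 <= m)%N -> (n0 <= n)%N -> forall u, N u <= A -> N (P m u - P n u) <= e.
  move=> A0 e e0; have [M M0 [hM _]] := bound A A0.
  have [n0 hn0] := small M _ M0 (divr2_gt0 e0); exists n0 => m n mm nn u uA.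
  have h1 := hM n0 (m - n0)%N u uA; have h2 := hM n0 (n - n0)%N u uA.
  rewrite subnKC // in h1; rewrite subnKC // in h2.
  have h3 := hn0 n0 (leqnn _).
  have := ler_normc_dist (P m u) (P n0 u) (P n u); rewrite [N (P n0 u - _)]normcBC; lra.
have posN1 u : 0 < N u + 1 by have := normc_ge0 u; lra.
have /choice [F hF] u : exists l, forall e : R, 0 < e -> exists n0 : nat, forall n,
    (n0 <= n)%N -> N (P n u - l) <= e.
  apply: cauchy_seqC => e /(unif _ (posN1 u)) [n0 hn0].
  by exists n0 => m n mm nn; apply: hn0 => //; lra.
exists F => p; apply: (@weierstrass _ P F p 1 (fun n => \sum_(i < n) a i * p ^+ i)) => //.
- by move=> n u _; eexists; exact: dP.
- move=> e e0.
  have A0 : 0 < N p + 2 by have := normc_ge0 p; lra.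
  have [n0 hn0] := unif _ A0 _ (divr2_gt0 e0); exists n0 => n nn u hu.
  have [n1 hn1] := hF u _ (divr2_gt0 e0).
  have h1 := hn1 _ (leq_maxr n0 n1).
  have h2 : N (P n u - P (maxn n0 n1) u) <= e / 2.
    apply: hn0; rewrite ?leq_maxl //.
    by have := sq_le hu; have := lerB_normc u p; lra.
  by have := ler_normc_dist (P n u) (P (maxn n0 n1) u) (F u); lra.
- move=> e e0; have [M M0 [_ hM]] := bound _ (posN1 p).
  have [n0 hn0] := small M e M0 e0; exists n0 => n nn.
  have -> : \sum_(i < n) a i * p ^+ i - f p = - (p ^+ n * t n p) by rewrite (fE n p); ring.
  rewrite normcN; apply: le_trans (hn0 n nn); apply: hM; lra.
Qed.

End Taylor.

(** * Derivatives along real segments *)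

Section RealPaths.
Variable R : realType.
Local Notation K := (R[i]).
Local Notation N := (@Normc.normc R).
Local Notation Re := (@complex.Re R).
Local Notation Im := (@complex.Im R).
Implicit Types (f g : K -> K) (z w u p : K) (r : R).

Lemma is_derive_le (f : R -> R) (x l : R) : is_derive x 1 f l ->
  forall e : R, 0 < e -> exists2 d : R, 0 < d & forall h, `|h| < d ->
    `|f (x + h) - f x - l * h| <= e * `|h|.
Proof.
move=> dfl e e0.
have C : ((fun h => h^-1 *: (f (h *: 1 + x) - f x)) @ 0^' --> l)%classic.
  by rewrite -(@derive_val _ _ _ _ _ _ _ dfl); exact: (@ex_derive _ _ _ _ _ _ _ dfl).
have /cvgrPdist_le /(_ e e0) /nbhs_ballP [d /= d0 hd] := C.
exists d => // h hh; have [->|h0] := eqVneq h 0.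
  by rewrite addr0 subrr mulr0 subr0 normr0 mulr0.
have := hd h; rewrite /ball /= sub0r normrN => /(_ hh h0).
rewrite distrC scaler1.
have -> : h^-1 *: (f (h + x) - f x) - l = (f (x + h) - f x - l * h) / h.
  by rewrite (addrC h) /GRing.scale /=; field.
by rewrite normrM normfV ler_pdivrMr ?normr_gt0.
Qed.

Lemma is_derive_of_le (f : R -> R) (x l : R) :
  (forall e : R, 0 < e -> exists2 d : R, 0 < d & forall h, `|h| < d ->
    `|f (x + h) - f x - l * h| <= e * `|h|) -> is_derive x 1 f l.
Proof.
move=> H.
have C : ((fun h => h^-1 *: (f (h *: 1 + x) - f x)) @ 0^' --> l)%classic.
  apply/cvgrPdist_le => e e0; have [d d0 hd] := H e e0.
  near=> h.
  have hd' : `|h| < d.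
    by near: h; exact: dnbhs0_lt.
  have h0 : h != 0 by near: h; exact: nbhs_dnbhs_neq.
  have hh := hd h hd'.
  rewrite distrC.
  have -> : h^-1 *: (f (h *: 1 + x) - f x) - l = (f (x + h) - f x - l * h) / h.
    rewrite scaler1 (addrC h) /GRing.scale /=; field; exact: h0.
  by rewrite normrM normfV ler_pdivrMr ?normr_gt0.
by apply: DeriveDef; [exact: cvgP C|exact: cvg_lim C].
Unshelve. all: by end_near.
Qed.

(** Along a segment, the real and imaginary parts are real functions with derivative 0. For a zero
    derivative it is enough that [phi] be 1-Lipschitz; linearity is not involved. *)
Lemma cder0_cst f : (forall u, cder f u 0) -> forall z w, f z = f w.
Proof.
move=> df z w.
have key (phi : K -> R) : (forall x y, `|phi x - phi y| <= N (x - y)) ->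
    phi (f z) = phi (f w).
  move=> hphi; pose psi (t : R) := phi (f (z + t%:C%C * (w - z))).
  have : psi 0 = psi 1.
    apply: is_derive_0_is_cst => t; apply: is_derive_of_le => e e0.
    have D0 : 0 < N (w - z) + 1 by have := normc_ge0 (w - z); lra.
    have [d d0 hd] := df (z + t%:C%C * (w - z)) _ (divr_gt0 e0 D0).
    exists (d / (N (w - z) + 1)); first exact: divr_gt0.
    move=> h; rewrite ltr_pdivlMr // => hh; rewrite mul0r subr0.
    apply: le_trans (hphi _ _) _.
    set v := z + (t + h)%:C%C * (w - z); set u := z + t%:C%C * (w - z).
    have vu : N (v - u) = `|h| * N (w - z).
      by rewrite -normc_real -Normc.normcM; congr N; rewrite /v /u rmorphD /=; ring.
    have vd : N (v - u) < d.
      by rewrite vu; apply: le_lt_trans hh; rewrite ler_wpM2l //; lra.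
    rewrite (slopeE f u 0 v) addrC addKr Normc.normcM vu.
    have := hd v vd; rewrite slope_at subr0 => h1.
    apply: le_trans (ler_wpM2r _ h1) _; first by rewrite mulr_ge0 ?normc_ge0.
    rewrite mulrAC ler_pdivrMr // -mulrA ler_wpM2l ?(ltW e0) //.
    by rewrite ler_wpM2l //; lra.
  rewrite /psi rmorph0 rmorph1 mul0r mul1r addr0.
  by have -> : z + (w - z) = w by ring.
apply/eqP; rewrite eq_complex; apply/andP; split; apply/eqP; apply: key => x y.
  by rewrite -ReB; exact: ler_normRe.
by rewrite -ImB; exact: ler_normIm.
Qed.

End RealPaths.

(** * Exponential and logarithm *)

Section ComplexExponential.
Variable R : realType.
Local Notation K := (R[i]).
Local Notation N := (@Normc.normc R).
Local Notation Re := (@complex.Re R).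
Local Notation Im := (@complex.Im R).
Implicit Types (f g : K -> K) (z w u p : K) (r : R).

Definition cexp z : K := (expR (Re z) * cos (Im z) +i* (expR (Re z) * sin (Im z)))%C.

Lemma cexpD z w : cexp (z + w) = cexp z * cexp w.
Proof.
case: z => a b; case: w => c d; apply/eqP; rewrite eq_complex /cexp /= expRD cosD sinD.
by apply/andP; split; apply/eqP; ring.
Qed.

Lemma cexp0 : cexp 0 = 1.
Proof. by rewrite /cexp /= expR0 cos0 sin0 mulr1 mulr0. Qed.

Lemma cexpNK z : cexp z * cexp (- z) = 1.
Proof. by rewrite -cexpD subrr cexp0. Qed.

Lemma cexp_neq0 z : cexp z != 0.
Proof.
by apply/eqP => h; have /eqP := cexpNK z; rewrite h mul0r eq_sym oner_eq0.
Qed.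

Lemma cexpN z : cexp (- z) = (cexp z)^-1.
Proof. by apply: (mulfI (cexp_neq0 z)); rewrite cexpNK mulfV // cexp_neq0. Qed.

Lemma cexp_natmul z n : cexp (n%:R * z) = cexp z ^+ n.
Proof.
elim: n => [|n IH]; first by rewrite mul0r cexp0 expr0.
by rewrite -natr1 mulrDl mul1r cexpD IH exprSr.
Qed.

Lemma cder_cexp0 : cder cexp 0 1.
Proof.
(* The real part of the error is at most [3 * (ep * n)] and the imaginary part at most
   [5 * (ep * n)], whence the 8; the cap at 1 gives [|1 + x| <= 2]. *)
move=> e e0; have e8 : 0 < Num.min (e / 8) 1 by rewrite lt_min divr_gt0 //=.
set ep := Num.min (e / 8) 1 in e8.
have ep1 : ep <= 1 by rewrite ge_min lexx orbT.
have epe : ep <= e / 8 by rewrite ge_min lexx.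
clearbody ep.
have [d1 d10 h1] := is_derive_le (is_derive_expR (0 : R)) e8.
have [d2 d20 h2] := is_derive_le (is_derive_cos (0 : R)) e8.
have [d3 d30 h3] := is_derive_le (is_derive_sin (0 : R)) e8.
exists (Num.min (Num.min d1 d2) (Num.min d3 ep)); first by rewrite !lt_min d10 d20 d30 e8.
move=> w; rewrite subr0 !lt_min => /andP[/andP[w1 w2] /andP[w3 w4]].
rewrite slope_at; have [->|w0] := eqVneq w 0; first by rewrite slope_at subrr Normc.normc0 ltW.
rewrite slope_neq // subr0 cexp0.
have -> : (cexp w - 1) / w - 1 = (cexp w - 1 - w) / w by field.
rewrite Normc.normcM Normc.normcV ler_pdivrMr ?normc_gt0 //.
apply: le_trans (ler_normc_ReIm _) _.
have x1 := ler_normRe w; have y1 := ler_normIm w.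
move: h1 h2 h3 => /(_ _ (le_lt_trans x1 w1)) h1 /(_ _ (le_lt_trans y1 w2)) h2 /(_ _ (le_lt_trans y1 w3)) h3.
rewrite !add0r expR0 mul1r in h1; rewrite !add0r cos0 sin0 oppr0 mul0r subr0 in h2.
rewrite !add0r sin0 cos0 subr0 mul1r in h3.
rewrite !ReB !ImB /cexp /=; move: x1 y1 h1 h2 h3 (cos_max (Im w)).
set x := Re w; set y := Im w; set E := expR x; set c := cos y; set s := sin y.
set n := N w in w4 * => x1 y1 h1 h2 h3 cm.
have -> : E * c - 1 - x = (E - 1 - x) * c + (1 + x) * (c - 1) by ring.
have -> : E * s - 0 - y = (E - 1) * s + (s - y) by ring.
have n0 : 0 <= n by exact: normc_ge0.
have a1 : `|(E - 1 - x) * c| <= ep * n.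
  rewrite normrM -[leRHS]mulr1; apply: ler_pM => //.
  by apply: le_trans h1 _; rewrite ler_wpM2l // ltW.
have a2 : `|(1 + x) * (c - 1)| <= 2 * (ep * n).
  rewrite normrM; apply: ler_pM => //.
    by apply: le_trans (ler_normD _ _) _; rewrite normr1; lra.
  by apply: le_trans h2 _; rewrite ler_wpM2l // ltW.
have b1 : `|E - 1| <= 2 * ep.
  have -> : E - 1 = (E - 1 - x) + x by ring.
  apply: le_trans (ler_normD _ _) _.
  have : ep * `|x| <= ep by rewrite ler_piMr //; lra.
  lra.
have b3 : `|s - y| <= ep * n by apply: le_trans h3 _; rewrite ler_wpM2l // ltW.
have b2 : `|s| <= 2 * n.
  have -> : s = (s - y) + y by ring.
  apply: le_trans (ler_normD _ _) _.
  have : ep * n <= n by rewrite ler_piMl.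
  lra.
have a3 : `|(E - 1) * s| <= 2 * ep * (2 * n) by rewrite normrM; apply: ler_pM.
have := ler_normD ((E - 1 - x) * c) ((1 + x) * (c - 1)).
have := ler_normD ((E - 1) * s) (s - y).
have : ep * n <= e / 8 * n by rewrite ler_wpM2r.
lra.
Qed.

Lemma cder_cexp z : cder cexp z (cexp z).
Proof.
apply: (eq_cder (f := fun w => cexp z * cexp (w - z))).
  by move=> w; rewrite -cexpD addrC subrK.
apply: (@cder_eq _ _ _ (cexp z * (1 * (1 - 0)))); first by ring.
apply: cderZ; apply: (cder_comp (f := cexp) (g := fun w => w - z)).
  by apply: cderB; [exact: cder_id|exact: cder_cst].
by rewrite subrr; exact: cder_cexp0.
Qed.

Lemma hol_cexp f z : hol f z -> hol (fun w => cexp (f w)) z.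
Proof.
by move=> hf; apply: (hol_comp (f := cexp)) => //; exists (cexp (f z)); exact: cder_cexp.
Qed.

(** Polar coordinates: [acos] gives the angle up to sign, and the sign of [Im w] decides. *)
Lemma cexp_surj w : w != 0 -> exists z, cexp z = w.
Proof.
move=> w0; have r0 : 0 < N w by rewrite normc_gt0.
pose x := Re w / N w; pose y := Im w / N w.
have r2 : N w ^+ 2 = Re w ^+ 2 + Im w ^+ 2.
  by case: (w) => a b /=; rewrite sqr_sqrtr // addr_ge0 // sqr_ge0.
have xy : x ^+ 2 + y ^+ 2 = 1.
  by rewrite /x /y !exprMn -mulrDl -r2 exprVn mulfV // lt0r_neq0 // exprn_gt0.
have x1 : -1 <= x <= 1.
  have : x ^+ 2 <= 1 by rewrite -xy lerDl sqr_ge0.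
  by move=> h; rewrite -ler_norml -sqrtr_sqr -[leRHS]sqrtr1; exact: ler_wsqrtr.
have [t [ct st]] : exists t, cos t = x /\ sin t = y.
  have y2 : 1 - x ^+ 2 = y ^+ 2 by lra.
  have [y0|y0] := leP 0 y.
    exists (acos x); rewrite acosK ?in_itv //= sin_acos // y2 sqrtr_sqr ger0_norm //.
  exists (- acos x); rewrite cosN sinN acosK ?in_itv //= sin_acos // y2 sqrtr_sqr.
  by rewrite ltr0_norm // opprK.
exists (ln (N w) +i* t)%C; rewrite /cexp /= ct st lnK ?posrE //.
by rewrite /x /y ![N w * (_ / _)]mulrC !divfK ?lt0r_neq0 //; case: (w).
Qed.

(** With [F] a primitive of the logarithmic derivative of [h], the function [h * cexp (- F)] has
    derivative 0; its constant value is absorbed by [c]. *)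
Lemma entire_log h : (forall u, hol h u) -> (forall u, h u != 0) ->
  exists2 F, forall u, hol F u & forall u, h u = cexp (F u).
Proof.
move=> hh h0.
have [F dF] : exists F, forall u, cder F u (cderive h u * (h u)^-1).
  apply: primitive => u; apply: holM; last exact: holV.
  exact: (hol_cderive ltr01).
pose g u := h u * cexp (- F u).
have dg u : cder g u 0.
  have d1 : cder (fun v => cexp (- F v)) u (cexp (- F u) * - (cderive h u * (h u)^-1)).
    by apply: (cder_comp (f := cexp)); [exact: cderN|exact: cder_cexp].
  apply: (cder_eq _ (cderM (cderiveP (hh u)) d1)); field; exact: h0.
have [c hc] : exists c, cexp c = g 0.
  by apply: cexp_surj; rewrite mulf_neq0 ?cexp_neq0.
exists (fun u => F u + c) => u.
  by apply: holD; [eexists; exact: dF|exact: hol_cst].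
rewrite cexpD hc (cder0_cst dg 0 u) /g mulrCA cexpNK mulr1 //.
Qed.

Definition ccosh z : K := (cexp z + cexp (- z)) / 2.

(** [f ^ 2 - 1] has no zero, hence an entire square root [s]. As [(f + s) * (f - s) = 1], the
    function [f + s] has a logarithm [F], and [ccosh F] is the mean of [f + s] and [f - s]. *)
Lemma entire_arcosh f : (forall u, hol f u) -> (forall u, f u != 1) ->
  (forall u, f u != -1) ->
  exists2 F, forall u, hol F u & forall u, f u = ccosh (F u).
Proof.
move=> hf f1 fN1.
have [L hL eL] : exists2 L, forall u, hol L u & forall u, f u ^+ 2 - 1 = cexp (L u).
  apply: (entire_log (h := fun u => f u ^+ 2 - 1)) => u.
    by apply: holB; [exact: holX|exact: hol_cst].
  have -> : f u ^+ 2 - 1 = (f u - 1) * (f u - -1) by ring.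
  by rewrite mulf_neq0 // subr_eq0.
pose s u := cexp (2^-1 * L u).
have s2 u : s u * s u = f u ^+ 2 - 1.
  by rewrite eL /s -cexpD; congr cexp; field.
have prod1 u : (f u + s u) * (f u - s u) = 1.
  have -> : (f u + s u) * (f u - s u) = f u ^+ 2 - s u * s u by ring.
  rewrite s2; ring.
have nz u : f u + s u != 0.
  by apply/eqP => h; have /eqP := prod1 u; rewrite h mul0r eq_sym oner_eq0.
have [F hF eF] : exists2 F, forall u, hol F u & forall u, f u + s u = cexp (F u).
  apply: (entire_log (h := fun u => f u + s u)) => // u; apply: holD => //.
  by apply: hol_cexp; apply: holM; [exact: hol_cst|].
exists F => // u; rewrite /ccosh cexpN -eF.
have -> : (f u + s u)^-1 = f u - s u.
  by apply: (mulfI (nz u)); rewrite mulfV // prod1.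
by field.
Qed.

End ComplexExponential.

(** * Little Picard theorem *)

Section Bloch.
Variable R : realType.
Local Notation K := (R[i]).
Local Notation N := (@Normc.normc R).
Local Notation Re := (@complex.Re R).
Local Notation Im := (@complex.Im R).
Implicit Types (f g : K -> K) (z w u p : K) (r : R).

(** The real mean value theorem is applied to [Re] and [Im] separately along the segment, which
    costs the factor 2. *)
Lemma mean_value f p r (M : R) : (forall u, sq p r u -> hol f u) ->
  (forall u, sq p r u -> N (cderive f u) <= M) ->
  forall w, sq p r w -> N (f w - f p) <= 2 * M * N (w - p).
Proof.
move=> hf fM w [hw1 hw2].
pose c (t : R) := p + t%:C%C * (w - p).
have hc (t : R) : 0 <= t <= 1 -> sq p r (c t).
  move=> /andP[t0 t1]; rewrite /sq /c [p + _]addrC addrK ReZ ImZ !normrM (ger0_norm t0).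
  by split; [apply: le_trans hw1|apply: le_trans hw2]; rewrite ler_piMl.
have key (phi : K -> R) : (forall x y, phi (x - y) = phi x - phi y) ->
    (forall (a : R) x, phi (a%:C%C * x) = a * phi x) ->
    (forall x, `|phi x| <= N x) -> `|phi (f w - f p)| <= M * N (w - p).
  move=> pB pZ pN.
  have D (t : R) : 0 <= t <= 1 ->
      is_derive t 1 (fun t : R => phi (f (c t))) (phi (cderive f (c t) * (w - p))).
    move=> /hc /hf /cderiveP df; apply: is_derive_of_le => e e0.
    have D0 : 0 < N (w - p) + 1 by have := normc_ge0 (w - p); lra.
    have [d d0 hd] := df _ (divr_gt0 e0 D0).
    exists (d / (N (w - p) + 1)); first exact: divr_gt0.
    move=> h; rewrite ltr_pdivlMr // => hh.
    have vu : c (t + h) - c t = h%:C%C * (w - p) by rewrite /c rmorphD /=; ring.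
    have Nvu : N (c (t + h) - c t) = `|h| * N (w - p) by rewrite vu Normc.normcM normc_real.
    have vd : N (c (t + h) - c t) < d.
      by rewrite Nvu; apply: le_lt_trans hh; rewrite ler_wpM2l //; lra.
    rewrite mulrC -pZ -!pB.
    have -> : f (c (t + h)) - f (c t) - h%:C%C * (cderive f (c t) * (w - p)) =
      (slope f (c t) (cderive f (c t)) (c (t + h)) - cderive f (c t)) * (c (t + h) - c t).
      by rewrite mulrBl {1}(slopeE f (c t) (cderive f (c t)) (c (t + h))) vu; ring.
    apply: le_trans (pN _) _; rewrite Normc.normcM Nvu.
    have := hd _ vd; rewrite slope_at => h1.
    apply: le_trans (ler_wpM2r _ h1) _; first by rewrite mulr_ge0 ?normc_ge0.
    rewrite mulrAC ler_pdivrMr // -mulrA ler_wpM2l ?(ltW e0) //.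
    by rewrite ler_wpM2l //; lra.
  have [||t ht] := @MVT R (fun t => phi (f (c t))) (fun t => phi (cderive f (c t) * (w - p))) 0 1 ltr01.
  - by move=> t; rewrite in_itv /= => /andP[t0 t1]; apply: D; rewrite !ltW.
  - apply: derivable_within_continuous => t; rewrite in_itv /= => t01.
    exact: (@ex_derive _ _ _ _ _ _ _ (D t t01)).
  rewrite subr0 mulr1 {1 2}/c rmorph1 rmorph0 mul0r mul1r addr0 [p + _]addrC subrK -pB => ->.
  apply: le_trans (pN _) _; rewrite Normc.normcM ler_wpM2r ?normc_ge0 //; apply/fM/hc.
  by move: ht; rewrite in_itv /= => /andP[t0 t1]; rewrite !ltW.
have h1 := key Re (@ReB R) (@ReZ R) (@ler_normRe R).
have h2 := key Im (@ImB R) (@ImZ R) (@ler_normIm R).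
by have := ler_normc_ReIm (f w - f p); lra.
Qed.

Definition supn z : R := Num.max `|Re z| `|Im z|.

Lemma sq_supn z r u : sq z r u <-> supn (u - z) <= r.
Proof. by rewrite /sq /supn ge_max; split=> [[-> ->]|/andP[]]. Qed.

Lemma supnD z w : supn (z + w) <= supn z + supn w.
Proof.
rewrite /supn ge_max ReD ImD; apply/andP; split.
  by apply: le_trans (ler_normD _ _) _; apply: lerD; rewrite le_max lexx.
by apply: le_trans (ler_normD _ _) _; apply: lerD; rewrite le_max lexx orbT.
Qed.

(* The point where (r - |u - z0|) |H'(u)| is almost maximal is the centre of a
   disc on which |H'| is comparable to its value at the centre. *)
Lemma bloch_point H z0 r : (forall u, hol H u) -> 0 < r -> cderive H z0 != 0 ->
  exists p rho, [/\ 0 < rho, r * N (cderive H z0) <= 4 * (rho * N (cderive H p)) &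
    forall u, sq p rho u -> N (cderive H u) <= 4 * N (cderive H p)].
Proof.
move=> hH r0 Hz0.
have cd u : ccont (cderive H) u by apply/hol_ccont/(hol_cderive ltr01).
have [M M0 hM] := sq_bounded (z := z0) r0 (fun u _ => cd u).
pose phi u := (r - supn (u - z0)) * N (cderive H u).
pose X := [set phi u | u in [set u | sq z0 r u]]%classic.
have sz0 : supn (z0 - z0) = 0 by rewrite subrr /supn normr0 maxxx.
have Xub : ubound X (r * M).
  move=> _ [u hu <-]; apply: ler_pM; rewrite ?normc_ge0 ?hM //.
    by rewrite subr_ge0; apply/sq_supn.
  by rewrite gerBl /supn le_max normr_ge0.
have Xs : has_sup X.
  split; last by exists (r * M).
  by exists (phi z0); exists z0 => //; exact/sq_center/ltW.
have phi0 : phi z0 = r * N (cderive H z0) by rewrite /phi sz0 subr0.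
have phi0_gt : 0 < phi z0 by rewrite phi0 mulr_gt0 // normc_gt0.
have ub u : sq z0 r u -> phi u <= sup X.
  by move=> hu; apply: ub_le_sup; [case: Xs|exists u].
have supX : phi z0 <= sup X by apply/ub/sq_center/ltW.
have sX0 : 0 < sup X / 2 by rewrite divr_gt0 //; lra.
(* A point where [phi] exceeds half its supremum is enough. This loss and the choice of [rho] as
   half the distance to the boundary together produce both factors 4. *)
have [_ [p hp <-]] := sup_adherent sX0 Xs.
move=> hphi.
have php : 0 < phi p by lra.
have Np : 0 < N (cderive H p).
  rewrite lt_def normc_ge0 andbT; apply: contraTneq php => h.
  by rewrite /phi h mulr0 ltxx.
have Sp : 0 < r - supn (p - z0) by move: php; rewrite /phi pmulr_lgt0.
exists p, ((r - supn (p - z0)) / 2); split.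
- exact: divr2_gt0.
- rewrite -phi0 (_ : 4 * _ = 2 * phi p); last by rewrite /phi; field.
  lra.
- move=> u /sq_supn hu.
  have su : supn (u - z0) <= supn (p - z0) + (r - supn (p - z0)) / 2.
    have -> : u - z0 = (u - p) + (p - z0) by ring.
    by have := supnD (u - p) (p - z0); lra.
  have hu' : sq z0 r u by apply/sq_supn; lra.
  have := ub u hu'; rewrite {1}/phi => h1.
  have h2 : (r - supn (p - z0)) / 2 * N (cderive H u) <= (r - supn (u - z0)) * N (cderive H u).
    by rewrite ler_wpM2r ?normc_ge0 //; lra.
  have h3 : sup X <= 2 * phi p by lra.
  rewrite /phi in h3.
  have := divr2_gt0 Sp; set rho := _ / 2 in h2 * => rho0.
  rewrite -(ler_pM2l rho0); apply: le_trans h2 _; apply: le_trans h1 _.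
  by apply: le_trans h3 _; rewrite /rho; lra.
Qed.

(** Otherwise [bloch_point] yields a square on whose boundary [H] stays farther than [2 * d] from
    its value [H p] at the centre, while some omitted [a] lies within [d] of [H p]. Then
    [(H - a)^-1] is entire and larger at the centre than on the boundary, against the maximum
    principle. *)
Lemma omitted_dense_cst H (A : K -> Prop) (d : R) : (forall u, hol H u) ->
  (forall c, exists2 w, A w & N (w - c) <= d) -> (forall u, ~ A (H u)) ->
  forall u, cderive H u = 0.
Proof.
move=> hH hA HA z0; apply/eqP; apply: contraT => Hz0.
have d0 : 0 <= d by have [w _ h] := hA 0; apply: le_trans h; exact: normc_ge0.
have Nz0 : 0 < N (cderive H z0) by rewrite normc_gt0.
(* [288 = 4 * 72]: the 4 comes from [bloch_point] and the 72 from [low], so that [rho * lam / 72] is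
   at least [2 * d + 1]. *)
pose r := 288 * (2 * d + 1) / N (cderive H z0).
have r0 : 0 < r by rewrite divr_gt0 // mulr_gt0 //; lra.
have [p [rho [rho0 hrl hM]]] := bloch_point hH r0 Hz0.
have rE : r * N (cderive H z0) = 288 * (2 * d + 1) by rewrite /r divfK // lt0r_neq0.
rewrite {}rE in hrl.
set lam := N (cderive H p) in hrl hM.
have lam0 : 0 <= lam by exact: normc_ge0.
have dp := cderiveP (hH p).
pose q1 := slope H p (cderive H p).
(* The factor 2 of [mean_value] times the bound [4 * lam] on the derivative; subtracting [q1 p]
   raises 8 to the 9 of [q2b]. *)
have q1b w : sq p rho w -> N (q1 w) <= 8 * lam.
  move=> hw; have [->|wp] := eqVneq w p; first by rewrite /q1 slope_at -/lam; lra.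
  rewrite /q1 slope_neq // Normc.normcM Normc.normcV ler_pdivrMr ?normc_gt0 ?subr_eq0 //.
  have := mean_value (fun u _ => hH u) hM hw; lra.
have hq1 u : hol q1 u.
  have Nr : 0 < N (u - p) + 1 by have := normc_ge0 (u - p); lra.
  apply: (hol_slope_at Nr (fun v _ => hH v) dp).
  by apply: sq_ball; lra.
pose q2 := slope q1 p (cderive q1 p).
have q2b w : sq p rho w -> N (q2 w) <= 9 * lam / rho.
  move=> hw; apply: (@max_principle _ q2 p rho [::] _ rho0 _ _ _ w hw).
  - move=> u _; have [->|up] := eqVneq u p; first exact: cderiveP (hq1 p).
    by apply: ccont_slope => //; exact: hol_ccont.
  - move=> u hu _; exact: (hol_slope_at rho0 (fun v _ => hq1 v) (cderiveP (hq1 p))).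
  - move=> u hu; have Nu := sq_bd_ge hu.
    have up : u - p != 0 by rewrite -normc_gt0 (lt_le_trans rho0).
    rewrite /q2 slope_neq; last by rewrite -subr_eq0.
    rewrite Normc.normcM Normc.normcV; apply: ler_pM; rewrite ?invr_ge0 ?normc_ge0 //; last first.
      by rewrite lef_pV2 ?posrE ?normc_gt0.
    apply: le_trans (ler_normcB _ _) _.
    have := q1b u (proj1 hu); have -> : q1 p = cderive H p by rewrite /q1 slope_at.
    rewrite -/lam; lra.
(* On this square [N (w - p)] is at most [rho / 18], so [q2 w * (w - p)] is at most
   [(9 * lam / rho) * (rho / 18) = lam / 2] and cannot cancel [cderive H p]. *)
have rs : 0 < rho / 36 by rewrite divr_gt0.
have low w : sq_bd p (rho / 36) w -> rho * lam / 72 <= N (H w - H p).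
  move=> hw; have w1 := sq_bd_ge hw; have w2 := sq_le (proj1 hw).
  have hw' : sq p rho w by apply: sq_mono (proj1 hw); lra.
  have -> : H w - H p = (w - p) * (cderive H p + q2 w * (w - p)).
    have e1 : H w = H p + q1 w * (w - p) by exact: slopeE.
    have e2 : q1 w = cderive H p + q2 w * (w - p).
      by rewrite -{1}(slope_at H p (cderive H p)); exact: slopeE.
    by rewrite e1 e2; ring.
  rewrite Normc.normcM.
  have h1 : N (q2 w * (w - p)) <= lam / 2.
    rewrite Normc.normcM; apply: le_trans (_ : (9 * lam / rho) * (2 * (rho / 36)) <= _).
      by apply: ler_pM; rewrite ?normc_ge0 ?q2b.
    by rewrite le_eqVlt; apply/orP; left; apply/eqP; field; rewrite lt0r_neq0.
  have h2 : lam / 2 <= N (cderive H p + q2 w * (w - p)).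
    have := lerB_normc (cderive H p) (- (q2 w * (w - p))); rewrite opprK normcN -/lam; lra.
  apply: le_trans (_ : rho / 36 * (lam / 2) <= _); first by lra.
  by apply: ler_pM => //; lra.
have [a Aa ha] := hA (H p).
have Ha u : H u - a != 0.
  by rewrite subr_eq0; apply/eqP => h; apply: (HA u); rewrite h.
have s0 : 2 * d + 1 <= rho * lam / 72 by lra.
have : N ((H p - a)^-1) <= (rho * lam / 72 - d)^-1.
  apply: (@max_principle _ (fun u => (H u - a)^-1) p (rho / 36) [::] _ rs).
  - by move=> u _; apply/hol_ccont/holV => //; apply: holB => //; exact: hol_cst.
  - by move=> u _ _; apply/holV => //; apply: holB => //; exact: hol_cst.
  - move=> w hw; rewrite Normc.normcV lef_pV2 ?posrE ?normc_gt0 //; last by lra.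
    by have := low w hw; have := ler_normc_dist (H w) a (H p); lra.
  - exact/sq_center/ltW.
rewrite Normc.normcV lef_pV2 ?posrE ?normc_gt0 //; last by lra.
rewrite normcBC; lra.
Qed.

Lemma ccoshN z : ccosh (- z) = ccosh z.
Proof. by rewrite /ccosh opprK addrC. Qed.

Lemma cexp_ipi : cexp (0 +i* pi)%C = -1 :> K.
Proof.
by rewrite /cexp /= expR0 cospi sinpi !mul1r; apply/eqP; rewrite eq_complex /= oppr0 !eqxx.
Qed.

Lemma ccosh_ipi n : ccosh (n%:R * (0 +i* pi)%C) = (-1) ^+ n :> K.
Proof.
by rewrite /ccosh cexpN cexp_natmul cexp_ipi invr_sign; field.
Qed.

End Bloch.

(** * Points where cosh is a positive integer, and entire functions that omit two values *)

Section LittlePicard.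
Variable R : realType.
Local Notation K := (R[i]).
Local Notation N := (@Normc.normc R).
Local Notation Re := (@complex.Re R).
Local Notation Im := (@complex.Im R).
Implicit Types (f g : K -> K) (z w u p : K) (r : R).

Lemma cexp_real (v : R) : cexp v%:C%C = (expR v)%:C%C.
Proof.
by apply/eqP; rewrite eq_complex /cexp /= cos0 sin0 mulr1 mulr0 !eqxx.
Qed.

(** [m] is the least integer strictly above the hyperbolic cosine [c] of [|x|], and [v = ln (m + s)]
    is the arcosh of [m]. Then [v >= |x|] by monotonicity, and [m <= c + 1] bounds the excess by
    3. *)
Lemma real_arcosh (x : R) : exists n (v : R), [/\ 0 <= v, `|v - `|x| | <= 3 &
  ccosh v%:C%C = n.+1%:R :> K].
Proof.
pose t : R := `|x|; have t0 : 0 <= t by exact: normr_ge0.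
pose E := expR t; pose F := expR (- t).
have EF : E * F = 1 by rewrite /E /F -expRD subrr expR0.
have E1 : 1 <= E by rewrite -expR0 ler_expR.
have F0 : 0 < F by exact: expR_gt0.
have F1 : F <= 1 by rewrite -EF ler_peMl // ltW.
pose c := (E + F) / 2.
have c0 : 0 <= c by rewrite divr_ge0 // addr_ge0 ?expR_ge0.
pose n := Num.truncn c; pose m : R := n.+1%:R.
have m1 : 1 <= m by rewrite ler1n.
have cm : c < m by exact: truncnS_gt.
have mc : m <= c + 1 by rewrite /m -natr1 lerD2r; move/truncn_itv: c0 => /andP[].
pose s := Num.sqrt (m ^+ 2 - 1).
have s0 : 0 <= s by exact: sqrtr_ge0.
have s2 : s * s = m ^+ 2 - 1.
  by rewrite -expr2 sqr_sqrtr // subr_ge0 expr_ge1 //; lra.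
pose a := m + s; pose b := m - s.
have a1 : 1 <= a by rewrite /a; lra.
have ab : a * b = 1.
  have -> : a * b = m ^+ 2 - s * s by rewrite /a /b; ring.
  by rewrite s2; ring.
have b0 : 0 < b by rewrite -(pmulr_rgt0 (x := a)) ?ab //; lra.
have ev : expR (ln a) = a by rewrite lnK // posrE; lra.
have evN : expR (- ln a) = b.
  by rewrite expRN ev; apply: (mulfI (x := a)); rewrite ?ab ?mulfV //; apply/lt0r_neq0; lra.
exists n, (ln a); split; first exact: ln_ge0.
- rewrite -/t ler_norml; apply/andP; split.
  + suff : t <= ln a by lra.
    rewrite leNgt; apply/negP; rewrite -ltr_expR ev -/E => aE.
    have : a + b <= E + F.
      (* Since [E * F = a * b = 1], this product is [E + F - a - b]: a sum of a number and its
         inverse increases with the number beyond 1. *)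
      have : 0 <= (E - a) * (1 - b * F).
        apply: mulr_ge0; first by lra.
        rewrite subr_ge0; have : b <= 1 by rewrite -ab ler_peMl // ltW.
        by move=> b1; rewrite mulr_ile1 // ltW.
      have -> : (E - a) * (1 - b * F) = E - a - (E * F) * b + (a * b) * F by ring.
      rewrite EF ab; lra.
    by move: cm; rewrite /c /a /b; lra.
  + suff : ln a <= t + 3 by lra.
    rewrite leNgt; apply/negP; rewrite -ltr_expR ev expRD -/E => aE.
    (* The contradiction is the chain [a <= 2 * m <= E + F + 2 <= 4 * E <= E * expR 3]. *)
    have e2 : 4 <= expR 3 :> R by have := expR_ge1Dx (3 : R); lra.
    have : 4 * E <= E * expR 3 by rewrite mulrC ler_wpM2l //; lra.
    have sm : s <= m by move: b0; rewrite /b; lra.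
    by move: mc aE; rewrite /c /a; lra.
- rewrite /ccosh -rmorphN !cexp_real ev evN -rmorphD /a /b.
  have -> : m + s + (m - s) = m * 2 by ring.
  by rewrite rmorphM !rmorph_nat mulfK // pnatr_eq0.
Qed.

(** [11 = 3 + 8]. Evenness of [ccosh] reduces the real part to [real_arcosh]; the imaginary part is
    approached by multiples of the period, within 8 because [pi <= 4]. *)
Lemma ccosh_nat_dense (c : K) : exists2 w, (exists n, ccosh w = n.+1%:R) & N (w - c) <= 11.
Proof.
have [n [v [v0 vx hv]]] := real_arcosh (Re c).
have pi4 : pi <= 4 :> R by have [/andP[_ h] _] := pihalf_02_cos_pihalf R; rewrite ler_pdivrMr // in h; apply: le_trans h _; lra.
have pi0 : 0 < pi :> R by exact: pi_gt0.
pose k := Num.truncn (`|Im c| / (2 * pi)).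
have twopi : 0 < 2 * pi :> R by rewrite mulr_gt0.
pose y : R := k%:R * (2 * pi).
have [y1 y2] : y <= `|Im c| /\ `|Im c| <= y + 8.
  have := truncn_itv (divr_ge0 (normr_ge0 (Im c)) (ltW twopi)).
  rewrite ler_pdivlMr // ltr_pdivrMr // -/k -[k.+1%:R]natr1 => /andP[h1 h2].
  by rewrite /y; split; lra.
have y0 : 0 <= y by rewrite mulr_ge0 // ltW.
have c1 : cexp (0 +i* y)%C = 1.
  have -> : (0 +i* y)%C = (k * 2)%:R * (0 +i* pi)%C :> K.
    apply/eqP; rewrite eq_complex /y -(rmorph_nat (real_complex R)) ReZ ImZ /= natrM.
    by apply/andP; split; apply/eqP; ring.
  by rewrite cexp_natmul cexp_ipi mulnC exprM sqrrN !expr1n.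
have c1N : cexp (0 +i* (- y))%C = 1.
  have -> : (0 +i* (- y))%C = - (0 +i* y)%C :> K.
    by apply/eqP; rewrite eq_complex /= oppr0 !eqxx.
  by rewrite cexpN c1 invr1.
have shift w u : cexp u = 1 -> ccosh (w + u) = ccosh w.
  by move=> h; rewrite /ccosh opprD !cexpD !cexpN h invr1 !mulr1.
pose s1 : R := if 0 <= Re c then v else - v.
pose t1 : R := if 0 <= Im c then y else - y.
exists (s1%:C%C + (0 +i* t1)%C).
  exists n; rewrite shift; last by rewrite /t1; case: ifP.
  by rewrite /s1; case: ifP => // _; rewrite rmorphN ccoshN.
apply: le_trans (ler_normc_ReIm _) _; rewrite ReB ImB ReD ImD /= addr0 add0r.
have h1 : `|s1 - Re c| <= 3.
  rewrite /s1; case: (ifP (0 <= Re c)) => h; first by move: vx; rewrite (ger0_norm h).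
  have {}h : Re c < 0 by rewrite ltNge h.
  move: vx; rewrite (ltr0_norm h) => vx.
  by rewrite -normrN; have -> : - (- v - Re c) = v - - Re c by ring.
have h2 : `|t1 - Im c| <= 8.
  rewrite /t1; case: (ifP (0 <= Im c)) => h.
    by move: y1 y2; rewrite (ger0_norm h) ler_norml => ? ?; apply/andP; split; lra.
  have {}h : Im c < 0 by rewrite ltNge h.
  by move: y1 y2; rewrite (ltr0_norm h) ler_norml => ? ?; apply/andP; split; lra.
lra.
Qed.

Lemma little_picard f (a b : K) : (forall u, hol f u) -> a != b ->
  (forall u, f u != a) -> (forall u, f u != b) -> forall u, f u = f 0.
Proof.
move=> hf ab fa fb.
have ba : b - a != 0 by rewrite subr_eq0 eq_sym.
(* The affine map that sends [a] to -1 and [b] to 1. *)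
pose g u := (2 * f u - (a + b)) * (b - a)^-1.
have hg u : hol g u.
  apply: holM; last exact: hol_cst.
  apply: holB; last exact: hol_cst.
  by apply: holM; first exact: hol_cst.
have fE u : f u = (g u * (b - a) + (a + b)) / 2.
  by rewrite /g mulfVK //; field.
have g1 u : g u != 1.
  by apply: contraNneq (fb u) => h; rewrite fE h; apply/eqP; field.
have gN1 u : g u != -1.
  by apply: contraNneq (fa u) => h; rewrite fE h; apply/eqP; field.
have [F hF gF] := entire_arcosh hg g1 gN1.
pose ip : K := (0 +i* pi)%C.
have ip0 : ip != 0 by rewrite eq_complex /= negb_and (lt0r_neq0 (pi_gt0 R)) orbT.
pose G u := F u * ip^-1.
have hG u : hol G u by apply: holM => //; exact: hol_cst.
have FG u : F u = G u * ip by rewrite /G mulfVK.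
(* [ccosh] takes the values 1 and -1, which [g] omits, at the multiples of [ip]. The case 1, with
   [GN1], permits the second arcosh; the positive integers are then omitted by [ccosh (H u)]. *)
have Gn n u : G u != n%:R.
  apply/eqP => h; have := gF u; rewrite FG h ccosh_ipi -signr_odd => h1.
  case: (odd n) h1; rewrite ?expr1 ?expr0 => h1.
    by have := gN1 u; rewrite h1 eqxx.
  by have := g1 u; rewrite h1 eqxx.
have GN1 u : G u != -1.
  apply/eqP => h; have := gF u; rewrite FG h mulN1r ccoshN -[ip]mul1r.
  rewrite (ccosh_ipi R 1) expr1 => h1.
  by have := gN1 u; rewrite h1 eqxx.
have [H hH GH] := entire_arcosh hG (Gn 1%N) GN1.
have dH := omitted_dense_cst hH ccosh_nat_dense _.
have HA u : ~ exists n, ccosh (H u) = n.+1%:R.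
  by move=> [n]; rewrite -GH => h; have := Gn n.+1 u; rewrite h eqxx.
have {}dH := dH HA => u.
have HE : H u = H 0.
  by apply: cder0_cst => w; rewrite -(dH w); apply: cderiveP.
by rewrite !fE !gF !FG !GH HE.
Qed.

End LittlePicard.

(** * Jackson-Picard values *)

Section JacksonPicard.
Variable R : realType.
Local Notation K := (R[i]).
Local Notation N := (@Normc.normc R).

(** * From the topology and derivability of [R[i]] to estimates with the real modulus *)

Lemma normr_normc (z : Cplx R) : `|z| = (N z)%:C%C.
Proof. by case: z. Qed.

(** A positive element of [R[i]] is real, so the radius of a ball can be taken in [R]. *)
Lemma near_normcP (z : Cplx R) (P : Cplx R -> Prop) : (\forall w \near z, P w)%classic <->
  exists2 d : R, 0 < d & forall w : K, N (w - z) < d -> P w.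
Proof.
split=> [/nbhs_ballP [e /= e0 he]|[d d0 hd]].
  have [a ea] : exists a : R, e = a%:C%C by apply/complex_realP; exact: gtr0_real.
  exists a; first by move: e0; rewrite ea -(rmorph0 (real_complex R)) ltcR.
  move=> w hw; apply: he; rewrite /ball /= distrC normr_normc ea ltcR; exact: hw.
apply/nbhs_ballP; exists (d%:C%C); first by rewrite /= -(rmorph0 (real_complex R)) ltcR.
by move=> w; rewrite /ball /= distrC normr_normc ltcR; exact: hd.
Qed.

Lemma dnear_normcP (z : Cplx R) (P : Cplx R -> Prop) : (\forall w \near z^', P w)%classic <->
  exists2 d : R, 0 < d & forall w : K, N (w - z) < d -> w != z -> P w.
Proof. exact: (near_normcP z (fun w => w != z -> P w)). Qed.

Lemma derivable_hol (g : Cplx R -> Cplx R) (z : Cplx R) : derivable g z 1 <-> hol g z.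
Proof.
split=> [dg|[l dl]].
  exists ('D_1 g z) => e e0.
  have C : ((fun h : K => h^-1 *: (g (h *: 1 + z) - g z)) @ (0 : Cplx R)^' --> 'D_1 g z)%classic.
    exact: dg.
  have e0' : 0 < e%:C%C :> K by rewrite -(rmorph0 (real_complex R)) ltcR.
  have /cvgrPdist_le /(_ _ e0') /dnear_normcP [d d0 hd] := C.
  exists d => // w wd; rewrite slope_at; have [->|wz] := eqVneq w z.
    by rewrite slope_at subrr Normc.normc0 ltW.
  rewrite slope_neq //; have := hd (w - z); rewrite subr0 subr_eq0 => /(_ wd wz).
  rewrite distrC normr_normc lecR.
  have -> : (w - z) *: (1 : Cplx R) + z = w by rewrite /GRing.scale /= mulr1 subrK.
  by rewrite /GRing.scale /= mulrC.
suff C : ((fun h : K => h^-1 *: (g (h *: 1 + z) - g z)) @ (0 : Cplx R)^' --> (l : Cplx R))%classic.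
  exact: cvgP C.
apply/cvgrPdist_le => e e0.
have [a ea] : exists a : R, e = a%:C%C by apply/complex_realP; exact: gtr0_real.
have a0 : 0 < a by move: e0; rewrite ea -(rmorph0 (real_complex R)) ltcR.
have [d d0 hd] := dl a a0.
apply/dnear_normcP; exists d => // h; rewrite subr0 => hh h0.
rewrite distrC normr_normc ea lecR.
have := hd (z + h); rewrite slope_at slope_neq; last by rewrite addrC -subr_eq0 addrK.
rewrite addrC addrA addNr add0r => /(_ hh).
by rewrite /GRing.scale /= mulr1 [h^-1 * _]mulrC [h + z]addrC.
Qed.

Lemma holomorphic_nearP (g : Cplx R -> Cplx R) (z : Cplx R) : holomorphic_near g z <->
  exists2 d : R, 0 < d & forall w : K, N (w - z) < d -> hol g w.
Proof.
split=> [/near_normcP [d d0 hd]|[d d0 hd]].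
  by exists d => // w /hd /derivable_hol.
by apply/near_normcP; exists d => // w /hd /derivable_hol.
Qed.

Implicit Types (f F : Cplx R -> sphere R) (z w : K).

(** * Regular points and poles of f and of 1 / f *)

Definition regular f z := exists g : K -> K, exists2 d : R, 0 < d &
  forall w, N (w - z) < d -> hol g w /\ f w = Some (g w).

(* Unlike isolated_pole, this holds for 1 / f at any zero of f, even if f vanishes
   identically near z. *)
Definition weak_pole f z := f z = None /\ forall A : R, exists2 d : R, 0 < d &
  forall w v, N (w - z) < d -> w != z -> f w = Some v -> A <= N v.

Definition isolated_pole f z := f z = None /\ exists g : K -> K,
  (exists2 d : R, 0 < d & forall w, N (w - z) < d -> w != z -> hol g w /\ f w = Some (g w)) /\
  forall A : R, exists2 d : R, 0 < d & forall w, N (w - z) < d -> w != z -> A <= N (g w).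

Lemma regular_atP f z : regular_at f z -> regular f z.
Proof.
move=> [g /holomorphic_nearP [d d0 hd] /near_normcP [d' d'0 hd']].
exists g, (Num.min d d'); first by rewrite lt_min d0.
by move=> w; rewrite lt_min => /andP[/hd ? /hd' ?].
Qed.

Lemma pole_atP f z : pole_at f z -> isolated_pole f z.
Proof.
move=> [fz [g /dnear_normcP [d d0 hd]] lim]; split=> //; exists g; split.
  by exists d => // w wd wz; have [? /derivable_hol ?] := hd w wd wz.
move=> A; have /cvgeyPge /(_ A) /dnear_normcP [d' d'0 hd'] := lim.
exists (Num.min d d'); first by rewrite lt_min d0.
move=> w; rewrite lt_min => /andP[w1 w2] wz.
by have := hd' w w2 wz; have [-> _] := hd w w1 wz; rewrite /= lee_fin.
Qed.

Lemma isolated_weak_pole f z : isolated_pole f z -> weak_pole f z.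
Proof.
move=> [fz [g [[d d0 hd] lim]]]; split=> // A; have [d' d'0 hd'] := lim A.
exists (Num.min d d'); first by rewrite lt_min d0.
move=> w v; rewrite lt_min => /andP[w1 w2] wz.
by have [_ ->] := hd w w1 wz => -[<-]; exact: hd'.
Qed.

(** The inverse of [g] tends to 0 at the pole, so its extension by 0 is continuous there and
    [removable] applies. *)
Lemma isolated_pole_recip f z : isolated_pole f z -> regular (recip f) z.
Proof.
move=> [fz [g [[d d0 hd] lim]]].
have [d1 d10 hd1] := lim 1.
pose k w := if w == z then 0 else (g w)^-1.
pose D := Num.min d d1; have D0 : 0 < D by rewrite lt_min d0.
have gn0 w : N (w - z) < D -> w != z -> g w != 0.
  rewrite lt_min => /andP[_ w2] wz; rewrite -normc_gt0.
  by have := hd1 w w2 wz; lra.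
have hk w : N (w - z) < D -> w != z -> hol k w.
  move=> wD wz; apply: (@hol_near _ (fun v => (g v)^-1) _ _ (N (w - z))).
  - by rewrite normc_gt0 subr_eq0.
  - move=> v vw; rewrite /k; case: eqP => // vz; move: vw; rewrite vz normcBC ltxx //.
  - apply: holV; first exact: gn0.
    by move: wD; rewrite lt_min => /andP[w1 _]; case: (hd w w1 wz).
have ck : ccont k z.
  move=> e e0; have [d2 d20 hd2] := lim e^-1.
  exists (Num.min D d2); first by rewrite lt_min D0.
  move=> w; rewrite lt_min => /andP[w1 w2]; rewrite /k eqxx subr0.
  case: eqVneq => [_|wz]; first by rewrite Normc.normc0 ltW.
  rewrite Normc.normcV -[e]invrK lef_pV2 ?posrE ?invr_gt0 ?normc_gt0 ?gn0 //; exact: hd2.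
have D4 : 0 < D / 4 by rewrite divr_gt0.
have hkz : hol k z.
  apply: (removable D4 ck) => u hu uz; apply: hk => //.
  by have := sq_le hu; lra.
exists k, D => // w wD; have [wz|wz] := eqVneq w z.
  by rewrite wz; split=> //; rewrite /recip fz /k eqxx.
split; first exact: hk.
move: (wD); rewrite lt_min => /andP[w1 _]; have [_ fw] := hd w w1 wz.
by rewrite /recip fw /k (negbTE (gn0 w wD wz)) (negbTE wz).
Qed.

Lemma regular_recip f z : regular f z -> f z != Some 0 -> regular (recip f) z.
Proof.
move=> [g [d d0 hd]].
have [hg fz] : hol g z /\ f z = Some (g z) by apply: hd; rewrite subrr Normc.normc0.
rewrite fz => gz; have {}gz : g z != 0 by apply: contraNneq gz => ->.
have [d' d'0 hd'] := ccont_neq0 (hol_ccont hg) gz.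
exists (fun w => (g w)^-1), (Num.min d d'); first by rewrite lt_min d0.
move=> w; rewrite lt_min => /andP[/hd [hw fw] /hd' gw].
by split; [exact: holV|rewrite /recip fw (negbTE gw)].
Qed.

Lemma zero_recip_weak_pole f z : regular f z -> f z = Some 0 -> weak_pole (recip f) z.
Proof.
move=> [g [d d0 hd]] fz0.
have [hg fz] : hol g z /\ f z = Some (g z) by apply: hd; rewrite subrr Normc.normc0.
have gz : g z = 0 by move: fz; rewrite fz0 => -[].
split; first by rewrite /recip fz0 eqxx.
move=> A; have A0 : 0 < `|A| + 1 by rewrite ltr_wpDl.
have [d' d'0 hd'] := hol_ccont hg (e := (`|A| + 1)^-1) (ltac:(by rewrite invr_gt0)).
exists (Num.min d d'); first by rewrite lt_min d0.
move=> w v; rewrite lt_min => /andP[/hd [_ fw] /hd']; rewrite gz subr0 => gw _.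
rewrite /recip fw; case: eqP => // /eqP gw0 [<-].
rewrite Normc.normcV; apply: le_trans (_ : `|A| + 1 <= _).
  by have := ler_norm A; lra.
by rewrite -[`|A| + 1]invrK lef_pV2 ?posrE ?invr_gt0 // normc_gt0.
Qed.

Lemma meromorphicP f : meromorphic f -> forall z, regular f z \/ isolated_pole f z.
Proof. by move=> h z; case: (h z) => [/regular_atP|/pole_atP]; [left|right]. Qed.

Lemma meromorphic_weak f : meromorphic f -> forall z, regular f z \/ weak_pole f z.
Proof. by move=> h z; case: (meromorphicP h z) => [|/isolated_weak_pole]; [left|right]. Qed.

Lemma meromorphic_recip f : meromorphic f -> forall z, regular (recip f) z \/ weak_pole (recip f) z.
Proof.
move=> h z; case: (meromorphicP h z) => [rf|/isolated_pole_recip]; last by left.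
have [fz|fz] := eqVneq (f z) (Some 0); first by right; exact: zero_recip_weak_pole.
by left; exact: regular_recip.
Qed.

(** * Identity theorem *)

Definition loc_cst f a z := exists2 d : R, 0 < d & forall w, N (w - z) < d -> f w = Some a.

Lemma loc_cst_open f a z : loc_cst f a z ->
  exists2 d : R, 0 < d & forall w, N (w - z) < d -> loc_cst f a w.
Proof.
move=> [d d0 hd]; exists d => // w wd; exists (d - N (w - z)); first by lra.
by move=> u ud; apply: hd; have := ler_normc_dist u w z; lra.
Qed.

Lemma regular_cst_or_order f a z : regular f z -> f z = Some a ->
  loc_cst f a z \/ exists h (g : K -> K), [/\ (0 < h)%N, g z != 0 &
    exists2 d : R, 0 < d & forall w, N (w - z) < d ->
      hol g w /\ f w = Some (a + (w - z) ^+ h * g w)].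
Proof.
move=> [g [d d0 hd]] fz.
have [_ ] : hol g z /\ f z = Some (g z) by apply: hd; rewrite subrr Normc.normc0.
rewrite fz => -[gz].
have d4 : 0 < d / 4 by rewrite divr_gt0.
have hs u : sq z (d / 4) u -> hol (fun v => g v - a) u.
  move=> hu; have ud : N (u - z) < d by have := sq_le hu; lra.
  by have [hg _] := hd u ud; apply: holB => //; exact: hol_cst.
case: (local_factor d4 hs) => [h|[n [k [hk kz gE]]]].
  left; exists (d / 4) => // w wd.
  have [|_ ->] := hd w; first by lra.
  by congr Some; apply/eqP; rewrite -subr_eq0 h.
right; exists n, k; split=> //.
  case: n gE => // gE; have := gE z.
  by rewrite expr0 mul1r -gz subrr => k0; rewrite -k0 eqxx in kz.
exists (d / 4) => // w wd; split; first by apply/hk/sq_ball/ltW.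
have [|_ ->] := hd w; first by lra.
by rewrite -gE addrC subrK.
Qed.

(** The value [a] is taken at points other than [x] arbitrarily close to [x]. This excludes a pole,
    forces [f x = Some a], and contradicts the isolation of the [a]-point [x] unless [f] is constant
    near [x]. *)
Lemma loc_cst_closed f a x : (forall z, regular f z \/ weak_pole f z) ->
  (forall d : R, 0 < d -> exists2 y, N (y - x) < d & loc_cst f a y) -> loc_cst f a x.
Proof.
move=> mf H.
have pts (d : R) : 0 < d -> exists w, [/\ N (w - x) < d, w != x & f w = Some a].
  move=> d0; have [y yd [d' d'0 hd']] := H d d0.
  have m0 : 0 < Num.min d' (d - N (y - x)) by rewrite lt_min d'0; lra.
  have [w []] := exists_near_neq y [:: x] m0.
  rewrite lt_min inE => /andP[w1 w2] wx _; exists w; split=> //; last exact: hd'.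
  by have := ler_normc_dist w y x; lra.
case: (mf x) => [rf|[fx lim]]; last first.
  have [d d0 hd] := lim (N a + 1); have [w [wd wx fw]] := pts d d0.
  by have := hd w a wd wx fw; lra.
have [g [d d0 hd]] := rf.
have [hg fx] : hol g x /\ f x = Some (g x) by apply: hd; rewrite subrr Normc.normc0.
have gx : g x = a.
  apply/eqP; rewrite -subr_eq0; apply: contraT => ga.
  have cg : ccont (fun w => g w - a) x by apply: ccontB; [exact: hol_ccont|exact: ccont_cst].
  have [d' d'0 hd'] := ccont_neq0 cg ga.
  have m0 : 0 < Num.min d d' by rewrite lt_min d0.
  have [w []] := pts _ m0; rewrite lt_min => /andP[/hd [_ ->] /hd' h] _ [e].
  by rewrite e subrr eqxx in h.
rewrite gx in fx.
case: (regular_cst_or_order rf fx) => // -[h [k [h0 kx [d' d'0 hd']]]].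
have [hkx _] : hol k x /\ f x = Some (a + (x - x) ^+ h * k x) by apply: hd'; rewrite subrr Normc.normc0.
have [d2 d20 hd2] := ccont_neq0 (hol_ccont hkx) kx.
have m0 : 0 < Num.min d' d2 by rewrite lt_min d'0.
have [w []] := pts _ m0; rewrite lt_min => /andP[/hd' [_ ->] /hd2 kw] wx [].
rewrite -[RHS]addr0 => /addrI /eqP; rewrite mulf_eq0 (negbTE kw) orbF expf_eq0.
by rewrite subr_eq0 (negbTE wx) andbF.
Qed.

(** Connectedness of the segment from [p] to [z]: [loc_cst] is an open condition and, by
    [loc_cst_closed], a closed one, which also rules out poles on the way. *)
Lemma loc_cst_global f a p : (forall z, regular f z \/ weak_pole f z) -> loc_cst f a p ->
  forall z, f z = Some a.
Proof.
move=> mf lp z.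
pose c (t : R) : K := p + t%:C%C * (z - p).
have Nc (s t : R) : N (c s - c t) = `|s - t| * N (z - p).
  by rewrite -normc_real -Normc.normcM rmorphB /=; congr N; rewrite /c; ring.
have D0 : 0 < N (z - p) + 1 by have := normc_ge0 (z - p); lra.
pose S := [set t : R | 0 <= t <= 1 /\ forall s, 0 <= s <= t -> loc_cst f a (c s)]%classic.
have S0 : S 0.
  split; first by rewrite lexx ler01.
  move=> s /andP[s0 s1]; have -> : s = 0 by lra.
  by rewrite /c rmorph0 mul0r addr0.
have hS : has_sup S.
  by split; [exists 0|exists 1 => t [/andP[_ ?] _]].
pose T := sup S.
have ubT t : S t -> t <= T by move=> St; apply: ub_le_sup => //; case: hS.
have T0 : 0 <= T by exact: ubT.
have T1 : T <= 1 by apply: ge_sup; [case: hS|move=> t [/andP[_ ?] _]].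
have near (d : R) : 0 < d -> exists2 s, S s & T - d < s by move=> d0; exact: sup_adherent.
have LT : loc_cst f a (c T).
  apply: loc_cst_closed => // d d0.
  have [s Ss sT] := near _ (divr_gt0 d0 D0).
  exists (c s); last by case: Ss => /andP[s0 s1]; apply; rewrite lexx s0.
  have sT' := ubT s Ss.
  rewrite Nc ler0_norm; last by lra.
  apply: le_lt_trans (_ : (T - s) * (N (z - p) + 1) < d).
    by rewrite opprB ler_wpM2l //; lra.
  by rewrite -ltr_pdivlMr //; lra.
have [d d0 hd] := loc_cst_open LT.
have e0 : 0 < d / (N (z - p) + 1) by rewrite divr_gt0.
set e := d / _ in e0.
have [s Ss sT] := near e e0.
have ext (t : R) : 0 <= t -> t < T + e -> loc_cst f a (c t).
  move=> t0 te; have [ts|st] := leP t s; first by case: Ss => _; apply; rewrite t0.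
  apply: hd; rewrite Nc; apply: le_lt_trans (_ : `|t - T| * (N (z - p) + 1) < d).
    by rewrite ler_wpM2l //; lra.
  by rewrite -ltr_pdivlMr // -/e ltr_norml; apply/andP; split; lra.
have : loc_cst f a (c 1).
  have [lt1|] := ltP 1 (T + e); first exact: ext.
  (* Otherwise [S] would contain a number beyond its supremum. *)
  move=> ge1; suff /ubT : S (T + e / 2) by lra.
  split; first by apply/andP; split; lra.
  by move=> t /andP[t0 te]; apply: ext; lra.
rewrite /c rmorph1 mul1r addrC subrK => -[d' d'0 hd']; apply: hd'.
by rewrite subrr Normc.normc0.
Qed.

(** * Multiplicities and the counting function *)

Lemma vanishing_order_unique F z h h' :
  is_vanishing_order F z h -> is_vanishing_order F z h' -> h = h'.
Proof.
wlog : h h' / (h <= h')%N.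
  move=> W H H'; have [/W|/ltnW/W] := leqP h h'; first exact.
  by move=> /(_ H' H).
rewrite leq_eqVlt => /orP[/eqP //|hh'].
move=> [g [/holomorphic_nearP [d1 d10 hg] gz /dnear_normcP [d2 d20 e1]]].
move=> [g' [/holomorphic_nearP [d3 d30 hg'] _ /dnear_normcP [d4 d40 e2]]].
have z0 (d : R) : 0 < d -> N (z - z) < d by rewrite subrr Normc.normc0.
have m0 : 0 < Num.min d2 d4 by rewrite lt_min d20.
(* After cancellation of [(w - z) ^+ h], letting [w] tend to [z] would give [g z = 0], as
   [h < h']. *)
suff E : g z = (z - z) ^+ (h' - h) * g' z.
  by move: gz; rewrite E subrr expr0n subn_eq0 leqNgt hh' mul0r eqxx.
apply: (ccont_lim_unique (f := g) (g := fun w => (w - z) ^+ (h' - h) * g' w) m0).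
- exact/hol_ccont/hg/z0.
- apply/hol_ccont/holM; last exact/hg'/z0.
  by apply: holX; apply: holB; [exact: hol_id|exact: hol_cst].
- move=> w; rewrite lt_min => /andP[/e1 {}e1 /e2 {}e2] wz.
  have := e1 wz; rewrite (e2 wz) => -[] eq.
  have wz0 : (w - z) ^+ h != 0 by rewrite expf_neq0 // subr_eq0.
  apply: (mulfI wz0); rewrite -eq mulrA -exprD subnKC //; exact: ltnW.
Qed.

Lemma zero_multE F z h : is_vanishing_order F z h -> zero_mult F z = h.
Proof.
move=> H.
exact: (vanishing_order_unique (@xgetPex _ 0%N (is_vanishing_order F z) (ex_intro _ h H)) H).
Qed.

(** A positive value cannot be the default 0, so it is a genuine order. *)
Lemma zero_mult_gt0 F z : (0 < zero_mult F z)%N -> is_vanishing_order F z (zero_mult F z).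
Proof.
have [ex _|/forallNP h] := pselect (exists h, is_vanishing_order F z h).
  exact: (@xgetPex _ 0%N (is_vanishing_order F z)).
by rewrite /zero_mult xgetPN.
Qed.

(** All terms are nonnegative, so each is bounded by the sum over the disc of radius [N z + 1],
    which contains [z]. *)
Lemma nJ_fin_defect q f a : (forall r, 0 < r -> nJ_fin q f a r = 0%E) ->
  forall z, f z = Some a -> jackson_defect q f a z = 0%N.
Proof.
move=> H z fz.
have r0 : 0 < N z + 1 by have := normc_ge0 z; lra.
apply/eqP; rewrite -leqn0 -(ler_nat R) -lee_fin.
apply: (@le_trans _ _ (nJ_fin q f a (N z + 1))); last by rewrite H.
apply: esum_ge; exists [set z]%classic.
  split; first exact: finite_set1.
  by move=> _ ->; split=> //=; lra.
by rewrite fsbig_set1.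
Qed.

(** Defect 0 means [h <= k], and [h > 0] at an isolated [a]-point; so [k] is positive, hence a
    genuine vanishing order of the Jackson quotient, and provides the cofactor [G]. *)
Lemma JP_vanishing q f a z : jackson_defect q f a z = 0%N -> regular f z -> f z = Some a ->
  loc_cst f a z \/ exists h k (g G : K -> K), [/\ (0 < h <= k)%N, g z != 0, ccont G z &
    exists2 d : R, 0 < d & forall w, N (w - z) < d ->
      [/\ hol g w, f w = Some (a + (w - z) ^+ h * g w) & w != z ->
        exists u v, [/\ f (q * w) = Some u, f w = Some v &
          (u - v) / (q * w - w) = (w - z) ^+ k * G w]]].
Proof.
move=> defect rf fz; case: (regular_cst_or_order rf fz) => [|[h [g [h0 gz [d d0 hd]]]]]; first by left.
right; have vo : is_vanishing_order (minus_cst f a) z h.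
  exists g; split=> //.
    by apply/holomorphic_nearP; exists d => // w /hd [].
  apply/dnear_normcP; exists d => // w /hd [_ fw] _.
  by rewrite /minus_cst fw /= addrC addKr.
move/eqP: defect; rewrite /jackson_defect (zero_multE vo).
set k := zero_mult (jackson q f) z; rewrite subn_eq0 leq_min leqnn /= => hk.
have := @zero_mult_gt0 (jackson q f) z; rewrite -/k => /(_ (leq_trans h0 hk)).
move=> [G [/holomorphic_nearP [d1 d10 hG] _ /dnear_normcP [d2 d20 hJ]]].
exists h, k, g, G; split=> //; first by rewrite h0.
  by apply/hol_ccont/hG; rewrite subrr Normc.normc0.
exists (Num.min d d2); first by rewrite lt_min d0.
move=> w; rewrite lt_min => /andP[/hd [hg fw] w2]; split=> // wz.
have := hJ w w2 wz; rewrite /jackson fw.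
case: (f (q * w)) => // u [e]; exists u, (a + (w - z) ^+ h * g w); split=> //.
Qed.

(* At an a-point, f (q w) = f w + (q w - w) D_q f (w) tends to a, because a
   Jackson-Picard value forces D_q f to vanish there. *)
Lemma JP_forward q f a z : 0 < N q -> N q < 1 -> (forall w, regular f w \/ weak_pole f w) ->
  z != 0 -> regular f z -> f z = Some a -> jackson_defect q f a z = 0%N ->
  loc_cst f a z \/ f (q * z) = Some a.
Proof.
move=> q0 q1 mf z0 rf fz defect.
case: (JP_vanishing defect rf fz) => [|[h [k [g [G [/andP[h0 hk] gz cG [d d0 hd]]]]]]]; first by left.
right; have k0 : (0 < k)%N by exact: leq_trans hk.
have zz (e : R) : 0 < e -> N (z - z) < e by rewrite subrr Normc.normc0.
have qn1 : q != 1 by apply: contraTneq q1 => ->; rewrite Normc.normc1 ltxx.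
have qn0 : q != 0 by rewrite -normc_gt0.
have [hg _ _] := hd z (zz d d0).
(* The value of [f (q * w)] forced by the Jackson quotient; it is [a] at [w = z] because [h] and [k]
   are positive. *)
pose L w := (a + (w - z) ^+ h * g w) + (w - z) ^+ k * G w * (q * w - w).
have cpow n : ccont (fun w => (w - z) ^+ n) z.
  by apply/hol_ccont/holX/holB; [exact: hol_id|exact: hol_cst].
have cL : ccont L z.
  apply: ccontD; last first.
    apply: ccontM; first exact: ccontM.
    by apply/hol_ccont/holB/hol_id/holM/hol_id/hol_cst.
  by apply: ccontD; [exact: ccont_cst|apply: ccontM => //; exact: hol_ccont].
have Lz : L z = a by rewrite /L subrr !expr0n !gtn_eqF // !mul0r !addr0.
(* Within distance [N z] of [z] the point [w] is nonzero, so [q * w - w] can be cleared from the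
   quotient. *)
have fq w : N (w - z) < Num.min d (N z) -> w != z -> f (q * w) = Some (L w).
  rewrite lt_min => /andP[w1 w2] wz; have [_ fw /(_ wz) [u [v [-> fv e]]]] := hd w w1.
  have w0 : w != 0 by apply: contraTneq w2 => ->; rewrite sub0r normcN ltxx.
  have qw : q * w - w != 0.
    have -> : q * w - w = (q - 1) * w by ring.
    by rewrite mulf_neq0 // subr_eq0.
  move: fv; rewrite fw => -[fv]; congr Some; rewrite /L -e mulfVK // fv; ring.
have m0 : 0 < Num.min d (N z) by rewrite lt_min d0 normc_gt0.
have Nq w : N (q * w - q * z) <= N (w - z).
  by rewrite -mulrBr Normc.normcM ler_piMl ?normc_ge0 // ltW.
case: (mf (q * z)) => [[g2 [d2 d20 hd2]]|[fqz lim]].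
  have [hg2 ->] : hol g2 (q * z) /\ f (q * z) = Some (g2 (q * z)) by apply: hd2; rewrite subrr Normc.normc0.
  congr Some; rewrite -Lz.
  apply: (ccont_lim_unique (f := fun w => g2 (q * w)) (d := Num.min (Num.min d (N z)) d2)) => //.
  - by rewrite lt_min m0.
  - apply: (ccont_comp (g := fun w => q * w)); last exact: hol_ccont.
    by apply/hol_ccont/holM/hol_id/hol_cst.
  - move=> w; rewrite lt_min => /andP[w1 w2] wz.
    have [|_] := hd2 (q * w); first exact: le_lt_trans w2.
    by rewrite fq // => -[].
(* A pole at [q * z] is impossible, since [f (q * w) = L w] stays bounded as [w] tends to [z]. *)
have [d1 d10 hb] := ccont_bnd cL.
have [d2 d20 hd2] := lim (N (L z) + 2).
have m1 : 0 < Num.min (Num.min d (N z)) (Num.min d1 d2) by rewrite !lt_min d0 normc_gt0 z0 d10.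
have [w []] := exists_near_neq z [::] m1.
rewrite lt_min [X in _ && X]lt_min => /and3P[w1 w2 w3] _ wz.
have qwz : q * w != q * z by rewrite (inj_eq (mulfI qn0)).
have := le_trans (hd2 (q * w) (L w) (le_lt_trans (Nq w) w3) qwz (fq w w1 wz)) (hb w w2).
by rewrite lerD2l (ler_nat R 2 1).
Qed.

(* At 0 an a-point of order h gives D_q f the order h - 1 only, as q ^ h <> 1. *)
Lemma JP_origin q f a : 0 < N q -> N q < 1 -> 
  regular f 0 -> f 0 = Some a -> jackson_defect q f a 0 = 0%N -> loc_cst f a 0.
Proof.
move=> q0 q1 rf f0 defect.
case: (JP_vanishing defect rf f0) => [//|[h [k [g [G [/andP[h0 hk] gz cG [d d0 hd]]]]]]].
exfalso.
have qn1 : q != 1 by apply: contraTneq q1 => ->; rewrite Normc.normc1 ltxx.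
have [hg _ _] : [/\ hol g 0, f 0 = Some (a + (0 - 0) ^+ h * g 0) & _] := hd 0 (ltac:(by rewrite subrr Normc.normc0)).
have cq : ccont (fun w => q * w) 0 by apply/hol_ccont/holM/hol_id/hol_cst.
(* This is [f (q w) - f w = (q w - w) D_q f (w)] divided by [w ^+ h], in the limit [w = 0]. The
   factor [q * w - w] adds 1 to the exponent, so the right-hand side vanishes even when [k = h]. *)
have E : q ^+ h * g (q * 0) - g 0 = (q - 1) * 0 ^+ (k - h).+1 * G 0.
  apply: (ccont_lim_unique (f := fun w => q ^+ h * g (q * w) - g w)
     (g := fun w => (q - 1) * w ^+ (k - h).+1 * G w) d0).
  - apply: ccontB; last exact: hol_ccont.
    apply: ccontM; first exact: ccont_cst.
    by apply: (ccont_comp cq); rewrite mulr0; exact: hol_ccont.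
  - apply: ccontM => //; apply/hol_ccont/holM; first exact: hol_cst.
    by apply: holX; exact: hol_id.
  - move=> w wd w0; have [_ fw /(_ w0) [u [v [fu fv e]]]] := hd w wd.
    have qwd : N (q * w - 0) < d.
      by move: wd; rewrite !subr0 => wd; apply: le_lt_trans wd; rewrite Normc.normcM ler_piMl ?normc_ge0 // ltW.
    have [_ fqw _] := hd (q * w) qwd.
    move: fu fv; rewrite fw fqw !subr0 => -[eu] [ev]; rewrite !subr0 in e.
    have qw : q * w - w != 0.
      have -> : q * w - w = (q - 1) * w by ring.
      by rewrite mulf_neq0 // subr_eq0.
    have wh : w ^+ h != 0 by rewrite expf_neq0.
    apply: (mulfI wh).
    have -> : w ^+ h * (q ^+ h * g (q * w) - g w) = u - v.
      by rewrite -eu -ev exprMn; ring.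
    have -> : u - v = w ^+ k * G w * (q * w - w) by rewrite -e divfK.
    by rewrite -[in LHS](subnKC hk) exprD exprS; ring.
have : (q ^+ h - 1) * g 0 = 0.
  by move: E; rewrite [q * 0]mulr0 exprS mul0r mulr0 mul0r mulrBl mul1r.
move=> /eqP; rewrite mulf_eq0 (negbTE gz) orbF subr_eq0 => /eqP qh.
have : N q ^+ h < 1 by rewrite expr_lt1 // normc_ge0.
by rewrite -normcX qh Normc.normc1 ltxx.
Qed.

Lemma weak_regular f z a : (forall w, regular f w \/ weak_pole f w) -> f z = Some a -> regular f z.
Proof. by move=> mf fz; case: (mf z) => // -[]; rewrite fz. Qed.

Lemma JP_omitted q f a : 0 < N q -> N q < 1 -> (forall w, regular f w \/ weak_pole f w) ->
  (forall z, f z = Some a -> jackson_defect q f a z = 0%N) ->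
  (exists z, f z = Some a) -> forall z, f z = Some a.
Proof.
move=> q0 q1 mf JP [z1 fz1].
have [[p lp]|/forallNP nl] := pselect (exists p, loc_cst f a p).
  exact: loc_cst_global lp.
exfalso.
have rf z : f z = Some a -> regular f z by exact: weak_regular.
have n0 z : f z = Some a -> z != 0.
  move=> fz; apply/eqP => z0; rewrite z0 in fz.
  exact: (nl 0 (JP_origin q0 q1 (rf _ fz) fz (JP _ fz))).
have qn z : f z = Some a -> f (q * z) = Some a.
  move=> fz; case: (JP_forward q0 q1 mf (n0 _ fz) (rf _ fz) fz (JP _ fz)) => // lc.
  by case: (nl z).
have orb n : f (q ^+ n * z1) = Some a.
  by elim: n => [|n IH]; rewrite ?mul1r // exprS -mulrA; exact: qn.
(* Otherwise the powers of [N q] would be bounded below, and [le_of_powers] would give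
   [1 <= N q]. *)
have small (d : R) : 0 < d -> exists n, N (q ^+ n * z1 - 0) < d.
  move=> d0; apply: contrapT => /forallNP h.
  have z10 : 0 < N z1 by rewrite normc_gt0 n0.
  have : 1 <= N q.
    apply: (@le_of_powers _ _ _ (N z1 / d)) => [//||n]; first exact: normc_ge0.
    have := h n.+1; rewrite subr0 Normc.normcM normcX => /negP; rewrite -leNgt expr1n => hn.
    by rewrite mulrAC ler_pdivlMr // mul1r mulrC.
  lra.
(* The orbit of [z1] accumulates at 0, which excludes a pole there and then gives [f 0 = Some a],
   against [n0]. *)
case: (mf 0) => [[g [d d0 hd]]|[_ lim]]; last first.
  have [d d0 hd] := lim (N a + 1); have [n hn] := small d d0.
  by have := hd _ a hn (n0 _ (orb n)) (orb n); lra.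
have [hg f0] : hol g 0 /\ f 0 = Some (g 0) by apply: hd; rewrite subrr Normc.normc0.
suff g0 : g 0 = a by have := n0 0; rewrite f0 g0 eqxx => /(_ erefl).
apply/eqP; rewrite -subr_eq0; apply: contraT => ga.
have cg : ccont (fun w => g w - a) 0 by apply: ccontB; [exact: hol_ccont|exact: ccont_cst].
have [d' d'0 hd'] := ccont_neq0 cg ga.
have m0 : 0 < Num.min d d' by rewrite lt_min d0.
have [n] := small _ m0; rewrite lt_min => /andP[/hd [_ fn] /hd'].
by have := orb n; rewrite fn => -[->]; rewrite subrr eqxx.
Qed.

(** * Meromorphic functions that omit three values *)

Lemma omits_inf_cst f (a b : K) : meromorphic f -> (forall z, f z <> None) -> a != b ->
  (forall z, f z <> Some a) -> (forall z, f z <> Some b) ->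
  exists w, forall z, f z = Some w.
Proof.
move=> mf fN ab fa fb.
pose g z : K := odflt 0 (f z).
have fg z : f z = Some (g z) by rewrite /g; have := fN z; case: (f z).
have hg z : hol g z.
  case: (meromorphicP mf z) => [[k [d d0 hd]]|[]]; last by move=> /fN.
  apply: (hol_near (f := k) d0); last by have [] := hd z; rewrite ?subrr ?Normc.normc0.
  by move=> w /hd [_]; rewrite fg => -[].
exists (g 0) => z; rewrite fg; congr Some; apply: (little_picard hg ab).
  by move=> u; apply/eqP => h; apply: (fa u); rewrite fg h.
by move=> u; apply/eqP => h; apply: (fb u); rewrite fg h.
Qed.

Lemma isolated_pole_minus_cst f a z : isolated_pole f z -> isolated_pole (minus_cst f a) z.
Proof.
move=> [fz [g [[d d0 hd] lim]]]; split; first by rewrite /minus_cst fz.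
exists (fun w => g w - a); split.
  exists d => // w wd wz; have [hg fw] := hd w wd wz.
  by split; [apply: holB => //; exact: hol_cst|rewrite /minus_cst fw].
move=> A; have [d' d'0 hd'] := lim (A + N a); exists d' => // w wd wz.
by have := hd' w wd wz; have := lerB_normc (g w) a; lra.
Qed.

Lemma regular_minus_cst f a z : regular f z -> regular (minus_cst f a) z.
Proof.
move=> [g [d d0 hd]]; exists (fun w => g w - a), d => // w /hd [hg fw].
by split; [apply: holB => //; exact: hol_cst|rewrite /minus_cst fw].
Qed.

(** Since [f] omits [a], the function [h = 1 / (f - a)] is entire, with value 0 at the poles of [f];
    it omits the inverses of [b - a] and [c - a]. *)
Lemma omits_fin_cst f (a b c : K) : meromorphic f -> a != b -> a != c -> b != c ->
  (forall z, f z <> Some a) -> (forall z, f z <> Some b) -> (forall z, f z <> Some c) ->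
  exists w, forall z, f z = Some w.
Proof.
move=> mf ab ac bc fa fb fc.
pose F := recip (minus_cst f a).
pose h z : K := odflt 0 (F z).
have rF z : regular F z.
  case: (meromorphicP mf z) => [rf|pf]; last exact/isolated_pole_recip/isolated_pole_minus_cst.
  apply: regular_recip; first exact: regular_minus_cst.
  rewrite /minus_cst; have := fa z; case: (f z) => //= w wa.
  by apply/eqP => -[/eqP]; rewrite subr_eq0 => /eqP e; apply: wa; rewrite e.
have hh z : hol h z.
  have [k [d d0 hd]] := rF z.
  apply: (hol_near (f := k) d0); last by have [] := hd z; rewrite ?subrr ?Normc.normc0.
  by move=> w /hd [_]; rewrite /h => ->.
have hE z w : f z = Some w -> h z = (w - a)^-1.
  move=> fw; rewrite /h /F /recip /minus_cst fw /=.
  by case: eqP => // ->; rewrite invr0.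
have hN z : f z = None -> h z = 0 by move=> fw; rewrite /h /F /recip /minus_cst fw.
have omit x : x != a -> (forall z, f z <> Some x) -> forall z, h z != (x - a)^-1.
  move=> xa fx z; case fz: (f z) => [w|]; last first.
    by rewrite (hN _ fz) eq_sym invr_eq0 subr_eq0.
  rewrite (hE _ _ fz); apply/eqP => /invr_inj /addIr e; apply: (fx z).
  by rewrite fz e.
have bca : (b - a)^-1 != (c - a)^-1.
  by rewrite (inj_eq invr_inj) (inj_eq (addIr _)).
have ba : b != a by rewrite eq_sym.
have ca : c != a by rewrite eq_sym.
have hc := little_picard hh bca (omit b ba fb) (omit c ca fc).
have fE z w : f z = Some w -> w = a + (h 0)^-1.
  by move=> fw; rewrite -(hc z) (hE _ _ fw) invrK addrC subrK.
(* [h = 0] identically would make [f] infinite everywhere, which is excluded because a pole has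
   finite values around it. *)
have [h0|h0] := eqVneq (h 0) 0; last first.
  exists (a + (h 0)^-1) => z; case fz: (f z) => [w|]; first by rewrite (fE _ _ fz).
  by have := hc z; rewrite hN // => e; rewrite -e eqxx in h0.
have fN z : f z = None.
  case fz: (f z) => [w|//]; have := fE _ _ fz; rewrite h0 invr0 addr0 => e.
  by case: (fa z); rewrite fz e.
case: (meromorphicP mf 0) => [[g [d d0 hd]]|[_ [g [[d d0 hd] _]]]].
  by have [] := hd 0; rewrite ?subrr ?Normc.normc0 ?fN.
have [w [wd _ w0]] := exists_near_neq (0 : K) [::] d0.
by have [] := hd w wd w0; rewrite fN.
Qed.

Lemma JP_cst_or_omits q f (p : sphere R) : 0 < N q -> N q < 1 -> meromorphic f ->
  jackson_picard_value q f p ->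
  (exists w, forall z, f z = Some w) \/ forall z, f z <> p.
Proof.
move=> q0 q1 mf JP.
have [[z fz]|/forallNP] := pselect (exists z, f z = p); last by right.
left; case: p JP fz => [a|] JP fz.
  exists a; apply: (JP_omitted q0 q1 (meromorphic_weak mf)); last by exists z.
  exact: nJ_fin_defect.
(* At infinity the argument is applied to 1 / f and the value 0. It would make [f] infinite
   everywhere, which [meromorphic] excludes near 0. *)
have H : forall z, recip f z = Some 0.
  apply: (JP_omitted q0 q1 (meromorphic_recip mf)); last by exists z; rewrite /recip fz.
  exact: nJ_fin_defect.
have fN w : f w = None.
  have := H w; rewrite /recip; case: (f w) => // x; case: eqP => // /eqP x0 [/eqP].
  by rewrite invr_eq0 (negbTE x0).
case: (meromorphicP mf 0) => [[g [d d0 hd]]|[_ [g [[d d0 hd] _]]]].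
  by have [] := hd 0; rewrite ?subrr ?Normc.normc0 ?fN.
have [w [wd _ w0]] := exists_near_neq (0 : K) [::] d0.
by have [] := hd w wd w0; rewrite fN.
Qed.

End JacksonPicard.

Theorem theorem2p5 (R : realType) (q : Cplx R) (f : Cplx R -> sphere R)
  (q0 : 0 < Normc.normc q) (q1 : Normc.normc q < 1)
  (f_mero : meromorphic f) (f_order : mero_order f = 0%E)
  (a b c : sphere R) (ab : a <> b) (ac : a <> c) (bc : b <> c)
  (a_JP : jackson_picard_value q f a)
  (b_JP : jackson_picard_value q f b)
  (c_JP : jackson_picard_value q f c) :
  exists w : Cplx R, forall z : Cplx R, f z = Some w.
Proof.
have [//|fa] := JP_cst_or_omits q0 q1 f_mero a_JP.
have [//|fb] := JP_cst_or_omits q0 q1 f_mero b_JP.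
have [//|fc] := JP_cst_or_omits q0 q1 f_mero c_JP.
have neq (x y : Cplx R) : Some x <> Some y -> x != y.
  by move=> h; apply/eqP => e; apply: h; rewrite e.
(* Distinctness leaves at most one value at infinity; if there is one, [f] is entire and omits the
   two others. *)
case: a b c ab ac bc {a_JP b_JP c_JP} fa fb fc => [a|] [b|] [c|] // ab ac bc fa fb fc.
- exact: (@omits_fin_cst _ f a b c f_mero (neq _ _ ab) (neq _ _ ac) (neq _ _ bc)).
- exact: (@omits_inf_cst _ f a b f_mero fc (neq _ _ ab)).
- exact: (@omits_inf_cst _ f a c f_mero fb (neq _ _ ac)).
- exact: (@omits_inf_cst _ f b c f_mero fa (neq _ _ bc)).
Qed.
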